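(* Let customers arrive according to the stationary Hawkes process with parameters $(\lambda_0,m,f)$ and i.i.d. job sizes, and let the service rate be $\mu\in[\underline\mu,\bar\mu]$ where, for some $\varepsilon>0$ and $\underline\mu>0$, $\lambda_0\mathbb{E}[V]/(1-m)<\underline\mu-\varepsilon$. Put $\tilde W(t)=\max_{s\ge0}R^{\leftarrow}(t,s)$ for $t\in\mathbb{R}$ and $\tilde X(t)=\arg\max_{s\ge0}R^{\leftarrow}(t,s)$ for $t\ge0$. Then the process $\tilde X(\cdot)$ is stationary. In addition, for each $t\ge0$, almost surely $\tilde X(t)$ equals the observed busy period corresponding to $\tilde W(\cdot)$, i.e. $\tilde X(t)=t-\sup\{s\le t:\tilde W(s)=0\}$.
   Context: Stationary Hawkes process with parameters $(\lambda_0,m,f)$: $\lambda_0>0$, $0<m<1$, $f$ a probability density on $[0,\infty)$, $h=mf$. Immigrants arrive at the points of a homogeneous Poisson process of rate $\lambda_0$ on $(-\infty,\infty)$; each immigrant starts a cluster, in which the immigrant and every further event at time $u$ independently generate children at the points of a Poisson process on $[u,\infty)$ with rate $h(t-u)$; clusters relative to their immigrant times are i.i.d. and independent of the immigrant process. The collection of all events of all clusters is the stationary Hawkes process. The job sizes of customers are i.i.d. copies of a positive random variable $V$ with continuous density and $\mathbb{E}[V]=1$, independent of the arrival times. For $t\in\mathbb{R}$, $s\ge0$, $R^{\leftarrow}(t,s)$ is the total size of jobs arriving in $[t-s,t)$ minus $\mu s$. *)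

(* Defs.v *)
From HB Require Import structures.
From mathcomp Require Import all_boot all_order all_algebra finmap.
From mathcomp Require Import all_classical all_reals all_analysis.
From mathcomp Require Import measurable_realfun.

Set Implicit Arguments.
Unset Strict Implicit.
Unset Printing Implicit Defensive.

Import Order.TTheory GRing.Theory Num.Theory.
Import numFieldNormedType.Exports.

Local Open Scope classical_set_scope.
Local Open Scope ring_scope.

(* Ulam-Harris labels: (i, [::]) is the i-th immigrant and (i, k :: w) is the
   k-th child of (i, w). *)
Definition label : Type := (nat * seq nat)%type.

Definition prob_density (R : realType) (D : set R) (f : R -> R) : Prop :=
  [/\ measurable_fun D f,
      (forall x, D x -> 0 <= f x) &
      (\int[lebesgue_measure]_(x in D) (f x)%:E = 1)%E].

Section Independence.
Context d (T : measurableType d) (R : realType) (P : probability T R).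

Definition sigma_of (I : Type) d' (E : measurableType d') (X : I -> T -> E) :
    set (set T) :=
  <<s \bigcup_i preimage_set_system setT (X i) measurable >>.

Definition mutual_independence (I : choiceType) (F : I -> set (set T)) : Prop :=
  forall (J : {fset I}) (A : I -> set T),
    (forall i, i \in J -> F i (A i)) ->
    P (\bigcap_(i in [set` J]) A i) = (\prod_(i <- J) P (A i))%E.

End Independence.

Section PoissonProcess.
Context d (T : measurableType d) (R : realType) (P : probability T R).

(* A point process is given by an enumeration xi of its points; there may be
   finitely many of them, so xi n w is an infinite value when the n-th point is
   absent. *)
Definition nb_points (xi : nat -> T -> \bar R) (A : set R) (w : T) : \bar R :=
  counting [set n | (EFin @` A) (xi n w)].

Definition intensity (D : set R) (rate : R -> R) (A : set R) : \bar R :=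
  (\int[lebesgue_measure]_(x in A `&` D) (rate x)%:E)%E.

(* The second argument of poisson_prob is a dummy. We avoid poisson_pmf, which
   is not the Poisson mass function when the parameter is 0. *)
Definition poisson_process (D : set R) (rate : R -> R)
    (xi : nat -> T -> \bar R) : Prop :=
  (forall n, measurable_fun [set: T] (xi n)) /\
  forall (k : nat) (A : 'I_k -> set R) (c : 'I_k -> nat),
    (forall i, measurable (A i)) ->
    trivIset [set: 'I_k] A ->
    (forall i, (intensity D rate (A i) < +oo)%E) ->
    P (\bigcap_(i in [set: 'I_k])
         [set w | nb_points xi (A i) w = (c i)%:R%:E]) =
    (\prod_(i < k)
       poisson_prob (fine (intensity D rate (A i))) 0 [set c i])%E.

End PoissonProcess.

Section Hawkes.
Context d (T : measurableType d) (R : realType) (P : probability T R).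

(* The children of the individual e are born at the points of (off e),
   translated by the birth time of e. The birth time is finite exactly when
   all the points involved are present. *)
Fixpoint birth_time (imm : nat -> T -> \bar R)
    (off : label -> nat -> T -> \bar R) (i : nat) (p : seq nat) (w : T) :
    \bar R :=
  if p is k :: p' then (birth_time imm off i p' w + off (i, p') k w)%E
  else imm i w.

Definition arrival (imm : nat -> T -> \bar R)
    (off : label -> nat -> T -> \bar R) (e : label) (w : T) : \bar R :=
  birth_time imm off e.1 e.2 w.

Record stationary_hawkes (lambda0 m : R) (f : R -> R)
    (imm : nat -> T -> \bar R) (off : label -> nat -> T -> \bar R) : Prop := {
  immigrants_poisson : poisson_process P setT (fun=> lambda0) imm ;
  offspring_poisson : forall e,
    poisson_process P `[0, +oo[ (fun x => m * f x) (off e) ;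
  hawkes_independence :
    mutual_independence P
      (fun o : option label =>
         if o is Some e then sigma_of (off e) else sigma_of imm) }.

(* S e is the size of the job brought by the individual e. *)
Definition iid_job_sizes (arr : label -> T -> \bar R) (V : {RV P >-> R})
    (S : label -> {RV P >-> R}) : Prop :=
  (forall e B, measurable B -> distribution P (S e) B = distribution P V B) /\
  mutual_independence P
    (fun o : option label =>
       if o is Some e then sigma_of (fun _ : unit => S e : T -> R)
       else sigma_of arr).

Definition positive_with_continuous_density (V : {RV P >-> R}) : Prop :=
  {ae P, forall w, 0 < V w} /\
  exists g : R -> R,
    [/\ prob_density `]0, +oo[ g,
        (forall x, 0 < x -> {for x, continuous g}) &
        forall B, measurable B -> distribution P V B =
          (\int[lebesgue_measure]_(x in B `&` `]0%R, +oo[) (g x)%:E)%E].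

End Hawkes.

Section Queue.
Context d (T : measurableType d) (R : realType).
Variables (arr : label -> T -> \bar R) (S : label -> T -> R) (mu : R).

Definition backward_input (t s : R) (w : T) : \bar R :=
  (\esum_(e in [set e | ((t - s)%:E <= arr e w)%E /\ (arr e w < t%:E)%E])
     (S e w)%:E - (mu * s)%:E)%E.

Definition workload (t : R) (w : T) : \bar R :=
  ereal_sup [set backward_input t s w | s in [set s | 0 <= s]].

Definition maximizers (t : R) (w : T) : set R :=
  [set s | 0 <= s /\
     forall s', 0 <= s' -> (backward_input t s' w <= backward_input t s w)%E].

Definition arg_maximum (t : R) (w : T) : R := xget 0 (maximizers t w).

(* +oo if the workload never vanishes on ]-oo, t]. *)
Definition observed_busy_period (t : R) (w : T) : \bar R :=
  (t%:E -
   ereal_sup [set s%:E | s in [set s | (s <= t)%R /\ workload s w = 0]])%E.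

End Queue.

(* Strict stationarity of (X t) for t >= 0. The variables X t are only required
   to be measurable for the completion of P, i.e. to agree almost surely with
   random variables Y t; the laws do not depend on the choice of Y. *)
Definition stationary_process d (T : measurableType d) (R : realType)
    (P : probability T R) (X : R -> T -> R) : Prop :=
  exists Y : R -> {RV P >-> R},
    (forall t, 0 <= t -> {ae P, forall w, X t w = Y t w}) /\
    forall (n : nat) (t : 'I_n -> R) (u : R) (B : 'I_n -> set R),
      (forall i, 0 <= t i) -> 0 <= u -> (forall i, measurable (B i)) ->
      P (\bigcap_(i in [set: 'I_n]) (Y (t i + u) @^-1` B i)) =
      P (\bigcap_(i in [set: 'I_n]) (Y (t i) @^-1` B i)).

(* Main.v *)
(* The law of the input process is handled through the Laplace functionals
   E exp(- sum_e S_e h(imm_e, arr_e)), where e runs over all individuals, imm_e is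
   the birth time of the immigrant starting the cluster of e and arr_e the arrival
   time of e. The branching structure expresses them as limits of exponentials of
   Lebesgue integrals, whence their invariance under translation, their
   factorization over disjoint sets of immigrants, and the bound lambda0 / (1 - m)
   on the mean rate of arriving work. Stability follows by a zero-one law for the
   event that the work of the past exceeds every line of slope mu_lo - eps (it is
   independent of the clusters started after any fixed time, hence of itself), and
   by Loynes' argument excluding probability one. So the backward path
   R(t, s) tends to -oo; it only jumps up at arrivals, and has therefore a maximizer
   which is 0 or t - arr_e. The maximizer X is unique because the job sizes have no
   atoms and are independent of everything else. Then R(t - X, .) <= 0, i.e. the
   workload vanishes at t - X, and R(s, s - (t - X)) > 0 for t - X < s <= t, i.e.
   it does not vanish later. Finally X is a measurable functional of the input path
   seen from t, whose law does not depend on t. *)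

Require Import Defs.
From HB Require Import structures.
From mathcomp Require Import all_boot all_order all_algebra finmap.
From mathcomp Require Import all_classical all_reals all_analysis.
From mathcomp Require Import measurable_realfun.
From mathcomp Require Import ring lra zify.

Set Implicit Arguments.
Unset Strict Implicit.
Unset Printing Implicit Defensive.

Import Order.TTheory GRing.Theory Num.Theory.
Import numFieldNormedType.Exports.

Local Open Scope classical_set_scope.
Local Open Scope ring_scope.

(** * The function exp(-x) on the extended reals *)

(** The obstacle is that the process is given by enumerations indexed by labels, on which time
    translation does not act: no map of the probability space shifts the paths. Stationarity and
    independence must therefore be statements about laws of functionals that forget the labels.
    Exponentials of minus sums suit this purpose because they are multiplicative, lie in [[0, 1]]
    and make sense before any sum is known to be finite (an infinite sum gives 0). Local finiteness
    comes only afterwards, from a mean bound read off the Laplace functional near 0. A path is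
    encoded as the family of these exponentials over all finite lists of windows; the law of a
    family of [[0, 1]]-valued variables that is closed under products is determined by its first
    moments. Recording the birth time of the immigrant next to each arrival time lets clusters be
    separated by their origin, as the zero-one law demands. The maximizer is unique only almost
    surely, so measurability and stationarity are proved for an explicit functional of the encoded
    path that agrees with it on regular paths. *)

Section NegativeExponential.
Context (R : realType).
Implicit Types x y : \bar R.
Local Open Scope ereal_scope.

Definition en (x : \bar R) : \bar R := expeR (- x).
Arguments en : simpl never.

Lemma en0 : en 0 = 1.
Proof. by rewrite /en oppe0 expeR0. Qed.

Lemma eny : en +oo = 0.
Proof. by []. Qed.

Lemma en_ge0 x : 0 <= en x.
Proof. exact: expeR_ge0. Qed.

Lemma lee_en x y : (en x <= en y) = (y <= x).
Proof. by rewrite /en lee_expeR leeN2. Qed.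

Lemma lte_en x y : (en x < en y) = (y < x).
Proof. by rewrite /en lte_expeR lteN2. Qed.

Lemma en_le1 x : 0 <= x -> en x <= 1.
Proof. by rewrite -en0 lee_en. Qed.

Lemma en_fin_num x : 0 <= x -> en x \is a fin_num.
Proof.
move=> x0; rewrite ge0_fin_numE ?en_ge0//.
by rewrite (le_lt_trans (en_le1 x0))// ltry.
Qed.

Lemma enD x y : 0 <= x -> 0 <= y -> en (x + y) = en x * en y.
Proof. by move=> x0 y0; rewrite /en -expeRD oppeD// ge0_adde_def. Qed.

Lemma en_lne x : 0 <= x -> en (- lne x) = x.
Proof. by move=> x0; rewrite /en oppeK; apply/eqP; rewrite lneK_eq. Qed.

Lemma enN_le1B x : 0 <= x -> 1 - en x <= x.
Proof.
case: x => [r| |]//; last by move=> _; rewrite leey.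
rewrite lee_fin => r0; rewrite /en/= -EFinB lee_fin lerBlDr -lerBlDl.
by rewrite (le_trans (expR_ge1Dx _)).
Qed.

Lemma measurable_en (D : set (\bar R)) : measurable D -> measurable_fun D en.
Proof.
move=> mD; apply: (measurability _ (ErealGenOInfty.measurableE R)) => //.
move=> /= _ [_ [y ->] <-]; apply: measurableI => //.
have [y0|y0] := ltP y%:E 0.
  rewrite (_ : _ @^-1` _ = setT)//; apply/seteqP; split => //= x _.
  by rewrite /preimage/= in_itv/= andbT (lt_le_trans y0)// en_ge0.
rewrite (_ : _ @^-1` _ = [set` `]-oo, - lne y%:E[%O]); last first.
  apply/seteqP; split => x /=; rewrite !in_itv/= ?andbT;
    by rewrite -{1}(en_lne y0) lte_en.
exact: emeasurable_itv.
Qed.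

Lemma en_sum (I : Type) (s : seq I) (a : I -> \bar R) : (forall i, 0 <= a i) ->
  (en (\sum_(i <- s) a i) = \prod_(i <- s) en (a i)).
Proof.
move=> a0; elim: s => [|i s ih]; first by rewrite !big_nil en0.
by rewrite !big_cons enD ?ih// sume_ge0.
Qed.

(** Exponents are recovered from expectations of [en] by this map, and inherit their measurability
    through it. *)
Lemma measurable_Nlne : measurable_fun [set: \bar R] (fun x => - lne x).
Proof.
apply: (measurability _ (ErealGenOInfty.measurableE R)) => //.
move=> /= _ [_ [y ->] <-]; apply: measurableI => //.
rewrite (_ : _ @^-1` _ = [set` `]-oo, en y%:E[%O]); first exact: emeasurable_itv.
suff E x : (y%:E < - lne x) = (x < en y%:E).
  by apply/seteqP; split => x /=; rewrite !in_itv/= ?andbT E.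
have [x0|x0] := leP 0 x; first by rewrite -[in RHS](en_lne x0) lte_en.
by rewrite le0_lneNy ?(ltW x0)// ltry (lt_le_trans x0)// en_ge0.
Qed.

Lemma en_sup (x : nat -> \bar R) :
  en (ereal_sup (range x)) = ereal_inf (range (en \o x)).
Proof.
apply/eqP; rewrite eq_le; apply/andP; split.
  apply: le_ereal_inf_tmp => _ [n _ <-] /=; rewrite lee_en.
  by apply: ereal_sup_ubound; exists n.
have z0 : 0 <= ereal_inf (range (en \o x)).
  by apply: le_ereal_inf_tmp => _ [n _ <-]; exact: en_ge0.
rewrite -(en_lne z0) lee_en; apply: ge_ereal_sup => _ [n _ <-].
by rewrite -lee_en en_lne//; apply: ereal_inf_lbound; exists n.
Qed.

Lemma cvg_en (x : nat -> \bar R) : nondecreasing_seq x ->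
  en \o x @ \oo --> en (limn x).
Proof.
move=> ndx; have /ereal_nondecreasing_cvgn/cvg_lim-> // := ndx.
rewrite en_sup; apply: ereal_nonincreasing_cvgn => m n mn /=.
by rewrite lee_en ndx.
Qed.

Lemma cvg_en_series (a : nat -> \bar R) : (forall n, 0 <= a n) ->
  (fun n => en (\sum_(0 <= k < n) a k)) @ \oo --> en (\sum_(k <oo) a k).
Proof.
move=> a0; apply: (@cvg_en (fun n => \sum_(0 <= k < n) a k)).
by apply/nondecreasing_seqP => n; rewrite big_nat_recr//= leeDl.
Qed.

End NegativeExponential.

Section BoundedConvergence.
Context d (T : measurableType d) (R : realType) (P : probability T R).
Local Open Scope ereal_scope.

Lemma bounded_cvg (f : nat -> T -> \bar R) (g : T -> \bar R) :
  (forall n, measurable_fun [set: T] (f n)) ->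
  (forall n x, 0 <= f n x <= 1) ->
  (forall x, f ^~ x @ \oo --> g x) ->
  \int[P]_x f n x @[n --> \oo] --> \int[P]_x g x.
Proof.
move=> mf f01 fg.
have mg : measurable_fun [set: T] g.
  by apply: (emeasurable_fun_cvg f) => // x _; exact: fg.
have [] := @dominated_convergence _ _ _ P setT measurableT f g (cst 1) => //.
- exact/aeW.
- exact: finite_measure_integrable_cst.
- apply/aeW => x n _ /=; rewrite gee0_abs; by have /andP[] := f01 n x.
Qed.

Lemma bounded_integrable (f : T -> \bar R) : measurable_fun [set: T] f ->
  (forall x, 0 <= f x <= 1) -> P.-integrable [set: T] f.
Proof.
move=> mf f01; apply: (@le_integrable _ _ _ _ _ _ _ (cst 1)) => //.
- move=> x _ /=; rewrite gee0_abs; last by have /andP[] := f01 x.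
  by rewrite normr1; have /andP[] := f01 x.
- exact: finite_measure_integrable_cst.
Qed.

End BoundedConvergence.

(** * Laws are determined by multiplicative families *)

Section Threshold.
Context (R : realType).
Implicit Types (c u x : R).

Lemma bernoulli_inequality x n : -1 <= x -> 1 + n%:R * x <= (1 + x) ^+ n.
Proof.
move=> x1; elim: n => [|n ih]; first by rewrite mul0r addr0 expr0.
rewrite exprS; apply: (@le_trans _ _ ((1 + x) * (1 + n%:R * x))).
  by rewrite -[in leLHS]natr1; have : 0 <= n%:R * x ^+ 2 :> R; [rewrite mulr_ge0// sqr_ge0|nra].
by rewrite ler_wpM2l//; lra.
Qed.

Lemma cvg_arithmetic_geometric q : 0 <= q < 1 ->
  n.+1%:R * q ^+ n @[n --> \oo] --> (0 : R).
Proof.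
(* Since [q <= s * s], one factor [s ^+ n] can be spent on [n.+1]: Bernoulli's inequality for
   [s^-1 = 1 + h] bounds their product by [h^-1], where [h <= 1] because [s >= 1/2]. The other
   factor decays. *)
move=> /andP[q0 q1]; pose s := (1 + q) / 2; pose h := s^-1 - 1.
have [s0 s1] : 0 < s /\ s < 1 by rewrite /s; split; lra.
have h0 : 0 < h by rewrite /h subr_gt0 invf_gt1.
have h1 : h <= 1.
  by rewrite /h lerBlDr -div1r ler_pdivrMr//; rewrite /s; lra.
apply: (@squeeze_cvgr _ _ _ _ (cst 0) (fun n => h^-1 * s ^+ n)).
- near=> n; rewrite mulr_ge0 ?exprn_ge0//=.
  apply: (@le_trans _ _ (n.+1%:R * (s ^+ n * s ^+ n))).
    have qs : q <= s * s by rewrite /s; have := sqr_ge0 (1 - q); nra.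
    by rewrite ler_wpM2l// -exprMn lerXn2r// ?nnegrE (le_trans q0).
  rewrite mulrA ler_wpM2r ?exprn_ge0 ?(ltW s0)//.
  rewrite -ler_pdivlMr ?exprn_gt0// -exprVn.
  rewrite ler_pdivlMl// (_ : s^-1 = 1 + h); last by rewrite /h; ring.
  apply: le_trans (bernoulli_inequality n _); last by lra.
  by rewrite -natr1; nra.
- exact: cvg_cst.
- rewrite -[X in _ --> X](mulr0 h^-1); apply: cvgM; first exact: cvg_cst.
  by apply: cvg_expr; rewrite gtr0_norm.
Unshelve. all: by end_near. Qed.

(** An exponent of order [N c^-N]: multiplied by [u^N] it tends to 0 when [u < c], and is at least
    [N] when [u >= c]. The factor [N] settles the borderline case [u = c]. *)
Definition threshold_exponent c N := (Num.truncn (N%:R * c ^- N)).+1.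

Lemma cvg_threshold c u : 0 < c <= 1 -> 0 <= u <= 1 ->
  (1 - u ^+ N) ^+ threshold_exponent c N @[N --> \oo] --> ((u < c)%R%:R : R).
Proof.
move=> /andP[c0 c1] /andP[u0 u1].
have uN01 N : 0 <= u ^+ N <= 1 by rewrite exprn_ge0// exprn_ile1.
have M_ge N : N%:R * c ^- N <= (threshold_exponent c N)%:R.
  apply/ltW; rewrite /threshold_exponent; apply: (truncnS_gt _).
have M_le N : (threshold_exponent c N)%:R <= N%:R * c ^- N + 1.
  rewrite /threshold_exponent -natr1 lerD2r truncn_le mulr_ge0//.
  by rewrite invr_ge0 exprn_ge0// ltW.
have [uc|cu] := ltP u c.
  (* Bernoulli's inequality gives the lower bound [1 - M u^N]. The [+ 1] due to rounding in [M] is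
     absorbed because [u^N <= (u / c)^N], as [c <= 1]. *)
  apply: (@squeeze_cvgr _ _ _ _ (fun N => 1 - N.+1%:R * (u / c) ^+ N) (cst 1)).
  - near=> N; apply/andP; split; last first.
      by rewrite exprn_ile1//; have := uN01 N; lra.
    apply: le_trans (bernoulli_inequality _ _); last by have := uN01 N; lra.
    rewrite mulrN lerD2l lerN2.
    apply: (@le_trans _ _ ((N%:R * c ^- N + 1) * u ^+ N)).
      by rewrite ler_wpM2r//; have /andP[] := uN01 N.
    rewrite mulrDl mul1r -mulrA [c ^- N * _]mulrC -exprVn -exprMn -[in leRHS]natr1 mulrDl mul1r.
    rewrite lerD2l lerXn2r ?nnegrE ?divr_ge0 ?(ltW c0)//.
    by rewrite ler_pdivlMr// ler_piMr.
  - rewrite -[X in _ --> X]subr0; apply: cvgB; first exact: cvg_cst.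
    apply: cvg_arithmetic_geometric.
    by rewrite divr_ge0 ?(ltW c0)//= ltr_pdivrMr// mul1r.
  - exact: cvg_cst.
(* The product of [(1 - u^N)^M] and [(1 + u^N)^M] is at most 1, and the second factor is at least
   [1 + M u^N >= N + 1] by Bernoulli's inequality. *)
apply: (@squeeze_cvgr _ _ _ _ (cst 0) (@harmonic R)).
- near=> N; apply/andP; split.
    by rewrite /= exprn_ge0//; have := uN01 N; lra.
  set M := threshold_exponent c N.
  rewrite /= -[leRHS]mul1r ler_pdivlMr//.
  apply: (@le_trans _ _ ((1 - u ^+ N) ^+ M * (1 + u ^+ N) ^+ M)).
    rewrite ler_wpM2l ?exprn_ge0//; first by have := uN01 N; lra.
    apply: le_trans (bernoulli_inequality _ _); last by have := uN01 N; lra.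
    rewrite -natr1 addrC lerD2l.
    apply: (@le_trans _ _ (N%:R * c ^- N * c ^+ N)).
      by rewrite -mulrA mulVf ?mulr1// expf_neq0// gt_eqF.
    apply: ler_pM => //.
    - by rewrite mulr_ge0// invr_ge0 exprn_ge0// ltW.
    - by rewrite exprn_ge0// ltW.
    - by rewrite lerXn2r ?nnegrE// ltW.
  rewrite -exprMn exprn_ile1//; have := uN01 N; nra.
- exact: cvg_cst.
- exact: cvg_harmonic.
Unshelve. all: by end_near. Qed.

End Threshold.

(** * The path space and its cylinder sigma-algebra *)

Section PathSpace.
Context (I : Type) (R : realType).

(** Strict upper bounds at finitely many indices: their indicators are products of the limits in
    [cvg_threshold], and intersections are concatenations of lists. *)
Definition cylinder (s : seq (I * R)) : set (I -> R) :=
  [set x | all (fun ic => x ic.1 < ic.2) s].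

Definition paths := g_sigma_algebraType (range cylinder).

Lemma setI_closed_cylinder : setI_closed (range cylinder).
Proof.
move=> _ _ [s _ <-] [t _ <-]; exists (s ++ t) => //.
by apply/seteqP; split => x /=; rewrite /cylinder/= all_cat => /andP.
Qed.

Lemma measurable_coordinate (i : I) :
  measurable_fun [set: paths] (fun x : paths => x i).
Proof.
apply: (measurability _ (RGenInftyO.measurableE R)).
move=> /= _ [_ [c ->] <-]; apply: sub_sigma_algebra; exists [:: (i, c)] => //.
by apply/seteqP; split => x /=; rewrite /cylinder/= in_itv/= andbT; [|case].
Qed.

Lemma measurable_to_paths d (T : measurableType d) (X : T -> paths) :
  (forall i, measurable_fun [set: T] (fun w => X w i)) ->
  measurable_fun [set: T] X.
Proof.
move=> mX; apply: (@measurability _ _ T paths setT X (range cylinder)) => //.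
move=> _ [_ [s _ <-] <-]; rewrite setTI; elim: s => [|[i c] s ih].
  by rewrite (_ : _ @^-1` _ = setT)//; apply/seteqP; split.
rewrite (_ : _ @^-1` _ = (fun w => X w i) @^-1` `]-oo, c[ `&`
    X @^-1` cylinder s).
  by apply: measurableI ih; rewrite -[X in measurable X]setTI; exact: mX.
apply/seteqP; split => x; rewrite /cylinder/= in_itv/=.
  by move=> /andP.
by move=> [-> ->].
Qed.

End PathSpace.

Section MultiplicativeClass.
Context d (T : measurableType d) (R : realType) (P : probability T R).

Definition unit_valued (f : T -> R) :=
  measurable_fun [set: T] f /\ forall x, 0 <= f x <= 1.

Lemma unit_valuedM f g : unit_valued f -> unit_valued g ->
  unit_valued (fun x => f x * g x).
Proof.
move=> [mf f01] [mg g01]; split; first exact: measurable_funM.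
by move=> x; have := f01 x; have := g01 x; nra.
Qed.

Lemma unit_valued_oneB f : unit_valued f -> unit_valued (fun x => 1 - f x).
Proof.
move=> [mf f01]; split; first exact: measurable_funB.
by move=> x; have := f01 x; lra.
Qed.

Lemma unit_valued_indic A : measurable A -> unit_valued (\1_A : T -> R).
Proof.
move=> mA; split; first exact: measurable_indic.
by move=> x; rewrite indicE; case: (_ \in _); rewrite ?lexx ?ler01.
Qed.

Lemma unit_valued_integrable f : unit_valued f ->
  P.-integrable [set: T] (EFin \o f).
Proof.
move=> [mf f01]; apply: (@le_integrable _ _ _ _ _ _ _ (EFin \o cst 1)) => //.
- exact/measurable_EFinP.
- move=> x _ /=; rewrite lee_fin normr1 ger0_norm; by have /andP[] := f01 x.
- exact: finite_measure_integrable_cst.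
Qed.

Lemma unit_valued_lim v w : (forall n : nat, unit_valued (v n)) ->
  (forall x, v ^~ x @ \oo --> (w x : R)) -> unit_valued w.
Proof.
move=> vv vw; split.
  apply: (@measurable_fun_cvg _ _ _ setT v) => [n|x _]; last exact: vw.
  exact: (vv n).1.
move=> x; have lw : limn (v ^~ x) = w x by exact/cvg_lim/vw.
apply/andP; split; rewrite -lw.
  apply: limr_ge; first exact: cvgP (vw x).
  by near=> n; have /andP[] := (vv n).2 x.
apply: limr_le; first exact: cvgP (vw x).
by near=> n; have /andP[] := (vv n).2 x.
Unshelve. all: by end_near. Qed.

Lemma unit_valued_cvg_integral v w : (forall n : nat, unit_valued (v n)) ->
  (forall x, v ^~ x @ \oo --> (w x : R)) ->
  (\int[P]_x (v n x)%:E @[n --> \oo] --> \int[P]_x (w x)%:E)%E.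
Proof.
move=> vv vw; apply: (@bounded_cvg _ _ _ P (fun n x => (v n x)%:E)).
- by move=> n; apply/measurable_EFinP; exact: (vv n).1.
- by move=> n x; rewrite !lee_fin; exact: (vv n).2.
- by move=> x; apply: cvg_EFin; [exact: nearW|exact: vw].
Qed.

Variables (I : Type) (zero : I) (add : I -> I -> I) (U1 U2 : I -> T -> R).
Hypotheses (U1v : forall i, unit_valued (U1 i))
  (U2v : forall i, unit_valued (U2 i)).
Hypotheses (U10 : forall x, U1 zero x = 1) (U20 : forall x, U2 zero x = 1).
Hypotheses (U1D : forall i j x, U1 (add i j) x = U1 i x * U1 j x)
  (U2D : forall i j x, U2 (add i j) x = U2 i x * U2 j x).

(** The weights make the induction run: each factor [1 - U j], and in the limit each indicator of
    [U j < c], is absorbed into them while equality of moments against the whole family persists. *)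
Definition same_moments (w1 w2 : T -> R) :=
  [/\ unit_valued w1, unit_valued w2 &
      forall i, (\int[P]_x (w1 x * U1 i x)%:E = \int[P]_x (w2 x * U2 i x)%:E)%E].

Lemma same_moments_oneB w1 w2 j : same_moments w1 w2 ->
  same_moments (fun x => w1 x * (1 - U1 j x)) (fun x => w2 x * (1 - U2 j x)).
Proof.
move=> [v1 v2 e]; split.
- exact/unit_valuedM/unit_valued_oneB.
- exact/unit_valuedM/unit_valued_oneB.
move=> i.
under eq_integral do rewrite mulrBr mulr1 mulrBl -mulrA -U1D EFinB.
under [in RHS]eq_integral do rewrite mulrBr mulr1 mulrBl -mulrA -U2D EFinB.
rewrite integralB//; last 2 first.
- exact/(@unit_valued_integrable (fun x => _ * _))/unit_valuedM.
- exact/(@unit_valued_integrable (fun x => _ * _))/unit_valuedM.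
rewrite integralB// ?e//.
- exact/(@unit_valued_integrable (fun x => _ * _))/unit_valuedM.
- exact/(@unit_valued_integrable (fun x => _ * _))/unit_valuedM.
Qed.

Lemma same_moments_lim w1 w2 v1 v2 :
  (forall n, same_moments (v1 n) (v2 n)) ->
  (forall x, v1 ^~ x @ \oo --> (w1 x : R)) ->
  (forall x, v2 ^~ x @ \oo --> (w2 x : R)) ->
  same_moments w1 w2.
Proof.
move=> s l1 l2.
have vv1 n : unit_valued (v1 n) by have [] := s n.
have vv2 n : unit_valued (v2 n) by have [] := s n.
split; [exact: unit_valued_lim l1|exact: unit_valued_lim l2|move=> i].
have h1 : (\int[P]_x (v1 n x * U1 i x)%:E @[n --> \oo] --> \int[P]_x (w1 x * U1 i x)%:E)%E.
  apply: (@unit_valued_cvg_integral (fun n x => _ * _)) => [n|x].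
    exact: unit_valuedM.
  by apply: cvgM; [exact: l1|exact: cvg_cst].
have h2 : (\int[P]_x (v2 n x * U2 i x)%:E @[n --> \oo] --> \int[P]_x (w2 x * U2 i x)%:E)%E.
  apply: (@unit_valued_cvg_integral (fun n x => _ * _)) => [n|x].
    exact: unit_valuedM.
  by apply: cvgM; [exact: l2|exact: cvg_cst].
rewrite -(cvg_lim _ h1)// -(cvg_lim _ h2)//; congr (limn _).
by apply/funext => n; have [_ _] := s n.
Qed.

Fixpoint iter_add n j := if n is n'.+1 then add j (iter_add n' j) else zero.

Lemma iter_addE1 n j x : U1 (iter_add n j) x = U1 j x ^+ n.
Proof. by elim: n => [|n ih] /=; rewrite ?U10// U1D ih exprS. Qed.

Lemma iter_addE2 n j x : U2 (iter_add n j) x = U2 j x ^+ n.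
Proof. by elim: n => [|n ih] /=; rewrite ?U20// U2D ih exprS. Qed.

Lemma same_moments_exp w1 w2 j N M : same_moments w1 w2 ->
  same_moments (fun x => w1 x * (1 - U1 j x ^+ N) ^+ M)
    (fun x => w2 x * (1 - U2 j x ^+ N) ^+ M).
Proof.
move=> s; elim: M => [|M ih].
  by congr same_moments: s; apply/funext => x; rewrite expr0 mulr1.
have := same_moments_oneB (iter_add N j) ih.
by congr same_moments; apply/funext => x;
  rewrite ?iter_addE1 ?iter_addE2 -mulrA -exprSr.
Qed.

Lemma same_moments_lt w1 w2 j c : same_moments w1 w2 ->
  same_moments (fun x => w1 x * (U1 j x < c)%R%:R)
    (fun x => w2 x * (U2 j x < c)%R%:R).
Proof.
(* [cvg_threshold] covers thresholds in []0, 1]]; for the others the condition on a [[0, 1]]-valued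
   variable never or always holds. *)
move=> s; have [c0|c0] := leP c 0.
  have U0 (U : I -> T -> R) x : (forall i, unit_valued (U i)) ->
      (U j x < c)%R%:R = 0 :> R.
    by move=> /(_ j)[_ /(_ x)/andP[u0 _]]; rewrite ltNge (le_trans c0 u0).
  under eq_fun do rewrite U0// mulr0.
  under [X in same_moments _ X]eq_fun do rewrite U0// mulr0.
  split; [| |move=> i; by under eq_integral do rewrite mul0r;
    under [in RHS]eq_integral do rewrite mul0r].
  - by split=> // x; rewrite lexx ler01.
  - by split=> // x; rewrite lexx ler01.
have [c1|c1] := ltP 1 c.
  have U1' (U : I -> T -> R) x : (forall i, unit_valued (U i)) ->
      (U j x < c)%R%:R = 1 :> R.
    by move=> /(_ j)[_ /(_ x)/andP[_ u1]]; rewrite (le_lt_trans u1 c1).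
  under eq_fun do rewrite U1'// mulr1.
  by under [X in same_moments _ X]eq_fun do rewrite U1'// mulr1.
apply: (same_moments_lim (fun N => same_moments_exp j N (threshold_exponent c N) s)).
- move=> x; apply: cvgM; first exact: cvg_cst.
  by apply: cvg_threshold; [rewrite c0|have [] := U1v j].
- move=> x; apply: cvgM; first exact: cvg_cst.
  by apply: cvg_threshold; [rewrite c0|have [] := U2v j].
Qed.

Lemma same_moments_cylinder (r : seq (I * R)) w1 w2 : same_moments w1 w2 ->
  same_moments (fun x => w1 x * (all (fun ic => U1 ic.1 x < ic.2) r)%:R)
    (fun x => w2 x * (all (fun ic => U2 ic.1 x < ic.2) r)%:R).
Proof.
elim: r w1 w2 => [|[i c] r ih] w1 w2 s.
  by congr same_moments: s; apply/funext => x; rewrite mulr1.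
have := ih _ _ (same_moments_lt i c s).
by congr same_moments; apply/funext => x /=; rewrite -mulrA -natrM mulnb.
Qed.

Let path1 (w : T) : paths I R := U1 ^~ w.
Let path2 (w : T) : paths I R := U2 ^~ w.

Let mpath1 : measurable_fun [set: T] path1.
Proof. by apply: measurable_to_paths => i; have [] := U1v i. Qed.

Let mpath2 : measurable_fun [set: T] path2.
Proof. by apply: measurable_to_paths => i; have [] := U2v i. Qed.

(* The powers (1 - U i ^ N) ^ threshold_exponent c N tend to the indicator of
   U i < c and expand into members of the family, so that the moments determine the
   weights of cylinders. *)
Theorem multiplicative_class w1 w2 A : same_moments w1 w2 ->
  measurable (A : set (paths I R)) ->
  (\int[P]_(x in path1 @^-1` A) (w1 x)%:E =
   \int[P]_(x in path2 @^-1` A) (w2 x)%:E)%E.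
Proof.
move=> s mA.
have [w1v w2v e] := s.
have i1 B : measurable B -> measurable (path1 @^-1` B).
  by move=> mB; rewrite -[X in measurable X]setTI; exact: mpath1.
have i2 B : measurable B -> measurable (path2 @^-1` B).
  by move=> mB; rewrite -[X in measurable X]setTI; exact: mpath2.
have mw1 : measurable_fun [set: T] (EFin \o w1) by apply/measurable_EFinP; case: w1v.
have mw2 : measurable_fun [set: T] (EFin \o w2) by apply/measurable_EFinP; case: w2v.
have w10 x : (0 <= (w1 x)%:E)%E by case: w1v => _ /(_ x)/andP[]; rewrite lee_fin.
have w20 x : (0 <= (w2 x)%:E)%E by case: w2v => _ /(_ x)/andP[]; rewrite lee_fin.
have eT : (\int[P]_x (w1 x)%:E = \int[P]_x (w2 x)%:E)%E.
  by have := e zero; under eq_integral do rewrite U10 mulr1;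
     under [X in _ = X -> _]eq_integral do rewrite U20 mulr1.
apply: (@dynkin_induction _ (paths I R) (range (@cylinder I R))
  (fun A => (\int[P]_(x in path1 @^-1` A) (w1 x)%:E =
   \int[P]_(x in path2 @^-1` A) (w2 x)%:E)%E)) => //.
- exact: setI_closed_cylinder.
- move=> _ [r _ <-]; have := same_moments_cylinder r s => -[_ _ /(_ zero)].
  under eq_integral do rewrite U10 mulr1.
  under [X in _ = X -> _]eq_integral do rewrite U20 mulr1.
  move=> er; rewrite integral_mkcond [in RHS]integral_mkcond.
  have restrict_all (w : T -> R) (U : I -> T -> R) (x : T) :
      ((fun y => (w y)%:E) \_ [set y | all (fun ic => (U ic.1 y < ic.2)%R) r]) x =
       (w x * (all (fun ic => (U ic.1 x < ic.2)%R) r)%:R)%:E.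
    rewrite patchE; case: (boolP (all _ r)) => h; first by rewrite mem_set// mulr1.
    by rewrite memNset ?mulr0//; exact/negP.
  by under eq_integral do rewrite restrict_all;
     under [in RHS]eq_integral do rewrite restrict_all.
- move=> B mB eB.
  have -> : path1 @^-1` (~` B) = ~` (path1 @^-1` B) by [].
  have -> : path2 @^-1` (~` B) = ~` (path2 @^-1` B) by [].
  have split_setT (w : T -> R) (C : set T) : unit_valued w -> measurable C ->
      (\int[P]_x (w x)%:E =
       \int[P]_(x in C) (w x)%:E + \int[P]_(x in ~` C) (w x)%:E)%E.
    move=> [mw w01] mC; rewrite -ge0_integral_setU ?setUv//.
    - exact: measurableC.
    - exact/measurable_EFinP.
    - by move=> x _; rewrite lee_fin; have /andP[] := w01 x.
    - exact/disj_setPCl.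
  have := eT; rewrite (split_setT _ (path1 @^-1` B))//; last exact: i1.
  rewrite (split_setT w2 (path2 @^-1` B))//; last exact: i2.
  rewrite eB.
  have fB : (\int[P]_(x in path2 @^-1` B) (w2 x)%:E)%E \is a fin_num.
    apply: integrable_fin_num; first exact: i2.
    by apply: (integrableS measurableT) (unit_valued_integrable w2v) => //; exact: i2.
  move=> /(congr1 (fun z => z - \int[P]_(x in path2 @^-1` B) (w2 x)%:E)%E).
  by rewrite ![(\int[P]_(x in path2 @^-1` B) (w2 x)%:E + _)%E]addeC !addeK.
- move=> F mF /trivIsetP tF eF; rewrite !preimage_bigcup !ge0_integral_bigcup//.
  + exact: eq_eseriesr.
  + by move=> k; exact: i2.
  + exact: measurable_funTS.
  + by apply/trivIsetP => i j _ _ ij; rewrite -preimage_setI tF// preimage_set0.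
  + by move=> k; exact: i1.
  + exact: measurable_funTS.
  + by apply/trivIsetP => i j _ _ ij; rewrite -preimage_setI tF// preimage_set0.
Qed.

End MultiplicativeClass.

(** * Integrating out independent variables *)

Section CountableSum.
Context (R : realType) (I : countType).
Local Open Scope ereal_scope.

(** Duplicate-free finite lists exhausting [K] in the order of the codes; they turn sums over labels
    into limits of finite sums, one source of randomness at a time. *)
Definition enum_upto (K : set I) N : seq I :=
  [seq i <- pmap (@pickle_inv I) (iota 0 N) | i \in K].

Lemma enum_upto_uniq K N : uniq (enum_upto K N).
Proof.
by apply/filter_uniq/(pmap_uniq (@pickle_invK I))/iota_uniq.
Qed.

Lemma enum_upto_sub K N i : i \in enum_upto K N -> K i.
Proof. by rewrite mem_filter => /andP[/set_mem]. Qed.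

Lemma sum_enum_upto (K : set I) (a : I -> \bar R) N :
  \sum_(i <- enum_upto K N) a i =
  \sum_(0 <= n < N)
    oapp (fun i => if i \in K then a i else 0) 0 (@pickle_inv I n).
Proof.
rewrite big_filter big_mkcond/= /index_iota subn0.
elim: (iota 0 N) => [|n s ih]; first by rewrite !big_nil.
rewrite /= big_cons; case: pickle_inv => [i|] /=; last by rewrite ih add0e.
by rewrite big_cons ih.
Qed.

Lemma esum_countable (K : set I) (a : I -> \bar R) :
  (forall i, K i -> 0 <= a i) ->
  \esum_(i in K) a i =
  \sum_(n <oo) oapp (fun i => if i \in K then a i else 0) 0 (@pickle_inv I n).
Proof.
move=> a0; rewrite nneseries_esumT; last first.
  by move=> n; case: pickle_inv => [i|]//=; case: ifPn => // /[!inE]; exact: a0.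
set b := fun n => oapp _ _ _.
have bK i : K i -> b (choice.pickle i) = a i by move=> Ki; rewrite /b pickleK_inv/= mem_set.
transitivity (\esum_(n in @choice.pickle I @` K) b n).
  rewrite (esum_image K (@choice.pickle I)); last by apply: in2W; exact: (pcan_inj (@choice.pickleK I)).
  by apply: eq_esum => i /bK.
rewrite esum_mkcond; apply: eq_esum => n _; case: ifPn => // nK; rewrite /b.
case E : pickle_inv => [i|]//=; case: ifPn => // /set_mem Ki.
exfalso; move/negP: nK; apply; apply/mem_set; exists i => //.
by have := @pickle_invK I n; rewrite E.
Qed.

Lemma measurable_esum d (T : measurableType d) (K : set I) (a : I -> T -> \bar R) :
  (forall i, K i -> measurable_fun [set: T] (a i)) ->
  (forall i w, K i -> 0 <= a i w) ->
  measurable_fun [set: T] (fun w => \esum_(i in K) a i w).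
Proof.
move=> ma a0.
under eq_fun do (rewrite esum_countable; last by move=> i Ki; exact: a0).
apply: ge0_emeasurable_sum => n.
  by move=> w _ _; case: pickle_inv => [i|]//=; case: ifPn => // /[!inE]; exact: a0.
move=> _; case: pickle_inv => [i|]/=; last exact: measurable_cst.
by case: (boolP (i \in K)) => [/set_mem/ma|_]//; exact: measurable_cst.
Qed.

End CountableSum.

Section IndependentFubini.
Context d (T : measurableType d) (R : realType) (P : probability T R).
Context d1 (E1 : measurableType d1) d2 (E2 : measurableType d2).
Local Open Scope ereal_scope.

(** Independence on rectangles identifies the law of the pair with the product of the two laws, and
    Tonelli's theorem applies on the image spaces. *)
Lemma independent_fubini (X : T -> E1) (Y : T -> E2) (F : E1 * E2 -> \bar R) :
  measurable_fun [set: T] X -> measurable_fun [set: T] Y ->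
  (forall A B, measurable A -> measurable B ->
    P (X @^-1` A `&` Y @^-1` B) = P (X @^-1` A) * P (Y @^-1` B)) ->
  measurable_fun [set: E1 * E2] F -> (forall z, 0 <= F z) ->
  \int[P]_w F (X w, Y w) = \int[P]_w \int[P]_w' F (X w, Y w').
Proof.
move=> mX mY indXY mF F0.
have mXY : measurable_fun [set: T] (fun w => (X w, Y w)).
  exact: measurable_fun_pair.
pose X' : {RV P >-> E1} := HB.pack X (isMeasurableFun.Build _ _ _ _ X mX).
pose Y' : {RV P >-> E2} := HB.pack Y (isMeasurableFun.Build _ _ _ _ Y mY).
pose XY' : {RV P >-> (E1 * E2)%type} :=
  HB.pack (fun w => (X w, Y w)) (isMeasurableFun.Build _ _ _ _ _ mXY).
rewrite -[LHS](ge0_integral_distribution XY')//.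
have eD A : measurable A ->
    (distribution P X' \x distribution P Y') A = distribution P XY' A.
  apply: product_measure_unique => {}A B mA mB.
  by rewrite /distribution/= /pushforward/= -indXY.
rewrite (eq_measure_integral (distribution P X' \x distribution P Y')); last first.
  by move=> A mA _; rewrite /= eD.
rewrite fubini_tonelli1//.
rewrite [LHS](ge0_integral_distribution X')//=; last 2 first.
- exact: measurable_fun_fubini_tonelli_F.
- by move=> x; exact: integral_ge0.
apply: eq_integral => w _; rewrite /fubini_F [LHS](ge0_integral_distribution Y')//=.
exact: measurableT_comp.
Qed.

End IndependentFubini.

Section MutualIndependence.
Context d (T : measurableType d) (R : realType) (P : probability T R).
Context (I : countType) (F : I -> set (set T)).
Hypothesis F_sigma : forall i, sigma_algebra [set: T] (F i).
Hypothesis F_measurable : forall i A, F i A -> measurable A.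
Hypothesis F_independent : mutual_independence P F.

Definition joint (J : set I) : set (set T) := \bigcup_(i in J) F i.

Let rectangles (J : set I) : set (set T) :=
  [set A | exists (K : {fset I}) (B : I -> set T),
    [/\ (forall i, i \in K -> J i), (forall i, i \in K -> F i (B i)) &
        A = \bigcap_(i in [set` K]) B i]].

Let F_setT i : F i [set: T].
Proof. by have [F0 FC _] := F_sigma i; rewrite -(setD0 setT); exact: FC. Qed.

Let F_setI i A B : F i A -> F i B -> F i (A `&` B).
Proof.
move=> FA FB; have /sigma_algebraP h := F_sigma i.
by move: (F_sigma i) => /sigma_algebra_id <-; apply: (@measurableI _ (g_sigma_algebraType (F i)));
  rewrite /measurable/=; apply: sub_sigma_algebra.
Qed.

Let setI_closed_rectangles J : setI_closed (rectangles J).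
Proof.
move=> _ _ [K1 [B1 [J1 F1 ->]]] [K2 [B2 [J2 F2 ->]]].
exists (K1 `|` K2)%fset, (fun i => (if i \in K1 then B1 i else setT) `&`
  (if i \in K2 then B2 i else setT)); split.
- by move=> i; rewrite in_fsetU => /orP[/J1|/J2].
- by move=> i _; apply: F_setI; case: ifPn => // iK; [exact: F1|exact: F2].
- apply/seteqP; split => x /=.
    move=> [x1 x2] i _; split; case: ifPn => // iK; [exact: x1|exact: x2].
  move=> h; split => i /= iK.
    by have := h i; rewrite /= in_fsetU iK => /(_ erefl)[].
  by have := h i; rewrite /= in_fsetU iK orbT => /(_ erefl)[].
Qed.

Let joint_rectangles J : joint J `<=` rectangles J.
Proof.
move=> A [i Ji FA]; exists [fset i]%fset, (fun=> A); split.
- by move=> j; rewrite in_fset1 => /eqP ->.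
- by move=> j; rewrite in_fset1 => /eqP ->.
- apply/seteqP; split => x /= h; first by move=> j _.
  by apply: (h i); rewrite /= in_fset1.
Qed.

Lemma joint_measurable J A : <<s joint J >> A -> measurable A.
Proof.
apply: (smallest_sub (@sigma_algebra_measurable _ T)) => B [i _].
exact: F_measurable.
Qed.

(** Dynkin's theorem on the pi-system of finite intersections of events from the sources in [J].
    There mutual independence applies to the index set enlarged by [j], with [B] put at [j]. *)
Lemma joint_independent J j A B : ~ J j -> <<s joint J >> A -> F j B ->
  P (A `&` B) = (P A * P B)%E.
Proof.
move=> Jj /(sub_sigma_algebra2 (joint_rectangles (J := J))) sA FB.
have mB := F_measurable FB.
suff [] : measurable A /\ P (A `&` B) = (P A * P B)%E by [].
apply: (@dynkin_induction _ (g_sigma_algebraType (rectangles J)) (rectangles J)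
  (fun A => measurable (A : set T) /\ P (A `&` B) = (P A * P B)%E)) => //.
- by split; rewrite ?setTI ?probability_setT ?mul1e//; exact: measurableT.
- move=> _ [K [C [JK FC ->]]].
  have mC : measurable (\bigcap_(i in [set` K]) C i).
    by apply: fin_bigcap_measurable => // i iK; exact/F_measurable/FC.
  split=> //.
  have jK : j \notin K by apply/negP => /JK.
  have := @F_independent (j |` K)%fset (fun i => if i == j then B else C i).
  rewrite big_fsetU1//= eqxx; have -> : \bigcap_(i in [set` (j |` K)%fset])
      (if i == j then B else C i) = (\bigcap_(i in [set` K]) C i) `&` B.
    apply/seteqP; split => x /=.
      move=> h; split; last by have := h j; rewrite /= in_fset1U eqxx; apply.
      move=> i /= iK; have := h i; rewrite /= in_fset1U iK orbT => /(_ erefl).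
      by case: eqP iK jK => // -> ->.
    move=> [hC hB] i /=; rewrite in_fset1U; case: eqP => //= _; exact: hC.
  move=> ->; last first.
    by move=> i; rewrite in_fset1U; case: eqP => [->|_ /= /FC].
  rewrite muleC; congr (_ * _)%E.
  rewrite (F_independent FC) !big_seq; apply: eq_bigr => i iK.
  by case: eqP iK jK => // -> ->.
- move=> S _ [mS PS]; split; first exact: measurableC.
  rewrite setIC -setDE measureD//=; last by rewrite -ge0_fin_numE// fin_num_measure.
  rewrite setIC PS probability_setC// muleBl ?mul1e//.
    exact: fin_num_measure.
- move=> S _ tS mPS; split; first by apply: bigcup_measurable => k _; have [] := mPS k.
  rewrite setI_bigcupl measure_bigcup//=; last 2 first.
  + by move=> k _; apply: measurableI => //; have [] := mPS k.
  + by apply: trivIset_setIr.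
  rewrite measure_bigcup//=; last by move=> k _; have [] := mPS k.
  rewrite muleC -(fineK (fin_num_measure P B mB)) -nneseriesZl//; apply: eq_eseriesr => k _.
  by rewrite fineK ?fin_num_measure// muleC; have [] := mPS k.
Qed.

Context dE (E : measurableType dE).

Local Notation joint_type J := (g_sigma_algebraType (joint J)).
Local Notation factor_type i := (g_sigma_algebraType (F i)).

Lemma measurable_fun_joint dX (X : measurableType dX) J (y : T -> X) :
  measurable_fun [set: joint_type J] y -> measurable_fun [set: T] y.
Proof.
move=> my _ B mB; apply: (@joint_measurable J); exact: my.
Qed.

Lemma measurable_fun_joint_sub dX (X : measurableType dX) J K (y : T -> X) :
  J `<=` K ->
  measurable_fun [set: joint_type J] y -> measurable_fun [set: joint_type K] y.
Proof.
move=> JK my _ B mB; apply: (sub_sigma_algebra2 _ (my _ B mB)) => //.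
by move=> A [i Ji FA]; exists i => //; exact: JK.
Qed.

Lemma measurable_fun_factor dX (X : measurableType dX) J i (y : T -> X) : J i ->
  measurable_fun [set: factor_type i] y -> measurable_fun [set: joint_type J] y.
Proof.
move=> Ji my _ B mB; apply: (sub_sigma_algebra2 _ (my _ B mB)) => //.
by move=> A FA; exists i.
Qed.

(** The identity into [T] equipped with [F i] plays the role of the source of index [i] as a random
    variable, so that Fubini's theorem can be used although [T] is not a product space. *)
Lemma measurable_id_factor i : measurable_fun [set: T] (id : T -> factor_type i).
Proof.
by move=> _ A mA; rewrite setTI; apply: (@F_measurable i);
  rewrite -(sigma_algebra_id (F_sigma i)).
Qed.

Lemma measurable_fun_of_factor dX (X : measurableType dX) i (y : T -> X) :
  measurable_fun [set: factor_type i] y -> measurable_fun [set: T] y.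
Proof. by move=> my; exact: (measurableT_comp my (measurable_id_factor (i := i))). Qed.

Lemma measurable_integral_factor i (q : E -> T -> \bar R) :
  measurable_fun [set: E * factor_type i] (fun z => q z.1 z.2) ->
  (forall x w, 0 <= q x w)%E ->
  measurable_fun [set: E] (fun x => \int[P]_w q x w)%E.
Proof.
move=> mq q0.
pose Z : {RV P >-> factor_type i} := HB.pack (id : T -> factor_type i)
  (isMeasurableFun.Build _ _ _ _ _ (measurable_id_factor (i := i))).
rewrite (_ : (fun x => _) =
    fubini_F (distribution P Z) (fun z : E * factor_type i => q z.1 z.2)).
  by apply: measurable_fun_fubini_tonelli_F => // z; exact: q0.
apply/funext => x; rewrite /fubini_F/= (ge0_integral_distribution Z)//.
exact: (measurableT_comp mq (pair1_measurable _)).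
Qed.

(** One source is integrated out per step, the remaining sources of [s] being counted as known
    meanwhile. The integrated factor depends on [J] only and joins the weight [W]. *)
Lemma integrate_out_seq J (s : seq I) (W : T -> \bar R) (y : I -> T -> E)
    (q : I -> E -> T -> \bar R) :
  uniq s -> (forall i, i \in s -> ~ J i) ->
  measurable_fun [set: joint_type J] W -> (forall w, 0 <= W w)%E ->
  (forall i, i \in s -> measurable_fun [set: joint_type J] (y i)) ->
  (forall i, i \in s ->
    measurable_fun [set: E * factor_type i] (fun z => q i z.1 z.2)) ->
  (forall i x w, 0 <= q i x w)%E ->
  (\int[P]_w (W w * \prod_(i <- s) q i (y i w) w) =
   \int[P]_w (W w * \prod_(i <- s) \int[P]_w' q i (y i w) w'))%E.
Proof.
elim: s W => [|i s ih] W; first by move=> *; apply: eq_integral => w _; rewrite !big_nil.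
move=> /= /andP[iNs us] sJ mW W0 my mq q0.
have prod0 w : (0 <= \prod_(j <- s) q j (y j w) w)%E.
  by elim/big_ind: _ => // a b; exact: mule_ge0.
pose W' w := (W w * \prod_(j <- s) q j (y j w) w)%E.
pose J' := J `|` [set` s].
have mprod : measurable_fun [set: joint_type J'] (fun w => \prod_(j <- s) q j (y j w) w)%E.
  suff : forall t, {subset t <= s} ->
      measurable_fun [set: joint_type J'] (fun w => \prod_(j <- t) q j (y j w) w)%E.
    exact.
  elim=> [_|j t iht st]; first by under eq_fun do rewrite big_nil; exact: measurable_cst.
  under eq_fun do rewrite big_cons.
  apply: emeasurable_funM; last first.
    by apply: iht => k kt; apply: st; rewrite inE kt orbT.
  have js : j \in s by apply: st; rewrite inE eqxx.
  apply: (@measurableT_comp _ _ _ _ _ _ (fun z : E * factor_type j => q j z.1 z.2)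
    _ (fun w : joint_type J' => (y j w, w))).
    by apply: mq; rewrite inE js orbT.
  apply: measurable_fun_pair.
    apply: (measurable_fun_joint_sub (J := J)); first by move=> ? ?; left.
    by apply: my; rewrite inE js orbT.
  by apply: (measurable_fun_factor (i := j)); [right|exact: measurable_id].
have mW' : measurable_fun [set: joint_type J'] W'.
  apply: emeasurable_funM => //.
  by apply: measurable_fun_joint_sub mW => ? ?; left.
have myi : measurable_fun [set: joint_type J'] (y i).
  apply: (measurable_fun_joint_sub (J := J)); first by move=> ? ?; left.
  by apply: my; rewrite inE eqxx.
have mqi : measurable_fun [set: E * factor_type i] (fun z => q i z.1 z.2).
  by apply: mq; rewrite inE eqxx.
have mX : measurable_fun [set: joint_type J'] (fun w => (W' w, y i w)).
  exact: measurable_fun_pair.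
transitivity (\int[P]_w (W' w * q i (y i w) w))%E.
  by apply: eq_integral => w _; rewrite big_cons /W' -muleA [(q i _ _ * _)%E]muleC.
have -> : (\int[P]_w (W' w * q i (y i w) w) =
    \int[P]_w \int[P]_w' (W' w * q i (y i w) w'))%E.
  (* [independent_fubini] asks for a function that is nonnegative on the whole image space, where
     the first coordinate is an arbitrary extended real. *)
  have absW' w : `|W' w|%E = W' w by rewrite gee0_abs// mule_ge0.
  under eq_integral do rewrite -absW'.
  under [in RHS]eq_integral do under eq_integral do rewrite -absW'.
  apply: (@independent_fubini _ _ _ P _ (\bar R * E)%type _ (factor_type i)
    (fun w => (W' w, y i w)) id (fun z => `|z.1.1| * q i z.1.2 z.2)%E).
  - exact: measurable_fun_joint mX.
  - exact: measurable_id_factor.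
  - move=> A B mA mB; apply: (@joint_independent J' i).
    + by case=> [/(sJ i)|]; [apply; rewrite inE eqxx|exact/negP].
    + by rewrite -[X in <<s _ >> X]setTI; exact: mX.
    + by rewrite -(sigma_algebra_id (F_sigma i)).
  - apply: emeasurable_funM.
      apply: measurableT_comp => //.
      exact: measurableT_comp measurable_fst measurable_fst.
    apply: (@measurableT_comp _ _ _ _ _ _ (fun z : E * factor_type i => q i z.1 z.2)
      _ (fun z : (\bar R * E) * factor_type i => (z.1.2, z.2))) => //.
    apply: measurable_fun_pair => //.
    exact: measurableT_comp measurable_snd measurable_fst.
  - by move=> z /=; rewrite mule_ge0.
transitivity (\int[P]_w ((W w * \int[P]_w' q i (y i w) w') *
    \prod_(j <- s) q j (y j w) w))%E.
  apply: eq_integral => w _; rewrite ge0_integralZl//.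
  - by rewrite /W' muleAC.
  - apply: measurable_fun_of_factor.
    exact: (measurableT_comp mqi (pair1_measurable _)).
  - by rewrite mule_ge0.
rewrite ih//; last first.
- by move=> j js; apply: mq; rewrite inE js orbT.
- by move=> j js; apply: my; rewrite inE js orbT.
- by move=> w; rewrite mule_ge0//; exact: integral_ge0.
- apply: emeasurable_funM => //.
  apply: (@measurableT_comp _ _ _ _ _ _ (fun x => \int[P]_w' q i x w')%E).
    exact: (measurable_integral_factor (i := i)).
  by apply: my; rewrite inE eqxx.
- by move=> j js; apply: sJ; rewrite inE js orbT.
by apply: eq_integral => w _; rewrite big_cons muleA.
Qed.

Lemma cvg_en_sum (c : \bar R) (K : set I) (a : I -> \bar R) :
  (0 <= c)%E -> (forall i, 0 <= a i)%E ->
  (en c * en (\sum_(i <- enum_upto K N) a i) @[N --> \oo] -->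
    en (c + \esum_(i in K) a i))%E.
Proof.
move=> c0 a0.
have a0' n : (0 <= oapp (fun i => if i \in K then a i else 0) 0 (@pickle_inv I n))%E.
  by case: pickle_inv => [i|]//=; case: ifPn.
rewrite esum_countable// enD//; last by apply: nneseries_ge0.
under eq_fun do rewrite sum_enum_upto.
apply: cvgeZl; first exact: en_fin_num.
exact: cvg_en_series.
Qed.

(** Given the sources in [J], those in [K] are independent and the [y i] are frozen, so exponents
    add up. This takes the place of conditional expectations, both in the recursion over generations
    and in the averaging over job sizes. *)
Lemma integrate_out (J K : set I) (W : T -> \bar R) (y : I -> T -> E)
    (r : I -> E -> T -> \bar R) (rho : I -> E -> \bar R) :
  (forall i, K i -> ~ J i) ->
  measurable_fun [set: joint_type J] W -> (forall w, 0 <= W w)%E ->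
  (forall i, K i -> measurable_fun [set: joint_type J] (y i)) ->
  (forall i, K i ->
    measurable_fun [set: E * factor_type i] (fun z => r i z.1 z.2)) ->
  (forall i x w, 0 <= r i x w)%E -> (forall i x, 0 <= rho i x)%E ->
  (forall i x, K i -> \int[P]_w en (r i x w) = en (rho i x))%E ->
  (\int[P]_w en (W w + \esum_(i in K) r i (y i w) w) =
   \int[P]_w en (W w + \esum_(i in K) rho i (y i w)))%E.
Proof.
move=> KJ mW W0 my mr r0 rho0 rrho.
have mrho i : K i -> measurable_fun [set: E] (rho i).
  move=> Ki; have -> : rho i = (fun x => - lne (\int[P]_w en (r i x w)))%E.
    by apply/funext => x; rewrite rrho// /en expeRK oppeK.
  apply: (@measurableT_comp _ _ _ _ _ _ (fun z => - lne z)%E setT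
    (fun x => \int[P]_w en (r i x w))%E (@measurable_Nlne R)).
  apply: (measurable_integral_factor (i := i) (q := fun x w => en (r i x w))).
    exact: measurableT_comp (measurable_en _) (mr _ Ki).
  by move=> x w; exact: en_ge0.
have mrw i : K i -> measurable_fun [set: T] (fun w => r i (y i w) w).
  move=> Ki.
  apply: (@measurableT_comp _ _ _ _ _ _ (fun z : E * factor_type i => r i z.1 z.2)
    _ (fun w : T => (y i w, w))); first exact: mr.
  have myi := measurable_fun_joint (my _ Ki).
  exact: (measurable_fun_pair myi (measurable_id_factor (i := i))).
have mrhow i : K i -> measurable_fun [set: T] (fun w => rho i (y i w)).
  by move=> Ki; exact: measurableT_comp (mrho _ Ki) (measurable_fun_joint (my _ Ki)).
have eN N : (\int[P]_w (en (W w) * en (\sum_(i <- enum_upto K N) r i (y i w) w)) =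
    \int[P]_w (en (W w) * en (\sum_(i <- enum_upto K N) rho i (y i w))))%E.
  under eq_integral do rewrite en_sum//.
  under [in RHS]eq_integral do rewrite en_sum//.
  rewrite (@integrate_out_seq J (enum_upto K N) (fun w => en (W w)) y (fun i x w => en (r i x w))).
  - apply: eq_integral => w _; congr (_ * _)%E.
    rewrite !big_seq; apply: eq_bigr => i /enum_upto_sub; exact: rrho.
  - exact: enum_upto_uniq.
  - by move=> i /enum_upto_sub; exact: KJ.
  - exact: measurableT_comp (measurable_en _) mW.
  - by move=> w; exact: en_ge0.
  - by move=> i /enum_upto_sub; exact: my.
  - move=> i /enum_upto_sub Ki; exact: measurableT_comp (measurable_en _) (mr _ Ki).
  - by move=> i x w; exact: en_ge0.
have lim (a : I -> T -> \bar R) : (forall i, K i -> measurable_fun [set: T] (a i)) ->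
    (forall i w, 0 <= a i w)%E ->
    (\int[P]_w (en (W w) * en (\sum_(i <- enum_upto K N) a i w)) @[N --> \oo] -->
     \int[P]_w en (W w + \esum_(i in K) a i w))%E.
  move=> ma a0; apply: bounded_cvg.
  - move=> N; apply: emeasurable_funM.
      exact: measurableT_comp (measurable_en _) (measurable_fun_joint mW).
    apply: measurableT_comp (measurable_en _) _ => //.
    under eq_fun do rewrite sum_enum_upto.
    apply: emeasurable_sum => n; case: pickle_inv => [i|]/=; last exact: measurable_cst.
    by case: (boolP (i \in K)) => [/set_mem/ma|_]//; exact: measurable_cst.
  - move=> N w; rewrite mule_ge0 ?en_ge0//=.
    by rewrite -enD ?sume_ge0// en_le1 ?adde_ge0 ?sume_ge0.
  - by move=> w; exact: cvg_en_sum.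
have h1 := lim _ mrw (fun i w => r0 i (y i w) w).
have h2 := lim _ mrhow (fun i w => rho0 i (y i w)).
move: h1; rewrite (funext eN) => h1.
exact: cvg_unique h1 h2.
Qed.

End MutualIndependence.

(** * The Laplace functional of a Poisson process *)

Section Series.
Context (R : realType).
Local Open Scope ereal_scope.

Lemma nneseries_mull (x : \bar R) (f : nat -> \bar R) :
  0 <= x -> (forall n, 0 <= f n) ->
  \sum_(n <oo) (x * f n) = x * \sum_(n <oo) f n.
Proof.
move=> x0 f0; rewrite -(@ge0_integral_count _ (fun n => x * f n)); last first.
  by move=> n; exact: mule_ge0.
by rewrite ge0_integralZl// ge0_integral_count.
Qed.

Lemma nneseries_delta (c : nat) (x : nat -> \bar R) : (forall n, 0 <= x n) ->
  \sum_(n <oo) ((n == c)%:R%:E * x n) = x c.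
Proof.
move=> x0; rewrite (@nneseriesD1 _ _ c)//; last first.
  by move=> n _; rewrite mule_ge0// lee_fin.
rewrite eqxx mul1e eseries0 ?adde0// => n _ /andP[_ /negbTE nc].
by rewrite nc mul0e.
Qed.

(** Linearity in the coefficient sequence of index [j], decomposed into Kronecker deltas; it drives
    the induction of [expectation_product]. *)
Lemma prod_series_expand k (g a : 'I_k -> nat -> \bar R) (j : 'I_k) :
  (forall i c, 0 <= g i c) -> (forall i c, 0 <= a i c) ->
  \prod_(i < k) \sum_(c <oo) (a i c * g i c) =
  \sum_(c <oo) (a j c * \prod_(i < k)
    \sum_(c' <oo) ((if i == j then (c' == c)%:R%:E else a i c') * g i c')).
Proof.
move=> g0 a0; pose X := \prod_(i < k | i != j) \sum_(c <oo) (a i c * g i c).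
have X0 : 0 <= X.
  rewrite /X; elim/big_ind: _ => // [x y|i _]; first exact: mule_ge0.
  by apply: nneseries_ge0 => n _ _; rewrite mule_ge0.
rewrite (bigD1 j)//= -/X muleC -nneseries_mull//; last by move=> n; rewrite mule_ge0.
apply: eq_eseriesr => c _; rewrite (bigD1 j)//= eqxx nneseries_delta//.
rewrite muleC -muleA; congr (_ * (_ * _)).
by apply: eq_bigr => i /negbTE ij; apply: eq_eseriesr => c' _; rewrite ij.
Qed.

Lemma cvg_integral_monotone d (T : measurableType d)
    (mu : {measure set T -> \bar R}) (D : set T) (g : nat -> T -> \bar R)
    (f : T -> \bar R) : measurable D ->
  (forall n, measurable_fun D (g n)) -> (forall n x, D x -> 0 <= g n x) ->
  (forall x, D x -> nondecreasing_seq (g ^~ x)) ->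
  (forall x, D x -> g ^~ x @ \oo --> f x) ->
  \int[mu]_(x in D) g n x @[n --> \oo] --> \int[mu]_(x in D) f x.
Proof.
move=> mD mg g0 ndg gf.
have := @cvg_monotone_convergence _ _ _ mu D mD g mg g0 ndg.
under [X in _ --> X -> _]eq_integral.
  by move=> x /[!inE] Dx; rewrite (cvg_lim _ (gf x Dx))//; over.
exact.
Qed.

Lemma cvg_nneseries_monotone (a : nat -> nat -> \bar R) (b : nat -> \bar R) :
  (forall n k, 0 <= a n k) -> (forall k, nondecreasing_seq (a ^~ k)) ->
  (forall k, a ^~ k @ \oo --> b k) ->
  \sum_(k <oo) a n k @[n --> \oo] --> \sum_(k <oo) b k.
Proof.
move=> a0 nda ab.
have b0 k : 0 <= b k.
  have := ab k => /(cvg_lim (@ereal_hausdorff R)) <-; apply: lime_ge.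
    exact: cvgP (ab k).
  exact: nearW.
rewrite -ge0_integral_count//; under eq_fun do rewrite -ge0_integral_count//.
exact: cvg_integral_monotone.
Qed.

End Series.

Section PoissonSeries.
Context (R : realType).
Local Open Scope ereal_scope.

Lemma poisson_prob_seriesE (lambda : R) :
  \sum_(c <oo) poisson_prob lambda 0 [set c] = 1.
Proof.
rewrite -(@probability_setT _ _ _ (poisson_prob lambda 0)).
rewrite [in RHS](_ : setT = \bigcup_n [set n]); last first.
  by apply/seteqP; split => // n _; exists n.
rewrite measure_bigcup//=; first by apply: eq_eseriesl => n; apply/esym/mem_set.
apply/trivIsetP => i j _ _ /eqP ij; apply/seteqP; split => // x [/= xi xj].
by apply: ij; rewrite -xi -xj.
Qed.

Lemma poisson_generating (lambda v : R) : (0 <= lambda)%R -> (0 <= v)%R ->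
  \sum_(c <oo) (en (v *+ c)%:E * poisson_prob lambda 0 [set c]) =
  en (lambda%:E * (1 - en v%:E)).
Proof.
move=> l0 v0.
(* For parameter 0, [poisson_prob] is the Dirac mass at 0. *)
have [l_gt0|] := ltP 0%R lambda; last first.
  move=> l_le0; have -> : lambda = 0%R by apply/eqP; rewrite eq_le l_le0.
  rewrite mul0e en0.
  under eq_eseriesr => c _.
    rewrite /poisson_prob ltxx diracE.
    rewrite (_ : (0%N \in [set c]) = (c == 0%N)); last first.
      by apply/idP/eqP => [/set_mem/= ->|->]//; exact/mem_set.
    rewrite muleC; over.
  by rewrite nneseries_delta ?mulr0n ?en0// => n; exact: en_ge0.
set u := expR (- v); have u_gt0 : (0 < u)%R by exact: expR_gt0.
have lu0 : (0 < lambda * u)%R by rewrite mulr_gt0.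
(* Exponential tilting: weighting the Poisson law of parameter [lambda] by [u^c] gives the one of
   parameter [lambda * u], up to the constant [exp(- lambda (1 - u))]; the total mass of the latter
   is 1. *)
transitivity (\sum_(c <oo) (en (lambda * (1 - u))%:E *
    poisson_prob (lambda * u) 0 [set c])).
  apply: eq_eseriesr => c _; rewrite /poisson_prob l_gt0 lu0 !esum_set1; last 2 first.
  - exact: poisson_pmf_ge0.
  - exact: poisson_pmf_ge0.
  rewrite /poisson_pmf l_gt0 lu0 /en/= -!EFinM; congr EFin.
  rewrite -mulNrn -[(- v *+ c)%R]mulr_natl expRM_natl -/u exprMn.
  rewrite (_ : - lambda = - (lambda * (1 - u)) - lambda * u)%R; last by ring.
  by rewrite expRD; ring.
rewrite nneseries_mull ?en_ge0// poisson_prob_seriesE mule1.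
by [].
Qed.

End PoissonSeries.

Lemma measurable_eprod d (T : measurableType d) (R : realType) (I : Type)
    (s : seq I) (h : I -> T -> \bar R) :
  (forall i, measurable_fun [set: T] (h i)) ->
  measurable_fun [set: T] (fun x => \prod_(i <- s) h i x)%E.
Proof.
move=> mh; elim: s => [|i s ih].
  by under eq_fun do rewrite big_nil; exact: measurable_cst.
by under eq_fun do rewrite big_cons; exact: emeasurable_funM.
Qed.

Section ProductFormula.
Context d (T : measurableType d) (R : realType) (P : probability T R).
Context (k : nat) (E : 'I_k -> nat -> set T) (p : 'I_k -> nat -> \bar R).
Hypothesis mE : forall i c, measurable (E i c).
Hypothesis p0 : forall i c, (0 <= p i c)%E.
Hypothesis PE : forall c : 'I_k -> nat,
  P (\bigcap_(i in [set: 'I_k]) E i (c i)) = (\prod_(i < k) p i (c i))%E.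
Local Open Scope ereal_scope.

Let S (a : nat -> \bar R) i w := \sum_(c <oo) (a c * (\1_(E i c) w)%:E).
Let M (a : nat -> \bar R) i := \sum_(c <oo) (a c * p i c).
Let delta (c : nat) : nat -> \bar R := fun c' => (c' == c)%:R%:E.

(** When all coefficient sequences are Kronecker deltas this is the hypothesis on the events. The
    induction on [j] frees the coordinates one by one. *)
Lemma expectation_product (a : 'I_k -> nat -> \bar R) :
  (forall i c, 0 <= a i c) ->
  \int[P]_w \prod_(i < k) S (a i) i w = \prod_(i < k) M (a i) i.
Proof.
suff H j : (j <= k)%N -> forall a : 'I_k -> nat -> \bar R,
    (forall i c, 0 <= a i c) ->
    (forall i : 'I_k, (j <= i)%N -> exists c, a i = delta c) ->
    \int[P]_w \prod_(i < k) S (a i) i w = \prod_(i < k) M (a i) i.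
  by move=> a0; apply: (H k) => // i; rewrite leqNgt ltn_ord.
elim: j => [_ {}a a0 ad|j ih jk {}a a0 ad].
  have /choice[c ac] : forall i, exists c, a i = delta c by move=> i; exact: ad.
  transitivity (\int[P]_w (\1_(\bigcap_(i in [set: 'I_k]) E i (c i)) w)%:E).
    apply: eq_integral => w _.
    transitivity (\prod_(i < k) (\1_(E i (c i)) w)%:E : \bar R).
      by apply: eq_bigr => i _; rewrite /S ac nneseries_delta.
    rewrite prodEFin; congr EFin; rewrite !indicE.
    case: (boolP (w \in _)) => [/set_mem h|].
      by rewrite big1// => i _; rewrite indicE mem_set//; exact: h.
    move=> /negP h; apply/eqP/prodf_eq0; apply: contrapT => h'.
    apply: h; apply/mem_set => i _; apply: contrapT => wi; apply: h'.
    by exists i => //; rewrite indicE memNset.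
  rewrite integral_indic ?setIT//; last first.
    by apply: fin_bigcap_measurable => //; exact: finite_finset.
  etransitivity; first exact: PE c.
  apply: eq_bigr => i _.
  by rewrite /M ac nneseries_delta.
pose j' := Ordinal jk.
pose a' c i := if i == j' then delta c else a i.
have a'0 c i n : 0 <= a' c i n by rewrite /a'; case: ifP => // _; rewrite lee_fin.
under eq_integral => w _.
  rewrite /S (prod_series_expand j')//.
  over.
rewrite [RHS](prod_series_expand j')//.
have S0 c w : 0 <= \prod_(i < k) S (a' c i) i w.
  elim/big_ind: _ => // [x y|i _]; first exact: mule_ge0.
  by apply: nneseries_ge0 => n _ _; rewrite mule_ge0// lee_fin.
have mS c : measurable_fun [set: T] (fun w => \prod_(i < k) S (a' c i) i w).
  apply: (@measurable_eprod _ _ _ _ _ (fun i w => S (a' c i) i w)) => i.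
  apply: ge0_emeasurable_sum => n; first by move=> w _ _; rewrite mule_ge0// lee_fin.
  by move=> _; apply: emeasurable_funM => //; exact/measurable_EFinP/measurable_indic.
have a'E c i n : (if i == j' then ((n == c)%:R)%:E else a i n) = a' c i n.
  by rewrite /a'; case: ifP.
under eq_integral => w _ do under eq_eseriesr => c _ do under eq_bigr => i _ do
  under eq_eseriesr => n _ do rewrite a'E.
under [RHS]eq_eseriesr => c _ do under eq_bigr => i _ do
  under eq_eseriesr => n _ do rewrite a'E.
rewrite integral_nneseries//; last 2 first.
- by move=> c; apply: emeasurable_funM; [exact: measurable_cst|exact: mS].
- by move=> c w _; apply: mule_ge0 => //; exact: S0.
apply: eq_eseriesr => c _.
rewrite ge0_integralZl//; [|exact: mS|by move=> w _; exact: S0].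
congr (_ * _); apply: ih => //; first exact: ltnW.
move=> i ji; rewrite /a'; case: eqP => [_|/eqP ij]; first by exists c.
apply: ad; rewrite ltn_neqAle ji andbT.
by apply: contra ij => /eqP ij; apply/eqP/val_inj.
Qed.

End ProductFormula.

Section FiniteExtension.
Context (R : realType).
Local Open Scope ereal_scope.

(* A function of the points of a point process: absent points, which are
   enumerated as infinite values, do not contribute. *)
Definition ext (phi : R -> \bar R) (x : \bar R) : \bar R :=
  if x is r%:E then phi r else 0.

Lemma ext_ge0 phi x : (forall r, 0 <= phi r) -> 0 <= ext phi x.
Proof. by case: x => [r| |] //; apply. Qed.

Lemma measurable_fin_num_bool : measurable_fun [set: \bar R] (fun x => x \is a fin_num).
Proof.
apply: (@measurable_fun_bool _ _ _ _ true).
have := emeasurable_fin_num measurableT (@measurable_id _ (\bar R) setT).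
by congr measurable; rewrite setTI; apply/seteqP; split.
Qed.

Lemma measurable_ext phi : measurable_fun [set: R] phi ->
  measurable_fun [set: \bar R] (ext phi).
Proof.
move=> mphi.
have -> : ext phi = (fun x => if x \is a fin_num then phi (fine x) else 0).
  by apply/funext => -[r| |].
apply: measurable_fun_ifT; first exact: measurable_fin_num_bool.
  exact: measurableT_comp mphi (fine_measurable _).
exact: measurable_cst.
Qed.

End FiniteExtension.

Section PoissonLaplace.
Context d (T : measurableType d) (R : realType) (P : probability T R).
Context (D : set R) (rate : R -> R) (xi : nat -> T -> \bar R).
Hypothesis mD : measurable D.
Hypothesis mrate : measurable_fun D rate.
Hypothesis rate0 : forall x, D x -> (0 <= rate x)%R.
Hypothesis xi_poisson : poisson_process P D rate xi.
Local Open Scope ereal_scope.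

Let mxi n : measurable_fun [set: T] (xi n).
Proof. by case: xi_poisson. Qed.

Lemma nb_pointsE A w :
  nb_points xi A w = \sum_(n <oo) ext (EFin \o \1_A) (xi n w).
Proof.
rewrite /nb_points counting_dirac; apply: eq_eseriesr => n _; rewrite diracE.
case E : (xi n w) => [r| |]/=; rewrite ?indicE.
- congr (_%:R%:E); congr nat_of_bool; apply/idP/idP => [/set_mem/= [y Ay]|].
    by rewrite E => -[<-]; exact/mem_set.
  by move=> /set_mem Ar; apply/mem_set; exists r.
- by rewrite memNset//= E => -[].
- by rewrite memNset//= E => -[].
Qed.

Lemma measurable_nb_points A : measurable A ->
  measurable_fun [set: T] (nb_points xi A).
Proof.
move=> mA; rewrite (funext (nb_pointsE A)).
apply: ge0_emeasurable_sum => n.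
  by move=> w _ _; apply: ext_ge0 => r; rewrite lee_fin.
move=> _; apply: measurableT_comp (mxi n).
exact/measurable_ext/measurable_EFinP/measurable_indic.
Qed.

Lemma nb_points_nat A w :
  nb_points xi A w = +oo \/ exists c : nat, nb_points xi A w = c%:R%:E.
Proof. by rewrite /nb_points/counting; case: asboolP => _; [right; eexists|left]. Qed.

Lemma measurable_nb_points_eq A (c : nat) : measurable A ->
  measurable [set w | nb_points xi A w = c%:R%:E].
Proof.
move=> mA; rewrite -[X in measurable X]setTI.
rewrite (_ : [set w | _] = nb_points xi A @^-1` [set c%:R%:E]); last first.
  by apply/seteqP; split.
exact: measurable_nb_points.
Qed.

(** Since [v] is positive, both sides vanish when there are infinitely many points in [A]. *)
Lemma en_nb_points A (v : R) w : (0 < v)%R ->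
  en (v%:E * nb_points xi A w) =
  \sum_(c <oo) (en (v *+ c)%:E *
    (\1_[set w | nb_points xi A w = c%:R%:E] w)%:E).
Proof.
move=> v0; have [Ny|[c Nc]] := nb_points_nat A w.
  rewrite Ny gt0_muley// eseries0// => n _ _ /=.
  by rewrite indicE memNset ?mule0//= Ny.
rewrite Nc.
under eq_eseriesr => n _.
  rewrite (_ : \1_ _ w = (n == c)%:R); last first.
    rewrite indicE; congr (_%:R); congr nat_of_bool.
    apply/idP/eqP => [/set_mem/=|->]; last exact/mem_set.
    by rewrite Nc => -[] /eqP; rewrite eqr_nat => /eqP.
  rewrite muleC; over.
by rewrite nneseries_delta -?EFinM ?mulr_natr// => n; exact: en_ge0.
Qed.

Lemma poisson_laplace_simple k (A : 'I_k -> set R) (v : 'I_k -> R) :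
  (forall i, measurable (A i)) -> trivIset [set: 'I_k] A ->
  (forall i, intensity D rate (A i) < +oo) -> (forall i, (0 < v i)%R) ->
  \int[P]_w en (\sum_(n <oo)
    ext (fun x => \sum_(i < k) (v i * \1_(A i) x)%:E) (xi n w)) =
  en (\int[lebesgue_measure]_(x in D)
    ((1 - en (\sum_(i < k) (v i * \1_(A i) x)%:E)) * (rate x)%:E)).
Proof.
move=> mA tA fA v0.
have int0 i : 0 <= intensity D rate (A i).
  by apply: integral_ge0 => x [_ Dx]; rewrite lee_fin rate0.
have en1B_ge0 i : 0 <= 1 - en (v i)%:E.
  by rewrite sube_ge0 ?en_le1 ?en_fin_num// lee_fin ltW.
have intf i : intensity D rate (A i) \is a fin_num by rewrite ge0_fin_numE.
transitivity (\int[P]_w \prod_(i < k) \sum_(c <oo) (en (v i *+ c)%:E *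
    (\1_[set w | nb_points xi (A i) w = c%:R%:E] w)%:E)).
  apply: eq_integral => w _.
  under [RHS]eq_bigr do rewrite -en_nb_points//.
  rewrite -en_sum; last by move=> i; rewrite mule_ge0// ?lee_fin ?ltW// /nb_points measure_ge0.
  congr en.
  transitivity (\sum_(n <oo) \sum_(i < k) ((v i)%:E * ext (EFin \o \1_(A i)) (xi n w))).
    apply: eq_eseriesr => n _; case: (xi n w) => [r| |] /=.
    - by apply: eq_bigr => i _; rewrite EFinM.
    - by rewrite big1// => i _; rewrite mule0.
    - by rewrite big1// => i _; rewrite mule0.
  rewrite nneseries_sum; last first.
    move=> i n _; apply: mule_ge0; first by rewrite lee_fin ltW.
    by apply: ext_ge0 => r; rewrite lee_fin.
  apply: eq_bigr => i _; rewrite nneseries_mull ?nb_pointsE ?lee_fin ?ltW//.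
  by move=> n; apply: ext_ge0 => r; rewrite lee_fin.
rewrite (@expectation_product _ _ _ P k
  (fun i c => [set w | nb_points xi (A i) w = c%:R%:E])
  (fun i c => poisson_prob (fine (intensity D rate (A i))) 0 [set c])); last first.
- by move=> i c; exact: en_ge0.
- by move=> c; case: xi_poisson => _ /(_ k A c); apply.
- by move=> i c; exact: measure_ge0.
- by move=> i c; exact: measurable_nb_points_eq.
under eq_bigr => i _.
  rewrite poisson_generating; [|exact: fine_ge0|exact: ltW].
  rewrite fineK//; over.
rewrite /= -en_sum; last first.
  by move=> i; exact: mule_ge0 (int0 i) (en1B_ge0 i).
congr en.
transitivity (\int[lebesgue_measure]_(x in D)
   \sum_(i < k) ((1 - en (v i)%:E) * ((rate x)%:E * (\1_(A i) x)%:E))); last first.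
  apply: eq_integral => x _.
  (* At most one of the disjoint sets contains [x], which is why the nonlinear [1 - en] of the
     simple function is a combination of indicators. *)
  have [[i Aix]|nA] := pselect (exists i, A i x).
    have Aj j : j != i -> \1_(A j) x = 0%R :> R.
      move=> ji; rewrite indicE memNset// => Ajx.
      by move/trivIsetP : tA => /(_ j i Logic.I Logic.I ji)/seteqP[/(_ x (conj Ajx Aix))].
    rewrite (bigD1 i)//= big1 ?adde0; last by move=> j ji; rewrite Aj// !mule0.
    rewrite [in RHS](bigD1 i)//= big1 ?adde0; last by move=> j ji; rewrite Aj// mulr0.
    by rewrite indicE mem_set// mulr1 mule1.
  have A0 j : \1_(A j) x = 0%R :> R.
    by rewrite indicE memNset// => Ajx; apply: nA; exists j.
  rewrite big1; last by move=> j _; rewrite A0 !mule0.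
  by rewrite big1 ?en0 ?subee ?mul0e// => j _; rewrite A0 mulr0.
rewrite ge0_integral_sum//; last 2 first.
- move=> i; apply: emeasurable_funM; first exact: measurable_cst.
  apply: emeasurable_funM; first exact/measurable_EFinP.
  by apply/measurable_EFinP/measurable_indic; exact: mA.
- by move=> i x Dx; rewrite !mule_ge0// lee_fin rate0.
apply: eq_bigr => i _; rewrite ge0_integralZl//; last 2 first.
- apply: emeasurable_funM; first exact/measurable_EFinP.
  by apply/measurable_EFinP/measurable_indic; exact: mA.
- by move=> x Dx; rewrite mule_ge0// lee_fin rate0.
rewrite muleC; congr (_ * _).
rewrite /intensity setIC integral_mkcondr; apply: eq_integral => x _.
by rewrite patchE indicE; case: ifPn; rewrite ?mule1 ?mule0.
Qed.

Lemma cvg_en_integral (phi : nat -> R -> \bar R) (psi : R -> \bar R) :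
  (forall n, measurable_fun [set: R] (phi n)) ->
  (forall n x, 0 <= phi n x) ->
  (forall x, nondecreasing_seq (phi ^~ x)) ->
  (forall x, phi ^~ x @ \oo --> psi x) ->
  en (\int[lebesgue_measure]_(x in D) ((1 - en (phi n x)) * (rate x)%:E))
    @[n --> \oo] -->
  en (\int[lebesgue_measure]_(x in D) ((1 - en (psi x)) * (rate x)%:E)).
Proof.
move=> mphi phi0 ndphi phipsi.
have en1B_ge0 n x : 0 <= 1 - en (phi n x).
  by rewrite sube_ge0 ?en_le1 ?en_fin_num.
have mint n : measurable_fun D (fun x => (1 - en (phi n x)) * (rate x)%:E).
  apply: emeasurable_funM; last exact/measurable_EFinP.
  apply: emeasurable_funB => //; apply: measurable_funTS.
  exact: measurableT_comp (measurable_en _) (mphi n).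
have ndint x : D x -> nondecreasing_seq (fun n => (1 - en (phi n x)) * (rate x)%:E).
  move=> Dx i j ij; apply: lee_wpmul2r; first by rewrite lee_fin rate0.
  by rewrite leeB// lee_en ndphi.
have c : \int[lebesgue_measure]_(x in D) ((1 - en (phi n x)) * (rate x)%:E)
    @[n --> \oo] -->
  \int[lebesgue_measure]_(x in D) ((1 - en (psi x)) * (rate x)%:E).
  apply: cvg_integral_monotone => //.
  - by move=> n x Dx; rewrite mule_ge0// lee_fin rate0.
  - move=> x Dx; apply: cvgeZr => //.
    apply: cvgeB; [by []|exact: cvg_cst|].
    by have := cvg_en (ndphi x); rewrite (cvg_lim _ (phipsi x)).
rewrite -(cvg_lim _ c)//; apply: cvg_en => i j ij.
apply: ge0_le_integral => //; last by move=> x Dx; exact: ndint.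
- by move=> x Dx; rewrite mule_ge0// lee_fin rate0.
- exact: mint.
- exact: mint.
Qed.

Import HBSimple HBNNSimple.

Hypothesis locally_finite : forall n : nat,
  intensity D rate `[(- n%:R : R)%R, (n%:R : R)%R]%classic < +oo.

(** Monotone approximation by simple functions, cut off outside [[-n, n]] because [poisson_process]
    prescribes the joint law of counts on sets of finite intensity only. *)
Theorem poisson_laplace (phi : R -> \bar R) :
  measurable_fun [set: R] phi -> (forall x, 0 <= phi x) ->
  \int[P]_w en (\sum_(n <oo) ext phi (xi n w)) =
  en (\int[lebesgue_measure]_(x in D) ((1 - en (phi x)) * (rate x)%:E)).
Proof.
move=> mphi phi0.
pose f := nnsfun_approx measurableT mphi.
pose B n : set R := `[(- n%:R : R)%R, (n%:R : R)%R]%classic.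
pose psi n x : \bar R := (f n x * \1_(B n) x)%:E.
have psi0 n x : 0 <= psi n x by rewrite lee_fin mulr_ge0.
have mpsi n : measurable_fun [set: R] (psi n).
  apply/measurable_EFinP; apply: measurable_funM => //.
  by apply: measurable_indic; exact: measurable_itv.
have ndpsi x : nondecreasing_seq (psi ^~ x).
  move=> i j ij; rewrite lee_fin; apply: ler_pM => //.
    by have /lefP := nd_nnsfun_approx measurableT mphi ij; apply.
  rewrite !indicE ler_nat; case: (boolP (x \in B i)) => // /set_mem/=.
  rewrite /B/= in_itv/= => /andP[ix xi']; rewrite mem_set//= in_itv/=.
  by rewrite (le_trans _ ix) ?lerN2 ?ler_nat//= (le_trans xi') ?ler_nat.
have psiphi x : psi ^~ x @ \oo --> phi x.
  have := cvg_nnsfun_approx measurableT mphi (fun x _ => phi0 x) (x := x) Logic.I.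
  apply: cvg_trans; apply: near_eq_cvg; near=> n.
  have Bx : B n x.
    by rewrite /B/= in_itv/= -ler_norml; near: n; exact: nbhs_infty_ger.
  by rewrite /psi indicE mem_set// mulr1.
have simple n : \int[P]_w en (\sum_(k <oo) ext (psi n) (xi k w)) =
    en (\int[lebesgue_measure]_(x in D) ((1 - en (psi n x)) * (rate x)%:E)).
  (* Only the positive values are kept: [poisson_laplace_simple] needs them positive, and the value
     0 contributes nothing. *)
  pose s := [seq y <- fset_set (range (f n)) | (0 < y)%R].
  have us : uniq s by apply/filter_uniq/fset_uniq.
  pose v (i : 'I_(size s)) := s`_i.
  pose A (i : 'I_(size s)) := f n @^-1` [set v i] `&` B n.
  have psiE : psi n = (fun x => \sum_(i < size s) (v i * \1_(A i) x)%:E).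
    apply/funext => x; transitivity (\sum_(y <- s)
        (y * \1_(f n @^-1` [set y] `&` B n) x)%:E); last first.
      by rewrite (big_nth 0%R) big_mkord.
    rewrite /psi sumEFin; congr EFin.
    have other y : y != f n x -> (y * \1_(f n @^-1` [set y] `&` B n) x = 0)%R.
      by move=> yf; rewrite indicE memNset ?mulr0// => -[/= fy _]; rewrite fy eqxx in yf.
    case: (boolP (f n x \in s)) => [fs|].
      rewrite (bigD1_seq (f n x))//= big1 ?addr0; last by move=> y /other.
      by congr (_ * _)%R; rewrite !indicE; congr (_%:R)%R; congr nat_of_bool;
        apply/idP/idP => [/set_mem Bx|/set_mem[_ Bx]]; exact/mem_set.
    rewrite mem_filter in_fset_set//= mem_set ?andbT; last by exists x.
    rewrite -leNgt => f0; have f00 : f n x = 0%R by apply/eqP; rewrite eq_le f0/=.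
    rewrite f00 mul0r big_seq big1// => y; rewrite mem_filter => /andP[y0 _].
    by apply: other; rewrite f00 gt_eqF.
  have mA i : measurable (A i).
    apply: measurableI; last exact: measurable_itv.
    by rewrite -[X in measurable X]setTI; exact: measurable_funP.
  rewrite psiE; apply: poisson_laplace_simple => //.
  - apply/trivIsetP => i j _ _ /eqP ij; apply/seteqP; split=> // x.
    move=> [[/= fi _] [/= fj _]]; apply: ij; apply/val_inj.
    apply: (uniqP 0%R us); [exact: ltn_ord|exact: ltn_ord|].
    exact: etrans (esym fi) fj.
  - move=> i; apply: le_lt_trans (locally_finite n).
    apply: ge0_subset_integral => //.
    + by apply: measurableI; [exact: mA|exact: mD].
    + by apply: measurableI => //; exact: measurable_itv.
    + apply/measurable_EFinP; apply: measurable_funS mrate => // x [].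
    + by move=> x [_ Dx]; rewrite lee_fin rate0.
    + by move=> x [[_ Bx] Dx].
  - move=> i; have : v i \in s by rewrite mem_nth.
    by rewrite mem_filter => /andP[].
have lhs : \int[P]_w en (\sum_(k <oo) ext (psi n) (xi k w)) @[n --> \oo] -->
    \int[P]_w en (\sum_(k <oo) ext phi (xi k w)).
  have nde x : nondecreasing_seq (fun n => ext (psi n) x).
    by case: x => [r| |] i j ij //=; exact: ndpsi.
  have ext0 n x : 0 <= ext (psi n) x by exact: ext_ge0.
  apply: bounded_cvg.
  - move=> n; apply: measurableT_comp (measurable_en _) _ => //.
    apply: ge0_emeasurable_sum => k; first by move=> *; exact: ext0.
    by move=> _; exact: measurableT_comp (measurable_ext (mpsi n)) (mxi k).
  - by move=> n w; rewrite en_ge0 en_le1// nneseries_ge0.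
  - move=> w.
    have c : \sum_(k <oo) ext (psi n) (xi k w) @[n --> \oo] -->
        \sum_(k <oo) ext phi (xi k w).
      apply: cvg_nneseries_monotone => // k.
      by case: (xi k w) => [r| |] /=; [exact: psiphi|exact: cvg_cst..].
    rewrite -(cvg_lim _ c)//; apply: cvg_en => i j ij.
    by apply: lee_nneseries => // k _; exact: nde.
have rhs := cvg_en_integral mpsi psi0 ndpsi psiphi.
move: lhs; rewrite (funext simple) => lhs.
exact: cvg_unique lhs rhs.
Unshelve. all: by end_near. Qed.

End PoissonLaplace.

(** * The Laplace functional of the Hawkes process *)

Section Translation.
Context (R : realType).
Local Open Scope ereal_scope.
Local Notation mu := (@lebesgue_measure R).

Lemma lebesgue_measure_translate (u : R) (A : set R) : measurable A ->
  mu ((fun x => x + u)%R @^-1` A) = mu A.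
Proof.
move=> mA.
pose sh : R -> measurableTypeR R := fun x => (x + u)%R.
have msh : measurable_fun [set: R] sh.
  by apply: measurable_funD => //; exact: measurable_cst.
pose sh' : {mfun R >-> measurableTypeR R} := HB.pack sh (isMeasurableFun.Build _ _ _ _ _ msh).
apply/esym.
apply: (@lebesgue_measure_unique R (pushforward mu sh')) => //.
move=> _ [[a b]] _ <-; rewrite /pushforward.
rewrite [X in _ = mu X](_ : _ = `](a - u)%R, (b - u)%R]%classic); last first.
  by apply/seteqP; split => x /=; rewrite !in_itv/= /sh ltrBlDr lerBrDr.
rewrite !lebesgue_measure_itv/= !lte_fin ltrD2r; case: ifP => // _.
by congr EFin; ring.
Qed.

Lemma integral_translate (u : R) (g : R -> \bar R) :
  measurable_fun [set: R] g -> (forall x, 0 <= g x) ->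
  \int[mu]_x g (x + u)%R = \int[mu]_x g x.
Proof.
move=> mg g0.
pose sh : measurableTypeR R -> measurableTypeR R := fun x => (x + u)%R.
have msh : measurable_fun [set: measurableTypeR R] sh.
  by apply: measurable_funD => //; exact: measurable_cst.
have := ge0_integral_pushforward msh mu measurableT mg (fun x _ => g0 x).
rewrite preimage_setT => <-.
by apply: eq_measure_integral => A mA _; exact: lebesgue_measure_translate.
Qed.

End Translation.

(** * Laplace exponents of Poisson branching *)

Section Branching.
Context (R : realType) (m : R) (f : R -> R).
Hypotheses (m0 : 0 < m) (m1 : m < 1) (f_density : prob_density `[0, +oo[ f).
Local Open Scope ereal_scope.
Local Notation mu := (@lebesgue_measure R).
Implicit Types (a b : R * R -> \bar R).

Let D : set R := `[0%R, +oo[%classic.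

Let f0 x : D x -> (0 <= f x)%R.
Proof. by move=> Dx; case: f_density => _ /(_ _ Dx). Qed.

Let mf : measurable_fun D f.
Proof. by case: f_density. Qed.

(** The Laplace exponent of the Poisson children of an individual born at [z.2] in a cluster started
    at [z.1], each child being weighted by [b]. *)
Definition offspring b (z : R * R) : \bar R :=
  \int[mu]_(s in `[0%R, +oo[) ((1 - en (b (z.1, (z.2 + s)%R))) * (m * f s)%:E).

(* en (branching a n (x0, x)) is the expectation of en (\sum_e a (x0, arr e))
   over the first n generations of descendants e of an individual born at x
   in a cluster started at x0. *)
Fixpoint branching a n : R * R -> \bar R :=
  if n is n'.+1 then fun z => a z + offspring (branching a n') z else a.

Let en1B_ge0 (x : \bar R) : 0 <= x -> 0 <= 1 - en x.
Proof. by move=> x0; rewrite sube_ge0 ?en_le1 ?en_fin_num. Qed.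

Lemma offspring_ge0 b z : (forall z, 0 <= b z) -> 0 <= offspring b z.
Proof.
move=> b0; apply: integral_ge0 => s Ds; apply: mule_ge0; first exact: en1B_ge0.
by rewrite lee_fin mulr_ge0 ?f0// ltW.
Qed.

Let mrate : measurable_fun [set: R] ((fun s => (m * f s)%:E) \_ D).
Proof.
have mD : measurable D by exact: measurable_itv.
apply: (measurable_restrictT _ mD).1; apply/measurable_EFinP.
by apply: measurable_funM => //; exact: measurable_cst.
Qed.

Let rate_ge0 s : 0 <= ((fun s => (m * f s)%:E) \_ D) s.
Proof.
rewrite patchE; case: ifPn => // /set_mem Ds.
by rewrite lee_fin mulr_ge0 ?f0// ltW.
Qed.

Let offspringE b z : offspring b z = \int[mu]_s
  ((1 - en (b (z.1, (z.2 + s)%R))) * ((fun s => (m * f s)%:E) \_ D) s).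
Proof.
rewrite /offspring integral_mkcond; apply: eq_integral => s _.
by rewrite !patchE; case: ifPn; rewrite ?mule0.
Qed.

Let measurable_integrand b : measurable_fun [set: R * R] b ->
  measurable_fun [set: (R * R) * R] (fun zs => (1 - en (b (zs.1.1, (zs.1.2 + zs.2)%R))) *
    ((fun s => (m * f s)%:E) \_ D) zs.2).
Proof.
move=> mb; apply: emeasurable_funM; last exact: measurableT_comp mrate _.
apply: emeasurable_funB => //; apply: measurableT_comp (measurable_en _) _ => //.
apply: measurableT_comp mb _; apply: measurable_fun_pair.
  exact: measurableT_comp measurable_fst measurable_fst.
apply: measurable_funD; last exact: measurable_snd.
exact: measurableT_comp measurable_snd measurable_fst.
Qed.

Let measurable_integrand1 b (z : R * R) : measurable_fun [set: R * R] b ->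
  measurable_fun [set: R] (fun s : R => (1 - en (b (z.1, (z.2 + s)%R))) *
    ((fun s => (m * f s)%:E) \_ D) s).
Proof.
move=> mb.
exact: (measurableT_comp (measurable_integrand mb) (pair1_measurable z)).
Qed.

Lemma measurable_offspring b : measurable_fun [set: R * R] b ->
  (forall z, 0 <= b z) -> measurable_fun [set: R * R] (offspring b).
Proof.
move=> mb b0; rewrite (funext (offspringE b)).
apply: (measurable_fun_fubini_tonelli_F (m2 := mu) _ (measurable_integrand mb)).
by move=> z; apply: mule_ge0 => //; exact: en1B_ge0.
Qed.

Lemma branching_ge0 a n z : (forall z, 0 <= a z) -> 0 <= branching a n z.
Proof.
move=> a0; elim: n z => [|n ih] z /=; first exact: a0.
by apply: adde_ge0; [exact: a0|exact: offspring_ge0].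
Qed.

Lemma measurable_branching a n : measurable_fun [set: R * R] a ->
  (forall z, 0 <= a z) -> measurable_fun [set: R * R] (branching a n).
Proof.
move=> ma a0; elim: n => //= n ih; apply: emeasurable_funD => //.
by apply: measurable_offspring => // z; exact: branching_ge0.
Qed.

(** The recursion moves only the second coordinate, so nothing but the fibre of the weight over [x0]
    matters. This is what decouples the clusters of different immigrants. *)
Lemma branching_local a a' x0 n x :
  (forall y, a (x0, y) = a' (x0, y)) ->
  branching a n (x0, x) = branching a' n (x0, x).
Proof.
move=> aa'; elim: n x => [|n ih] x /=; first exact: aa'.
by rewrite aa'; congr (_ + _); apply: eq_integral => s _; rewrite ih.
Qed.

Lemma branching_eq0 a x0 n x :
  (forall y, a (x0, y) = 0) -> branching a n (x0, x) = 0.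
Proof.
move=> a0; elim: n x => [|n ih] x /=; first exact: a0.
rewrite a0 add0e /offspring/= integral0_eq// => s _.
by rewrite ih en0 subee// mul0e.
Qed.

Lemma branching_translate a u n z :
  branching (fun z => a (z.1 - u, z.2 - u)%R) n z =
  branching a n (z.1 - u, z.2 - u)%R.
Proof.
elim: n z => [//|n ih] z /=; congr (_ + _); apply: eq_integral => s _.
by rewrite ih/= addrAC.
Qed.

Lemma branching_snd (g : R -> \bar R) n x0 x0' x :
  branching (fun z => g z.2) n (x0, x) = branching (fun z => g z.2) n (x0', x).
Proof.
elim: n x => [//|n ih] x /=; congr (_ + _); apply: eq_integral => s _.
by rewrite ih.
Qed.

(** By [1 - en x <= x], Tonelli's theorem and translation invariance, passing to the children
    multiplies the total mass by at most [m]; the constant is the sum of the geometric series. *)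
Lemma integral_branching_le (g : R -> \bar R) n :
  measurable_fun [set: R] g -> (forall x, 0 <= g x) ->
  \int[mu]_x branching (fun z => g z.2) n (x, x) <=
  (1 - m)^-1%:E * \int[mu]_x g x.
Proof.
(* The recursion leaves the diagonal, since it shifts the second coordinate alone. Freezing the
   first one at 0 is harmless because the weight ignores it. *)
move=> mg g0; pose G n x := branching (fun z => g z.2) n (0%R, x).
have mg2 : measurable_fun [set: R * R] (fun z => g z.2).
  exact: measurableT_comp mg measurable_snd.
have mG k : measurable_fun [set: R] (G k).
  exact: measurableT_comp (measurable_branching k mg2 (fun z => g0 z.2)) _.
have G0 k x : 0 <= G k x by exact: branching_ge0.
have i0 : 0 <= \int[mu]_x g x by exact: integral_ge0.
have rec k : \int[mu]_x G k.+1 x <= \int[mu]_x g x + m%:E * \int[mu]_x G k x.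
  have -> : \int[mu]_x G k.+1 x =
      \int[mu]_x g x + \int[mu]_x offspring (branching (fun z => g z.2) k) (0%R, x).
    apply: ge0_integralD => //.
    - by move=> x _; apply: offspring_ge0 => z; exact: branching_ge0.
    - apply: (measurableT_comp (f := offspring _)) => //.
      apply: measurable_offspring; first exact: measurable_branching.
      by move=> z; exact: branching_ge0.
  apply: leeD2l.
  pose F (xs : R * R) := G k (xs.1 + xs.2)%R * ((fun s => (m * f s)%:E) \_ D) xs.2.
  have F0 xs : 0 <= F xs by exact: mule_ge0.
  have mF : measurable_fun [set: R * R] F.
    apply: emeasurable_funM; last exact: measurableT_comp mrate _.
    by apply: measurableT_comp (mG k) _; apply: measurable_funD.
  apply: (@le_trans _ _ (\int[mu]_x \int[mu]_s F (x, s))).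
    apply: ge0_le_integral => //.
    - by move=> x _; apply: offspring_ge0 => z; exact: branching_ge0.
    - apply: (measurableT_comp (f := offspring _)) => //.
      apply: measurable_offspring; first exact: measurable_branching.
      by move=> z; exact: branching_ge0.
    - exact: measurable_fun_fubini_tonelli_F.
    move=> x _; rewrite offspringE; apply: ge0_le_integral => //.
    - move=> s _; apply: mule_ge0 => //; apply: en1B_ge0; exact: branching_ge0.
    - have mk := measurable_branching k mg2 (fun z => g0 z.2).
      exact: (measurable_integrand1 ((0 : R)%R, x) mk).
    - exact: (measurableT_comp mF (pair1_measurable x)).
    - by move=> s _; apply: lee_wpmul2r => //; apply: enN_le1B; exact: branching_ge0.
  rewrite (fubini_tonelli (m1 := mu) (m2 := mu) F mF F0).
  have int_rate : \int[mu]_s (((fun s => (m * f s)%:E) \_ D) s) = m%:E.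
    rewrite -integral_mkcond.
    under eq_integral do rewrite EFinM.
    have mD : measurable D by exact: measurable_itv.
    rewrite ge0_integralZl_EFin; [|exact: mD|by move=> x Dx; rewrite lee_fin f0|
      exact/measurable_EFinP|exact: ltW].
    by case: f_density => _ _ ->; rewrite mule1.
  rewrite -int_rate -ge0_integralZr//; last exact: integral_ge0.
  rewrite le_eqVlt; apply/orP; left; apply/eqP; apply: eq_integral => s _.
  rewrite /F/= ge0_integralZr//; last by apply: measurableT_comp (mG k) _; exact: measurable_funD.
  by rewrite muleC integral_translate.
have -> : \int[mu]_x branching (fun z => g z.2) n (x, x) = \int[mu]_x G n x.
  by apply: eq_integral => x _; exact: branching_snd.
move: i0; case E : (\int[mu]_x g x) => [c| |]// c0; last first.
  by rewrite gt0_muley ?leey// lte_fin invr_gt0 subr_gt0.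
elim: n => [|k ih].
  rewrite [leLHS]E -EFinM lee_fin ler_peMl// invf_ge1 ?subr_gt0//.
  by rewrite lerBlDr lerDl ltW.
apply: le_trans (rec k) _; rewrite E.
apply: (@le_trans _ _ (c%:E + m%:E * ((1 - m)^-1%:E * c%:E))).
  by apply: leeD2l; apply: lee_wpmul2l => //; rewrite lee_fin ltW.
rewrite -!EFinM -EFinD lee_fin le_eqVlt; apply/orP; left; apply/eqP.
by field; rewrite subr_eq0 gt_eqF.
Qed.

End Branching.

Section GeneratedSigma.
Context d (T : measurableType d) d' (E : measurableType d') (I : Type).
Variable X : I -> T -> E.

Lemma sigma_of_sigma_algebra : sigma_algebra [set: T] (sigma_of X).
Proof. exact: smallest_sigma_algebra. Qed.

Lemma sigma_of_measurable A : (forall i, measurable_fun [set: T] (X i)) ->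
  sigma_of X A -> measurable A.
Proof.
move=> mX; apply: (smallest_sub (@sigma_algebra_measurable _ T)).
by move=> _ [i _ [B mB <-]]; exact: mX.
Qed.

Lemma measurable_sigma_of i :
  measurable_fun [set: g_sigma_algebraType (sigma_of X)] (X i).
Proof.
move=> _ B mB; apply: sub_sigma_algebra; apply: sub_sigma_algebra.
by exists i => //; exists B.
Qed.

End GeneratedSigma.

Section Ext2.
Context (R : realType).
Local Open Scope ereal_scope.

Definition ext2 (h : R * R -> \bar R) (z : \bar R * \bar R) : \bar R :=
  ext (fun r0 => ext (fun r => h (r0, r)) z.2) z.1.

Lemma ext2_ge0 h z : (forall r, 0 <= h r) -> 0 <= ext2 h z.
Proof. by move=> h0; apply: ext_ge0 => r0; exact: ext_ge0. Qed.

Lemma measurable_ext2 h : measurable_fun [set: R * R] h ->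
  measurable_fun [set: \bar R * \bar R] (ext2 h).
Proof.
move=> mh.
have -> : ext2 h = (fun z => if (z.1 \is a fin_num) && (z.2 \is a fin_num) then
    h (fine z.1, fine z.2) else 0).
  by apply/funext => -[[r0| |] [r| |]].
apply: measurable_fun_ifT; last exact: measurable_cst.
  apply: measurable_and.
    exact: measurableT_comp (@measurable_fin_num_bool R) measurable_fst.
  exact: measurableT_comp (@measurable_fin_num_bool R) measurable_snd.
apply: measurableT_comp mh _; apply: measurable_fun_pair.
  exact: measurableT_comp (fine_measurable _) measurable_fst.
exact: measurableT_comp (fine_measurable _) measurable_snd.
Qed.

Lemma ext2D h h' z : (forall r, 0 <= h r) ->
  ext2 (fun r => h r + h' r) z = ext2 h z + ext2 h' z.
Proof. by move=> h0; case: z => -[r0| |] [r| |]; rewrite /ext2/= ?adde0. Qed.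

End Ext2.

(** * Averaging over the generations *)

Section HawkesLaplace.
Context d (T : measurableType d) (R : realType) (P : probability T R).
Context (lambda0 m : R) (f : R -> R).
Context (imm : nat -> T -> \bar R) (off : label -> nat -> T -> \bar R).
Hypotheses (lambda0_gt0 : 0 < lambda0) (m0 : 0 < m) (m1 : m < 1).
Hypothesis f_density : prob_density `[0, +oo[ f.
Hypothesis hawkes : stationary_hawkes P lambda0 m f imm off.
Local Open Scope ereal_scope.
Local Notation mu := (@lebesgue_measure R).

Definition birth (e : label) (w : T) : \bar R * \bar R :=
  (imm e.1 w, arrival imm off e w).

Let source (o : option label) : set (set T) :=
  if o is Some e then sigma_of (off e) else sigma_of imm.

Let mimm i : measurable_fun [set: T] (imm i).
Proof. by case: (immigrants_poisson hawkes). Qed.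

Let moff e k : measurable_fun [set: T] (off e k).
Proof. by case: (offspring_poisson hawkes e). Qed.

Let source_sigma o : sigma_algebra [set: T] (source o).
Proof. by case: o => [e|]; exact: sigma_of_sigma_algebra. Qed.

Let source_measurable o A : source o A -> measurable A.
Proof. by case: o => [e|]; apply: sigma_of_measurable => i. Qed.

Let source_independent : mutual_independence P source.
Proof. exact: hawkes_independence hawkes. Qed.

(** These sources determine all births up to generation [n], and are independent of the offspring
    processes of generation [n]. *)
Definition known n : set (option label) :=
  [set o | if o is Some e then (size e.2 < n)%N else True].

Local Notation known_type n := (g_sigma_algebraType (joint source (known n))).

Lemma measurable_birth_time n i p : (size p <= n)%N ->
  measurable_fun [set: known_type n] (birth_time imm off i p).
Proof.
elim: p => [_|k p ih pn] /=.
  by apply: (@measurable_fun_factor _ _ _ source _ _ _ None); last exact: measurable_sigma_of.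
apply: emeasurable_funD; first exact: ih (ltnW pn).
apply: (@measurable_fun_factor _ _ _ source _ _ _ (Some (i, p))) => //.
exact: measurable_sigma_of.
Qed.

Lemma measurable_birth_known n e : (size e.2 <= n)%N ->
  measurable_fun [set: known_type n] (birth e).
Proof.
move=> en; apply: measurable_fun_pair; last exact: measurable_birth_time.
exact: (@measurable_birth_time n e.1 [::]).
Qed.

Lemma measurable_birth e : measurable_fun [set: T] (birth e).
Proof.
have := @measurable_birth_known (size e.2) e (leqnn _).
exact: (measurable_fun_joint source_measurable).
Qed.

Definition generation n : set label := [set e | size e.2 = n].
Definition earlier n : set label := [set e | (size e.2 < n)%N].

Lemma esum_earlierS n (c : label -> \bar R) : (forall e, 0 <= c e) ->
  \esum_(e in earlier n.+1) c e =
  \esum_(e in earlier n) c e + \esum_(e in generation n) c e.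
Proof.
move=> c0; rewrite (esumID (earlier n))//.
have -> : earlier n.+1 `&` earlier n = earlier n.
  by apply/seteqP; split => e /=; rewrite /earlier/=; lia.
congr (_ + _); have -> : earlier n.+1 `&` ~` earlier n = generation n; last by [].
by apply/seteqP; split => e /=; rewrite /earlier/generation/=; lia.
Qed.

Lemma esum_generationS n (c : label -> \bar R) : (forall e, 0 <= c e) ->
  \esum_(e in generation n.+1) c e =
  \esum_(e in generation n) \sum_(k <oo) c (e.1, k :: e.2).
Proof.
move=> c0; under [RHS]eq_esum do rewrite nneseries_esumT//.
rewrite (@esum_esum _ _ _ (generation n) (fun=> setT) (fun e k => c (e.1, k :: e.2)))//.
apply: (reindex_esum _ _ (fun ek : label * nat => (ek.1.1, ek.2 :: ek.1.2))).
split.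
- by move=> [e k] [/= en _]; rewrite /generation/= en.
- by move=> [[i p] k] [[j q] l] /= _ _ [-> -> ->].
- by move=> [i [|k p]]//= [np]; exists ((i, p), k) => //; split.
Qed.

(** The weight [b] of generation [n] is meant to include, besides [a], the averaged contribution of
    the descendants beyond it. *)
Definition truncated_sum n a b w :=
  \esum_(e in earlier n) ext2 a (birth e w) +
  \esum_(e in generation n) ext2 b (birth e w).

Lemma poisson_offspring e b (z : \bar R * \bar R) :
  measurable_fun [set: R * R] b -> (forall z, 0 <= b z) ->
  \int[P]_w en (\sum_(k <oo) ext2 b (z.1, z.2 + off e k w)) =
  en (ext2 (offspring m f b) z).
Proof.
move=> mb b0.
pose D : set R := `[0%R, +oo[%classic.
have mD : measurable D by exact: measurable_itv.
have mf : measurable_fun D f by case: f_density.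
have f0 x : D x -> (0 <= f x)%R by case: f_density => _ /(_ x).
have mrate : measurable_fun D (fun x => m * f x)%R.
  by apply: measurable_funM => //; exact: measurable_cst.
have rate0 x : D x -> (0 <= m * f x)%R by move=> Dx; rewrite mulr_ge0 ?f0 ?ltW.
(* An absent individual has no children, so that the sum vanishes identically. *)
have trivial_case : (forall k w, ext2 b (z.1, z.2 + off e k w) = 0) ->
    \int[P]_w en (\sum_(k <oo) ext2 b (z.1, z.2 + off e k w)) = 1.
  move=> h; under eq_integral.
    by move=> w _; rewrite eseries0 => [|k _ _]; [rewrite en0; over|exact: h].
  by rewrite integral_cst//= mul1e; exact: probability_setT.
case: z trivial_case => -[r0| |] z2 trivial_case; last 2 first.
- by rewrite trivial_case// [ext2 _ _]/= en0.
- by rewrite trivial_case// [ext2 _ _]/= en0.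
case: z2 trivial_case => [r1| |] trivial_case; last 2 first.
- rewrite trivial_case ?[ext2 _ _]/= ?en0// => k w.
  by rewrite /ext2/=; case: (off e k w).
- by rewrite trivial_case// [ext2 _ _]/= en0.
transitivity (\int[P]_w en (\sum_(k <oo) ext (fun s => b (r0, r1 + s)%R) (off e k w))).
  apply: eq_integral => w _; congr en; apply: eq_eseriesr => k _.
  by case: (off e k w).
apply: (poisson_laplace mD mrate rate0 (offspring_poisson hawkes e)) => //.
- move=> n; apply: (@le_lt_trans _ _ (\int[mu]_(x in D) (m * f x)%:E)).
    apply: ge0_subset_integral => //.
    + by apply: measurableI => //; exact: measurable_itv.
    + exact/measurable_EFinP.
  under eq_integral do rewrite EFinM.
  rewrite ge0_integralZl_EFin; [|exact: mD|by move=> x Dx; rewrite lee_fin f0|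
    exact/measurable_EFinP|exact: ltW].
  by case: f_density => _ _ ->; rewrite mule1 ltry.
- apply: measurableT_comp mb _; apply: measurable_fun_pair; first exact: measurable_cst.
  by apply: measurable_funD => //; exact: measurable_cst.
Qed.

(** Given [known n], the births of generation [n] are fixed while their offspring processes are
    fresh. Generation [n.+1] is integrated out, and its exponent is charged to the parents. *)
Lemma laplace_step n a b :
  measurable_fun [set: R * R] a -> (forall z, 0 <= a z) ->
  measurable_fun [set: R * R] b -> (forall z, 0 <= b z) ->
  \int[P]_w en (truncated_sum n.+1 a b w) =
  \int[P]_w en (truncated_sum n a (fun z => a z + offspring m f b z) w).
Proof.
move=> ma a0 mb b0.
have o0 z : 0 <= offspring m f b z by apply: offspring_ge0.
pose W w := \esum_(e in earlier n) ext2 a (birth e w) +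
  \esum_(e in generation n) ext2 a (birth e w).
pose K : set (option label) := Some @` generation n.
pose y (o : option label) w : \bar R * \bar R := if o is Some e then birth e w else (0, 0).
pose r (o : option label) (z : \bar R * \bar R) w : \bar R :=
  if o is Some e then \sum_(k <oo) ext2 b (z.1, z.2 + off e k w) else 0.
pose rho (o : option label) := ext2 (offspring m f b).
have esumK (c : option label -> \bar R) :
    \esum_(o in K) c o = \esum_(e in generation n) c (Some e).
  by rewrite esum_image// => e e' _ _ [].
transitivity (\int[P]_w en (W w + \esum_(o in K) r o (y o w) w)).
  apply: eq_integral => w _; congr en.
  rewrite /truncated_sum esum_earlierS//; last by move=> e; exact: ext2_ge0.
  congr (_ + _); rewrite esumK esum_generationS//; last by move=> e; exact: ext2_ge0.
  by apply: eq_esum => -[i p] _.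
transitivity (\int[P]_w en (W w + \esum_(o in K) rho o (y o w))); last first.
  apply: eq_integral => w _; congr en.
  rewrite esumK /W -addeA; congr (_ + _); rewrite -esumD//.
  - by apply: eq_esum => e _; rewrite ext2D.
  - by move=> e _; exact: ext2_ge0.
  - by move=> e _; exact: ext2_ge0.
apply: (@integrate_out _ _ _ P _ source source_sigma source_measurable
  source_independent _ _ (known n) K).
- by move=> _ [e en <-]; rewrite /known/= en ltnn.
- have mext e : (size e.2 <= n)%N ->
      measurable_fun [set: known_type n] (fun w => ext2 a (birth e w)).
    by move=> en; exact: measurableT_comp (measurable_ext2 ma) (measurable_birth_known en).
  apply: emeasurable_funD.
    apply: measurable_esum => [e en|e w _]; last exact: ext2_ge0.
    by apply: mext; exact: ltnW.
  apply: measurable_esum => [e en|e w _]; last exact: ext2_ge0.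
  by apply: mext; rewrite en.
- by move=> w; apply: adde_ge0; apply: esum_ge0 => e _; exact: ext2_ge0.
- by move=> _ [e en <-]; apply: measurable_birth_known; rewrite en.
- move=> _ [e en <-] /=; apply: ge0_emeasurable_sum => k.
    by move=> z _ _; exact: ext2_ge0.
  move=> _; apply: measurableT_comp (measurable_ext2 mb) _.
  apply: measurable_fun_pair.
    exact: measurableT_comp measurable_fst measurable_fst.
  apply: emeasurable_funD.
    exact: measurableT_comp measurable_snd measurable_fst.
  exact: measurableT_comp (@measurable_sigma_of _ _ _ _ _ (off e) k) measurable_snd.
- by move=> [e|] z w //=; apply: nneseries_ge0 => k _ _; exact: ext2_ge0.
- by move=> o z; exact: ext2_ge0.
- by move=> _ z [e en <-]; exact: poisson_offspring.
Qed.

Lemma laplace_iterate n k a :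
  measurable_fun [set: R * R] a -> (forall z, 0 <= a z) ->
  \int[P]_w en (truncated_sum n a (branching m f a k) w) =
  \int[P]_w en (truncated_sum 0 a (branching m f a (k + n)) w).
Proof.
move=> ma a0; elim: n k => [|n ih] k; first by rewrite addn0.
rewrite laplace_step//; last 2 first.
- exact: measurable_branching.
- by move=> z; exact: branching_ge0.
by rewrite addnS -addSn -ih.
Qed.

Lemma measurable_branching_diag n a :
  measurable_fun [set: R * R] a -> (forall z, 0 <= a z) ->
  measurable_fun [set: R] (fun x => branching m f a n (x, x)).
Proof.
move=> ma a0.
apply: (@measurableT_comp _ _ _ _ _ _ (branching m f a n) setT (fun x : R => (x, x))).
  exact: measurable_branching.
exact: measurable_fun_pair.
Qed.

Lemma integrand_ge0 n a x : (forall z, 0 <= a z) ->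
  0 <= (1 - en (branching m f a n (x, x))) * lambda0%:E.
Proof.
move=> a0; apply: mule_ge0; last by rewrite lee_fin ltW.
have b0 : 0 <= branching m f a n (x, x) by exact: branching_ge0.
by rewrite sube_ge0 ?en_le1 ?en_fin_num.
Qed.

Lemma laplace_immigrants b a :
  measurable_fun [set: R * R] b -> (forall z, 0 <= b z) ->
  \int[P]_w en (truncated_sum 0 a b w) =
  en (\int[mu]_x ((1 - en (b (x, x))) * lambda0%:E)).
Proof.
move=> mb b0.
transitivity (\int[P]_w en (\sum_(i <oo) ext (fun x => b (x, x)) (imm i w))).
  apply: eq_integral => w _; congr en; rewrite /truncated_sum.
  have -> : earlier 0 = set0 by apply/seteqP; split.
  rewrite esum_set0 add0e.
  rewrite (reindex_esum [set: nat] (generation 0) (fun i => (i, [::]) : label)).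
    rewrite -nneseries_esumT; last by move=> i; exact: ext2_ge0.
    by apply: eq_eseriesr => i _; rewrite /ext2/birth/arrival/=; case: (imm i w).
  split.
  - by [].
  - by move=> i j _ _ [].
  - by move=> [i [|//]] _; exists i.
apply: (poisson_laplace measurableT _ _ (immigrants_poisson hawkes)) => //.
- by move=> x _; exact: ltW.
- move=> n; rewrite /intensity setIT integral_cst//=.
  by rewrite lebesgue_measure_itv/=; case: ifP => _; rewrite ?mule0 ?ltry// -EFinD -EFinM ltry.
- by apply: measurableT_comp mb _; exact: measurable_fun_pair.
Qed.

Lemma cvg_esum_earlier (c : label -> \bar R) : (forall e, 0 <= c e) ->
  \esum_(e in earlier n) c e @[n --> \oo] --> \esum_(e in [set: label]) c e.
Proof.
move=> c0; under eq_fun do rewrite esum_countable//.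
rewrite esum_countable//; apply: cvg_nneseries_monotone.
- by move=> n k; case: pickle_inv => [e|]//=; case: ifP.
- move=> k; case: pickle_inv => [e|]//= i j ij.
  case: (boolP (e \in earlier i)) => [/set_mem ei|_]; last by case: ifP.
  by rewrite mem_set//; exact: leq_trans ei ij.
- move=> k; case: pickle_inv => [e|]/=; last exact: cvg_cst.
  rewrite mem_set//; apply: cvg_near_cst; near=> n; rewrite mem_set//.
  by near: n; exists (size e.2).+1.
Unshelve. all: by end_near. Qed.

Definition birth_sum a w := \esum_(e in [set: label]) ext2 a (birth e w).

Lemma birth_sum_ge0 a w : (forall z, 0 <= a z) -> 0 <= birth_sum a w.
Proof. by move=> a0; apply: esum_ge0 => e _; exact: ext2_ge0. Qed.

Lemma measurable_birth_sum a : measurable_fun [set: R * R] a ->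
  (forall z, 0 <= a z) -> measurable_fun [set: T] (birth_sum a).
Proof.
move=> ma a0; apply: measurable_esum => [e _|e w _]; last exact: ext2_ge0.
exact: measurableT_comp (measurable_ext2 ma) (measurable_birth e).
Qed.

Definition laplace a := \int[P]_w en (birth_sum a w).

Lemma laplace_fin_num a : measurable_fun [set: R * R] a ->
  (forall z, 0 <= a z) -> laplace a \is a fin_num.
Proof.
move=> ma a0; rewrite ge0_fin_numE; last by apply: integral_ge0 => w _; exact: en_ge0.
apply: (@le_lt_trans _ _ (\int[P]_w cst 1 w)); last first.
  by rewrite integral_cst//= mul1e probability_setT ltry.
apply: ge0_le_integral => //.
- by move=> w _; exact: en_ge0.
- exact: measurableT_comp (measurable_en _) (measurable_birth_sum ma a0).
- by move=> w _; rewrite en_le1// birth_sum_ge0.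
Qed.

(** For the sum restricted to the generations up to [n], averaging from the last generation down to
    the immigrants is exact; bounded convergence then removes the restriction. *)
Theorem cvg_laplace a :
  measurable_fun [set: R * R] a -> (forall z, 0 <= a z) ->
  en (\int[mu]_x ((1 - en (branching m f a n (x, x))) * lambda0%:E))
    @[n --> \oo] --> laplace a.
Proof.
move=> ma a0.
have e0 w e : 0 <= ext2 a (birth e w) by exact: ext2_ge0.
have -> : (fun n => en (\int[mu]_x ((1 - en (branching m f a n (x, x))) * lambda0%:E))) =
    (fun n => \int[P]_w en (\esum_(e in earlier n.+1) ext2 a (birth e w))).
  apply/funext => n.
  rewrite -(@laplace_immigrants _ a); last 2 first.
  - exact: measurable_branching.
  - by move=> z; exact: branching_ge0.
  (* Each integrated generation adds one to the depth of the recursion, which starts at depth 0,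
     where [branching] is [a] itself. *)
  rewrite -[n in branching m f a n]add0n -laplace_iterate//.
  by apply: eq_integral => w _; rewrite esum_earlierS.
apply: bounded_cvg.
- move=> n; apply: measurableT_comp (measurable_en _) _ => //.
  apply: measurable_esum => [e _|e w _]; last exact: e0.
  exact: measurableT_comp (measurable_ext2 ma) (measurable_birth e).
- by move=> n w; rewrite en_ge0 en_le1// esum_ge0.
- move=> w; have c := cvg_esum_earlier (e0 w).
  have nd : nondecreasing_seq (fun n => \esum_(e in earlier n) ext2 a (birth e w)).
    move=> i j ij; rewrite esum_mkcond [leRHS]esum_mkcond; apply: le_esum => e _.
    case: (boolP (e \in earlier i)) => [/set_mem ei|_]; last by case: ifP.
    by rewrite mem_set//; exact: leq_trans ei ij.
  have := cvg_en nd; rewrite (cvg_lim _ c)//.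
  by rewrite -(cvg_shiftS (_ \o _)).
Qed.

Lemma laplace_translate u a :
  measurable_fun [set: R * R] a -> (forall z, 0 <= a z) ->
  laplace (fun z => a (z.1 - u, z.2 - u)%R) = laplace a.
Proof.
move=> ma a0.
have mau : measurable_fun [set: R * R] (fun z => a (z.1 - u, z.2 - u)%R).
  apply: measurableT_comp ma _; apply: measurable_fun_pair.
    by apply: measurable_funB.
  by apply: measurable_funB.
have e n : en (\int[mu]_x ((1 - en (branching m f
      (fun z => a (z.1 - u, z.2 - u)%R) n (x, x))) * lambda0%:E)) =
    en (\int[mu]_x ((1 - en (branching m f a n (x, x))) * lambda0%:E)).
  congr en; under eq_integral do rewrite branching_translate/=.
  rewrite -[RHS](@integral_translate _ (- u)%R)//.
  - apply: emeasurable_funM => //; apply: emeasurable_funB => //.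
    apply: measurableT_comp (measurable_en _) _ => //.
    exact: measurable_branching_diag.
  - move=> x; exact: integrand_ge0.
have c := cvg_laplace mau (fun z => a0 _).
rewrite (funext e) in c.
exact: cvg_unique c (cvg_laplace ma a0).
Qed.

(** [1 - en] is not additive, but over each immigrant time one of the two exponents vanishes, so the
    integrands, hence the exponents of the Laplace functionals, do add. *)
Lemma laplace_factor a1 a2 :
  measurable_fun [set: R * R] a1 -> (forall z, 0 <= a1 z) ->
  measurable_fun [set: R * R] a2 -> (forall z, 0 <= a2 z) ->
  (forall x0, (forall x, a1 (x0, x) = 0) \/ (forall x, a2 (x0, x) = 0)) ->
  laplace (fun z => a1 z + a2 z) = laplace a1 * laplace a2.
Proof.
move=> ma1 a10 ma2 a20 a12.
have ma : measurable_fun [set: R * R] (fun z => a1 z + a2 z) by exact: emeasurable_funD.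
have a0 z : 0 <= a1 z + a2 z by exact: adde_ge0.
have mI a n : measurable_fun [set: R * R] a -> (forall z, 0 <= a z) ->
    measurable_fun [set: R] (fun x => (1 - en (branching m f a n (x, x))) * lambda0%:E).
  move=> {}ma {}a0; apply: emeasurable_funM => //; apply: emeasurable_funB => //.
  apply: measurableT_comp (measurable_en _) _ => //.
  exact: measurable_branching_diag.
have I0 a n x : (forall z, 0 <= a z) ->
    0 <= (1 - en (branching m f a n (x, x))) * lambda0%:E.
  exact: integrand_ge0.
have e n : en (\int[mu]_x ((1 - en (branching m f
      (fun z => a1 z + a2 z) n (x, x))) * lambda0%:E)) =
    en (\int[mu]_x ((1 - en (branching m f a1 n (x, x))) * lambda0%:E)) *
    en (\int[mu]_x ((1 - en (branching m f a2 n (x, x))) * lambda0%:E)).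
  rewrite -enD; last 2 first.
  - by apply: integral_ge0 => x _; exact: I0.
  - by apply: integral_ge0 => x _; exact: I0.
  congr en; rewrite -ge0_integralD//; last 4 first.
  - by move=> x _; exact: I0.
  - exact: mI.
  - by move=> x _; exact: I0.
  - exact: mI.
  apply: eq_integral => x _; have [a1x|a2x] := a12 x.
    rewrite (@branching_local _ m f _ a2); last by move=> y; rewrite a1x add0e.
    by rewrite (branching_eq0 m f n x a1x) en0 subee// mul0e add0e.
  rewrite (@branching_local _ m f _ a1); last by move=> y; rewrite a2x adde0.
  by rewrite (branching_eq0 m f n x a2x) en0 subee// mul0e adde0.
have c := cvg_laplace ma a0; rewrite (funext e) in c.
apply: (cvg_unique _ c) => //.
by apply: cvgeM; [by apply: mule_def_fin; exact: laplace_fin_num|exact: cvg_laplace|exact: cvg_laplace].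
Qed.

(** The exponent is at most linear in the weight; [mean_le_of_laplace] later turns this lower bound
    into an upper bound on means. *)
Lemma laplace_ge (g : R -> \bar R) :
  measurable_fun [set: R] g -> (forall x, 0 <= g x) ->
  en ((lambda0 / (1 - m))%:E * \int[mu]_x g x) <= laplace (fun z => g z.2).
Proof.
move=> mg g0.
have mg2 : measurable_fun [set: R * R] (fun z => g z.2).
  exact: measurableT_comp mg measurable_snd.
have c := cvg_laplace mg2 (fun z => g0 z.2).
rewrite -(cvg_lim _ c)//; apply: lime_ge; first exact: cvgP c.
apply: nearW => n; rewrite lee_en.
have mb : measurable_fun [set: R] (fun x => branching m f (fun z => g z.2) n (x, x)).
  exact: measurable_branching_diag.
apply: (@le_trans _ _ (\int[mu]_x (branching m f (fun z => g z.2) n (x, x) * lambda0%:E))).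
  apply: ge0_le_integral => //.
  - move=> x _; exact: integrand_ge0.
  - apply: emeasurable_funM => //; apply: emeasurable_funB => //.
    by apply: measurableT_comp (measurable_en _) _.
  - exact: emeasurable_funM.
  - move=> x _; apply: lee_wpmul2r; first by rewrite lee_fin ltW.
    by apply: enN_le1B; exact: branching_ge0.
rewrite ge0_integralZr//; last 2 first.
- by move=> x _; exact: branching_ge0.
- by rewrite lee_fin ltW.
rewrite EFinM -muleA [leLHS]muleC; apply: lee_wpmul2l; first by rewrite lee_fin ltW.
exact: integral_branching_le.
Qed.

End HawkesLaplace.

(** * Job sizes *)

Section MeanFromLaplace.
Context d (T : measurableType d) (R : realType) (P : probability T R).
Local Open Scope ereal_scope.

Lemma cvg_difference_quotient (Z : \bar R) : 0 <= Z ->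
  n.+1%:R%:E * (1 - en (n.+1%:R^-1%:E * Z)) @[n --> \oo] --> Z.
Proof.
case: Z => [z| |]//; last first.
  move=> _.
  have -> : (fun n => n.+1%:R%:E * (1 - en (n.+1%:R^-1%:E * +oo))) =
      (fun n => (n.+1%:R : R)%:E).
    by apply/funext => n; rewrite gt0_muley ?lte_fin// eny sube0 mule1.
  apply/cvgeryP.
  have := @cvgr_idn R; rewrite -cvg_shiftS; exact.
rewrite lee_fin => z0.
pose e (n : nat) : R := expR (- (n.+1%:R^-1 * z)).
have e1 : e n @[n --> \oo] --> (1 : R)%R.
  have c0 : (- ((n.+1%:R^-1 : R) * z))%R @[n --> \oo] --> (- (0 * z) : R)%R.
    by apply: cvgN; apply: cvgM; [exact: cvg_harmonic|exact: cvg_cst].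
  have := cvg_comp _ _ c0 (@continuous_expR R (- (0 * z))%R).
  by rewrite mul0r oppr0 expR0; exact.
have lim : (n.+1%:R * (1 - e n))%R @[n --> \oo] --> z.
  apply: (@squeeze_cvgr _ _ _ _ (fun n => z * e n)%R (cst z)).
  - near=> n; have n0 : (0 < n.+1%:R :> R)%R by [].
    have x0 : (0 <= n.+1%:R^-1 * z)%R by rewrite mulr_ge0.
    apply/andP; split; last first.
      rewrite -ler_pdivlMl// lerBlDr -lerBlDl /e.
      exact: (expR_ge1Dx (- (n.+1%:R^-1 * z))).
    rewrite -ler_pdivrMl// mulrA lerBrDr -[X in (_ + X)%R]mul1r -mulrDl.
    rewrite -[leRHS](@mulVf _ (expR (n.+1%:R^-1 * z))) ?gt_eqF ?expR_gt0//.
    rewrite /e expRN mulrC ler_wpM2l ?invr_ge0 ?expR_ge0//.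
    by rewrite addrC expR_ge1Dx.
  - by rewrite -[X in _ --> X](mulr1 z); apply: cvgM => //; exact: cvg_cst.
  - exact: cvg_cst.
by apply: cvg_EFin; [exact: nearW|exact: lim].
Unshelve. all: by end_near. Qed.

(** Fatou's lemma for the difference quotients of the Laplace transform at 0. No finiteness of [Z]
    is presupposed, so that almost sure finiteness can be deduced from the bound. *)
Lemma mean_le_of_laplace (Z : T -> \bar R) (C : \bar R) :
  measurable_fun [set: T] Z -> (forall w, 0 <= Z w) -> 0 <= C ->
  (forall n : nat, en (n.+1%:R^-1%:E * C) <= \int[P]_w en (n.+1%:R^-1%:E * Z w)) ->
  \int[P]_w Z w <= C.
Proof.
move=> mZ Z0 C0 ZC.
pose q (n : nat) w := n.+1%:R%:E * (1 - en (n.+1%:R^-1%:E * Z w)).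
have Zn0 n w : 0 <= n.+1%:R^-1%:E * Z w by rewrite mule_ge0// lee_fin.
have mZn n : measurable_fun [set: T] (fun w => n.+1%:R^-1%:E * Z w).
  exact: emeasurable_funM.
have men n : measurable_fun [set: T] (fun w => en (n.+1%:R^-1%:E * Z w)).
  exact: measurableT_comp (measurable_en _) (mZn n).
have en1B n w : 0 <= 1 - en (n.+1%:R^-1%:E * Z w).
  by rewrite sube_ge0 ?en_le1 ?en_fin_num.
have q0 n w : 0 <= q n w by rewrite mule_ge0// lee_fin.
have mq n : measurable_fun [set: T] (q n).
  by apply: emeasurable_funM => //; exact: emeasurable_funB.
have qC n : \int[P]_w q n w <= C.
  rewrite ge0_integralZl_EFin//; last exact: emeasurable_funB.
  have -> : \int[P]_w (1 - en (n.+1%:R^-1%:E * Z w)) =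
      1 - \int[P]_w en (n.+1%:R^-1%:E * Z w).
    rewrite integralB//; last 2 first.
    - exact: finite_measure_integrable_cst.
    - by apply: bounded_integrable => // w; rewrite en_ge0 en_le1.
    by rewrite integral_cst//= mul1e probability_setT.
  apply: (@le_trans _ _ (n.+1%:R%:E * (1 - en (n.+1%:R^-1%:E * C)))).
    by apply: lee_wpmul2l; [rewrite lee_fin|exact: leeB].
  apply: (@le_trans _ _ (n.+1%:R%:E * (n.+1%:R^-1%:E * C))).
    apply: lee_wpmul2l; first by rewrite lee_fin.
    by apply: enN_le1B; rewrite mule_ge0// lee_fin.
  by rewrite muleA -EFinM divff ?mul1e.
have -> : \int[P]_w Z w = \int[P]_w limn_einf (q ^~ w).
  apply: eq_integral => w _; apply/esym.
  have c := cvg_difference_quotient (Z0 w).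
  by rewrite is_cvg_limn_einfE; [rewrite (cvg_lim _ c)|exact: cvgP c].
apply: le_trans (fatou P measurableT mq (fun n w _ => q0 n w)) _.
rewrite limn_einf_lim; apply: lime_le; first exact: is_cvg_einfs.
apply: nearW => n; apply: le_trans (qC n).
by apply: ereal_inf_lbound; exists n => /=.
Qed.

End MeanFromLaplace.

Section EsumScale.
Context (R : realType).
Local Open Scope ereal_scope.

Lemma esumZ (I : countType) (K : set I) (c : \bar R) (a : I -> \bar R) : 0 <= c ->
  (forall i, K i -> 0 <= a i) ->
  \esum_(i in K) (c * a i) = c * \esum_(i in K) a i.
Proof.
move=> c0 a0; rewrite !esum_countable//; last by move=> i Ki; rewrite mule_ge0// a0.
rewrite -nneseries_mull//; last first.
  by move=> n; case: pickle_inv => [i|]//=; case: ifPn => // /set_mem; exact: a0.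
apply: eq_eseriesr => n _; case: pickle_inv => [i|]/=; last by rewrite mule0.
by case: ifP; rewrite ?mule0.
Qed.

Lemma ext2Z (c : \bar R) (h : R * R -> \bar R) z :
  ext2 (fun r => c * h r) z = c * ext2 h z.
Proof. by case: z => -[r0| |] [r| |]; rewrite /ext2/= ?mule0. Qed.

End EsumScale.

Section JobLaplace.
Context d (T : measurableType d) (R : realType) (P : probability T R).
Context (lambda0 m : R) (f : R -> R).
Context (imm : nat -> T -> \bar R) (off : label -> nat -> T -> \bar R).
Context (V : {RV P >-> R}) (S : label -> {RV P >-> R}).
Hypotheses (lambda0_gt0 : 0 < lambda0) (m0 : 0 < m) (m1 : m < 1).
Hypothesis f_density : prob_density `[0, +oo[ f.
Hypothesis hawkes : stationary_hawkes P lambda0 m f imm off.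
Hypothesis V_density : positive_with_continuous_density V.
Hypothesis V_mean : ('E_P[V] = 1)%E.
Hypothesis jobs : iid_job_sizes (arrival imm off) V S.
Local Open Scope ereal_scope.
Local Notation mu := (@lebesgue_measure R).
Local Notation birth := (birth imm off).

(** Job sizes are positive only almost surely; taking the positive part makes all sums over labels
    meaningful at every sample point. *)
Definition job (e : label) (w : T) : R := Num.max (S e w) 0%R.

Definition job_exponent (theta : \bar R) : \bar R :=
  - lne (\int[P]_w en ((Num.max (V w) 0)%:E * theta)).

Lemma job_ge0 e w : (0 <= job e w)%R.
Proof. by rewrite /job le_max lexx orbT. Qed.

Lemma measurable_job e : measurable_fun [set: T] (job e).
Proof. by apply: measurable_maxr => //; exact: measurable_cst. Qed.

Let mV : measurable_fun [set: T] (fun w => Num.max (V w) 0%R).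
Proof. by apply: measurable_maxr => //; exact: measurable_cst. Qed.

Let V0 w : (0 <= Num.max (V w) 0)%R.
Proof. by rewrite le_max lexx orbT. Qed.

Lemma integral_job e (phi : R -> \bar R) : measurable_fun [set: R] phi ->
  (forall x, 0 <= phi x) -> \int[P]_w phi (S e w) = \int[P]_w phi (V w).
Proof.
move=> mphi phi0.
rewrite -[LHS](ge0_integral_distribution (S e))//.
rewrite -[RHS](ge0_integral_distribution V)//.
by apply: eq_measure_integral => A mA _; case: jobs => + _; apply.
Qed.

Lemma job_exponentE theta : 0 <= theta ->
  \int[P]_w en ((Num.max (V w) 0)%:E * theta) = en (job_exponent theta).
Proof.
by move=> t0; rewrite /job_exponent en_lne// integral_ge0// => w _; exact: en_ge0.
Qed.

Let men_job theta : measurable_fun [set: R] (fun v : R => en ((Num.max v 0)%:E * theta)).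
Proof.
apply: measurableT_comp (measurable_en _) _ => //.
apply: emeasurable_funM => //; apply/measurable_EFinP.
by apply: measurable_maxr => //; exact: measurable_cst.
Qed.

Lemma integral_en_job e theta : 0 <= theta ->
  \int[P]_w en ((job e w)%:E * theta) = en (job_exponent theta).
Proof.
move=> t0; rewrite -job_exponentE//.
rewrite (@integral_job e (fun v => en ((Num.max v 0)%:E * theta)))// => x.
exact: en_ge0.
Qed.

Lemma job_exponent_ge0 theta : 0 <= theta -> 0 <= job_exponent theta.
Proof.
move=> t0; rewrite -lee_en en0 -job_exponentE//.
apply: (@le_trans _ _ (\int[P]_w cst 1 w)); last first.
  by rewrite integral_cst//= mul1e probability_setT.
apply: ge0_le_integral => //.
- by move=> w _; exact: en_ge0.
- exact: (measurableT_comp (men_job theta)).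
- by move=> w _; rewrite en_le1// mule_ge0// lee_fin.
Qed.

Lemma job_exponent0 : job_exponent 0 = 0.
Proof.
rewrite /job_exponent; under eq_integral do rewrite mule0 en0.
by rewrite integral_cst//= mul1e probability_setT lne1 oppe0.
Qed.

Let mean_V_pos : \int[P]_w (Num.max (V w) 0)%:E = 1.
Proof.
rewrite -V_mean unlock; apply: ae_eq_integral => //.
- exact/measurable_EFinP.
- exact/measurable_EFinP.
- case: V_density => + _; apply: filterS => w V_gt0 _.
  by rewrite max_l// ltW.
Qed.

(* Jensen: the tangent inequality of exp at the mean 1 of V. *)
Lemma job_exponent_le theta : 0 <= theta -> job_exponent theta <= theta.
Proof.
have [->|] := eqVneq theta +oo; first by move=> _; rewrite leey.
case: theta => [t| |] // _; rewrite lee_fin => t0; rewrite -lee_en -job_exponentE ?lee_fin//.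
have et0 : (0 <= expR (- t) * t)%R by rewrite mulr_ge0// expR_ge0.
have tangent v : (expR (- t) + expR (- t) * t <= expR (- (v * t)) + expR (- t) * t * v)%R.
  have := ler_wpM2l (expR_ge0 (- t)) (expR_ge1Dx (t - v * t)%R).
  rewrite -expRD (_ : (- t + (t - v * t) = - (v * t))%R); last by ring.
  by lra.
rewrite -(@leeD2rE _ (expR (- t) * t)%:E)//.
rewrite -[X in _ <= _ + X]mule1 -mean_V_pos -ge0_integralZl_EFin//; last 2 first.
- by move=> w _; rewrite lee_fin.
- exact/measurable_EFinP.
rewrite -ge0_integralD//; last 4 first.
- by move=> w _; exact: en_ge0.
- exact: (measurableT_comp (men_job t%:E)).
- by move=> w _; rewrite mule_ge0// lee_fin.
- by apply: emeasurable_funM => //; exact/measurable_EFinP.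
apply: (@le_trans _ _ (\int[P]_w cst (expR (- t) + expR (- t) * t)%:E w)).
  by rewrite integral_cst//= probability_setT mule1.
apply: ge0_le_integral => //.
- by move=> w _; rewrite lee_fin addr_ge0// expR_ge0.
- apply: emeasurable_funD; first exact: (measurableT_comp (men_job t%:E)).
  by apply: emeasurable_funM => //; exact/measurable_EFinP.
- by move=> w _ /=; rewrite lee_fin; exact: tangent.
Qed.

Lemma measurable_job_exponent : measurable_fun [set: \bar R] job_exponent.
Proof.
apply: (@measurableT_comp _ _ _ _ _ _ (fun z => - lne z)%E setT
    (fun x => \int[P]_w en ((Num.max (V w) 0)%:E * x))%E (@measurable_Nlne R)).
apply: (measurable_fun_fubini_tonelli_F (m2 := P)
  (fun xw => en ((Num.max (V xw.2) 0)%:E * xw.1))).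
  apply: measurableT_comp (measurable_en _) _ => //.
  apply: emeasurable_funM; last exact: measurable_fst.
  apply/measurable_EFinP; exact: measurableT_comp mV measurable_snd.
by move=> xw; exact: en_ge0.
Qed.

Definition work (h : R * R -> \bar R) (w : T) : \bar R :=
  \esum_(e in [set: label]) ((job e w)%:E * ext2 h (birth e w)).

Lemma work_ge0 h w : (forall z, 0 <= h z) -> 0 <= work h w.
Proof.
move=> h0; apply: esum_ge0 => e _; apply: mule_ge0; last exact: ext2_ge0.
by rewrite lee_fin job_ge0.
Qed.

Lemma measurable_work h : measurable_fun [set: R * R] h ->
  (forall z, 0 <= h z) -> measurable_fun [set: T] (work h).
Proof.
move=> mh h0; apply: measurable_esum => [e _|e w _]; last first.
  by apply: mule_ge0; [rewrite lee_fin job_ge0|exact: ext2_ge0].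
apply: emeasurable_funM; first exact/measurable_EFinP/measurable_job.
exact: measurableT_comp (measurable_ext2 mh) (measurable_birth hawkes e).
Qed.

(** Job sizes are independent of one another and of all arrivals, so each is averaged separately
    with the births frozen. *)
Theorem work_laplace h : measurable_fun [set: R * R] h -> (forall z, 0 <= h z) ->
  \int[P]_w en (work h w) = laplace P imm off (fun z => job_exponent (h z)).
Proof.
move=> mh h0.
pose source (o : option label) : set (set T) :=
  if o is Some e then sigma_of (fun _ : unit => S e : T -> R)
  else sigma_of (arrival imm off).
have source_sigma o : sigma_algebra [set: T] (source o).
  by case: o => [e|]; exact: sigma_of_sigma_algebra.
have marr e : measurable_fun [set: T] (arrival imm off e).
  have := measurableT_comp measurable_snd (measurable_birth hawkes e); exact.
have source_measurable o A : source o A -> measurable A.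
  by case: o => [e|]; apply: sigma_of_measurable => i.
have source_indep : mutual_independence P source by case: jobs.
pose y (o : option label) w : \bar R * \bar R := if o is Some e then birth e w else (0, 0).
pose r (o : option label) (z : \bar R * \bar R) w : \bar R :=
  if o is Some e then (job e w)%:E * ext2 h z else 0.
pose rho (o : option label) := ext2 (fun z => job_exponent (h z)).
pose K : set (option label) := Some @` [set: label].
have esumK (c : option label -> \bar R) :
    \esum_(o in K) c o = \esum_(e in [set: label]) c (Some e).
  by rewrite esum_image// => e e' _ _ [].
transitivity (\int[P]_w en (cst 0 w + \esum_(o in K) r o (y o w) w)).
  by apply: eq_integral => w _; rewrite esumK add0e.
transitivity (\int[P]_w en (cst 0 w + \esum_(o in K) rho o (y o w))); last first.
  by apply: eq_integral => w _; rewrite esumK add0e.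
apply: (@integrate_out _ _ _ P _ source source_sigma source_measurable
  source_indep _ _ [set None] K (cst 0) y r rho).
- by move=> _ [e _ <-].
- exact: measurable_cst.
- by [].
- move=> _ [e _ <-]; apply: measurable_fun_pair.
    apply: (@measurable_fun_factor _ _ _ source _ _ _ None) => //.
    (* The birth time of an immigrant is itself an arrival time, that of the label with an empty
       word. *)
    exact: (@measurable_sigma_of _ _ _ _ _ (arrival imm off) (e.1, [::])).
  apply: (@measurable_fun_factor _ _ _ source _ _ _ None) => //.
  exact: measurable_sigma_of.
- move=> _ [e _ <-]; apply: emeasurable_funM; last first.
    exact: measurableT_comp (measurable_ext2 mh) measurable_fst.
  apply/measurable_EFinP; apply: measurable_maxr; last exact: measurable_cst.
  exact: measurableT_comp (@measurable_sigma_of _ _ _ _ _ (fun _ : unit => S e : T -> R) tt) measurable_snd.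
- move=> [e|] z w //=; apply: mule_ge0; last exact: ext2_ge0.
  by rewrite lee_fin job_ge0.
- by move=> o z; apply: ext2_ge0 => t; exact: job_exponent_ge0.
- move=> _ z [e _ <-]; rewrite /r integral_en_job; last exact: ext2_ge0.
  congr en; case: z => -[r0| |] [r1| |]; rewrite /rho /ext2/= ?job_exponent0//.
Qed.

Lemma workD h1 h2 w : (forall z, 0 <= h1 z) -> (forall z, 0 <= h2 z) ->
  work (fun z => h1 z + h2 z) w = work h1 w + work h2 w.
Proof.
move=> h10 h20; rewrite -esumD.
- apply: eq_esum => e _; rewrite ext2D// muleDr// ge0_adde_def// inE; exact: ext2_ge0.
- by move=> e _; apply: mule_ge0; [rewrite lee_fin job_ge0|exact: ext2_ge0].
- by move=> e _; apply: mule_ge0; [rewrite lee_fin job_ge0|exact: ext2_ge0].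
Qed.

Lemma workZ (c : R) h w : (0 <= c)%R -> (forall z, 0 <= h z) ->
  work (fun z => c%:E * h z) w = c%:E * work h w.
Proof.
move=> c0 h0; rewrite /work -esumZ//; last first.
  by move=> e _; apply: mule_ge0; [rewrite lee_fin job_ge0|exact: ext2_ge0].
by apply: eq_esum => e _; rewrite ext2Z muleCA.
Qed.

Lemma birth_sumZ (c : R) h w : (0 <= c)%R -> (forall z, 0 <= h z) ->
  birth_sum imm off (fun z => c%:E * h z) w = c%:E * birth_sum imm off h w.
Proof.
move=> c0 h0; rewrite /birth_sum -esumZ//; last by move=> e _; exact: ext2_ge0.
by apply: eq_esum => e _; rewrite ext2Z.
Qed.

Lemma work_translate u h : measurable_fun [set: R * R] h -> (forall z, 0 <= h z) ->
  \int[P]_w en (work (fun z => h (z.1 - u, z.2 - u)%R) w) = \int[P]_w en (work h w).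
Proof.
move=> mh h0.
have mhu : measurable_fun [set: R * R] (fun z => h (z.1 - u, z.2 - u)%R).
  apply: measurableT_comp mh _; apply: measurable_fun_pair.
    by apply: measurable_funB.
  by apply: measurable_funB.
have -> := work_laplace mhu (fun z => h0 (z.1 - u, z.2 - u)%R).
have -> := work_laplace mh h0.
have mj : measurable_fun [set: R * R] (fun z => job_exponent (h z)).
  exact: measurableT_comp measurable_job_exponent mh.
exact: (laplace_translate lambda0_gt0 m0 m1 f_density hawkes u mj
  (fun z => job_exponent_ge0 (h0 z))).
Qed.

Lemma work_factor h1 h2 :
  measurable_fun [set: R * R] h1 -> (forall z, 0 <= h1 z) ->
  measurable_fun [set: R * R] h2 -> (forall z, 0 <= h2 z) ->
  (forall x0, (forall x, h1 (x0, x) = 0) \/ (forall x, h2 (x0, x) = 0)) ->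
  \int[P]_w (en (work h1 w) * en (work h2 w)) =
  \int[P]_w en (work h1 w) * \int[P]_w en (work h2 w).
Proof.
move=> mh1 h10 mh2 h20 h12.
transitivity (\int[P]_w en (work (fun z => h1 z + h2 z) w)).
  by apply: eq_integral => w _; rewrite workD// enD// work_ge0.
rewrite !work_laplace//; last 2 first.
- exact: emeasurable_funD.
- by move=> z; exact: adde_ge0.
rewrite -(laplace_factor lambda0_gt0 m0 m1 f_density hawkes)//.
- congr laplace; apply/funext => -[x0 x]; case: (h12 x0) => e0; rewrite e0 job_exponent0.
    by rewrite !add0e.
  by rewrite !adde0.
- exact: measurableT_comp measurable_job_exponent mh1.
- by move=> z; exact: job_exponent_ge0.
- exact: measurableT_comp measurable_job_exponent mh2.
- by move=> z; exact: job_exponent_ge0.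
- by move=> x0; case: (h12 x0) => e0; [left|right] => x; rewrite e0 job_exponent0.
Qed.

Let rate0 : (0 <= lambda0 / (1 - m))%R.
Proof. by rewrite divr_ge0// ?(ltW lambda0_gt0)// subr_ge0 (ltW m1). Qed.

Lemma birth_sum_mean (g : R -> \bar R) : measurable_fun [set: R] g -> (forall x, 0 <= g x) ->
  \int[P]_w birth_sum imm off (fun z => g z.2) w <= (lambda0 / (1 - m))%:E * \int[mu]_x g x.
Proof.
move=> mg g0; apply: mean_le_of_laplace => [|w||n].
- apply: (measurable_birth_sum hawkes); last by move=> z.
  exact: measurableT_comp mg measurable_snd.
- by apply: birth_sum_ge0 => z.
- by rewrite mule_ge0 ?lee_fin// integral_ge0.
have n0 : (0 <= n.+1%:R^-1 :> R)%R by [].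
rewrite muleCA -ge0_integralZl_EFin//.
under [leRHS]eq_integral do rewrite -birth_sumZ//.
have ng0 x : 0 <= (n.+1%:R^-1)%:E * g x by rewrite mule_ge0.
have mng : measurable_fun [set: R] (fun x => (n.+1%:R^-1)%:E * g x) by exact: emeasurable_funM.
exact: (laplace_ge lambda0_gt0 m0 m1 f_density hawkes mng ng0).
Qed.

Lemma laplace_le a b : measurable_fun [set: R * R] a -> measurable_fun [set: R * R] b ->
  (forall z, 0 <= a z <= b z) -> laplace P imm off b <= laplace P imm off a.
Proof.
move=> ma mb ab; have a0 z : 0 <= a z by have /andP[] := ab z.
have le_ab z : a z <= b z by have /andP[] := ab z.
have b0 z : 0 <= b z by exact: le_trans (le_ab z).
apply: ge0_le_integral => //.
- by move=> w _; exact: en_ge0.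
- exact: measurableT_comp (measurable_en _) (measurable_birth_sum hawkes mb b0).
- exact: measurableT_comp (measurable_en _) (measurable_birth_sum hawkes ma a0).
- move=> w _; rewrite lee_en; apply: le_esum => e _.
  by case: (birth e w) => -[x0| |] [x| |]; rewrite /ext2/=.
Qed.

(** Jensen's bound [job_exponent_le], which rests on the mean 1 of [V], reduces the estimate to the
    one for births, without any computation of moments of the work. *)
Lemma work_mean (g : R -> \bar R) : measurable_fun [set: R] g -> (forall x, 0 <= g x) ->
  \int[P]_w work (fun z => g z.2) w <= (lambda0 / (1 - m))%:E * \int[mu]_x g x.
Proof.
move=> mg g0.
have mg2 : measurable_fun [set: R * R] (fun z => g z.2).
  exact: measurableT_comp mg measurable_snd.
apply: mean_le_of_laplace => [|w||n].
- by apply: measurable_work => // z.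
- by apply: work_ge0 => z.
- by rewrite mule_ge0 ?lee_fin// integral_ge0.
have n0 : (0 <= n.+1%:R^-1 :> R)%R by [].
have ng0 x : 0 <= (n.+1%:R^-1)%:E * g x by rewrite mule_ge0.
have mng : measurable_fun [set: R] (fun x => (n.+1%:R^-1)%:E * g x) by exact: emeasurable_funM.
rewrite muleCA -ge0_integralZl_EFin//.
under [leRHS]eq_integral do rewrite -workZ//.
rewrite work_laplace//; last exact: emeasurable_funM.
apply: le_trans (laplace_ge lambda0_gt0 m0 m1 f_density hawkes mng ng0) _.
apply: laplace_le => [||z].
- exact: measurableT_comp measurable_job_exponent (measurableT_comp mng measurable_snd).
- exact: measurableT_comp mng measurable_snd.
- by rewrite job_exponent_ge0// job_exponent_le.
Qed.

End JobLaplace.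

(** * Work arriving in time windows *)

Section Windows.
Context (R : realType).
Implicit Types (D : set R) (s t : seq (R * R)).

(* A weight on pairs (birth time of the immigrant, arrival time): it restricts the
   input to the clusters started in [D] and sums it over the windows in [s]. *)
Definition windows D s (z : R * R) : \bar R :=
  (\1_D z.1 * \sum_(ab <- s) \1_(`[ab.1, ab.2[%classic : set R) z.2)%:E.

Lemma indic_ge0 (A : set R) x : 0 <= \1_A x :> R.
Proof. by rewrite indicE. Qed.

Lemma windows_ge0 D s z : (0 <= windows D s z)%E.
Proof.
by rewrite lee_fin mulr_ge0 ?indic_ge0// sumr_ge0// => ab _; exact: indic_ge0.
Qed.

Lemma measurable_windows D s : measurable D ->
  measurable_fun [set: R * R] (windows D s).
Proof.
move=> mD; apply/measurable_EFinP; apply: measurable_funM.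
  exact: measurableT_comp (measurable_indic mD) measurable_fst.
apply: measurable_sum => ab; apply: measurableT_comp measurable_snd.
by apply: measurable_indic; exact: measurable_itv.
Qed.

Lemma windows_nil D z : windows D [::] z = 0%E.
Proof. by rewrite /windows big_nil mulr0. Qed.

Lemma windows_cat D s t z : windows D (s ++ t) z = (windows D s z + windows D t z)%E.
Proof. by rewrite /windows big_cat mulrDr EFinD. Qed.

Lemma windows1 D a b z :
  windows D [:: (a, b)] z = (\1_D z.1 * \1_(`[a, b[%classic : set R) z.2)%:E.
Proof. by rewrite /windows big_seq1. Qed.

Lemma windowsT1 a b z :
  windows setT [:: (a, b)] z = (\1_(`[a, b[%classic : set R) z.2)%:E.
Proof. by rewrite windows1 indicT mul1r. Qed.

Definition shift_windows (u : R) s := [seq (ab.1 + u, ab.2 + u) | ab <- s].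

Lemma windows_shift u s z :
  windows setT (shift_windows u s) z = windows setT s (z.1 - u, z.2 - u).
Proof.
rewrite /windows !indicT big_map; congr (_ * _)%:E; apply: eq_bigr => ab _ /=.
by rewrite !indicE !mem_setE !in_itv/= lerBrDr ltrBlDr.
Qed.

Lemma windows_le D E s z : D `<=` E -> (windows D s z <= windows E s z)%E.
Proof.
move=> DE; rewrite lee_fin ler_wpM2r//.
  by rewrite sumr_ge0// => ab _; exact: indic_ge0.
rewrite !indicE ler_nat; case: (boolP (z.1 \in D)) => // /set_mem /DE zE.
by rewrite mem_set.
Qed.

(* For [p] the family of survival probabilities along a random measure, the
   mass of [[a, b[, with the value [0] when this mass is infinite. *)
Definition load (p : seq (R * R) -> R) (ab : R * R) : R := - ln (p [:: ab]).

Lemma measurable_load ab :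
  measurable_fun [set: paths (seq (R * R)) R] (fun p => load p ab).
Proof.
apply: measurable_funN; apply: measurableT_comp (@measurable_coordinate _ R [:: ab]).
exact: measurable_ln.
Qed.

End Windows.

Section Survival.
Context d (T : measurableType d) (R : realType) (P : probability T R).
Context (lambda0 m : R) (f : R -> R).
Context (imm : nat -> T -> \bar R) (off : label -> nat -> T -> \bar R).
Context (V : {RV P >-> R}) (S : label -> {RV P >-> R}).
Hypotheses (lambda0_gt0 : 0 < lambda0) (m0 : 0 < m) (m1 : m < 1).
Hypothesis f_density : prob_density `[0, +oo[ f.
Hypothesis hawkes : stationary_hawkes P lambda0 m f imm off.
Hypothesis jobs : iid_job_sizes (arrival imm off) V S.
Local Notation birth := (birth imm off).
Local Notation work := (work imm off S).
Implicit Types (D : set R) (s t : seq (R * R)).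

(** The probability that a unit-rate exponential clock, run by the work in the windows of [s], has
    not yet rung. It stays meaningful, with value 0, where the work is infinite. *)
Definition survival D s w : R := fine (en (work (windows D s) w)).

Definition input D a b w : R := fine (work (windows D [:: (a, b)]) w).

Lemma survivalE D s w : (survival D s w)%:E = en (work (windows D s) w).
Proof. by rewrite /survival fineK// en_fin_num// work_ge0// => z; exact: windows_ge0. Qed.

Lemma survival_unit D s : measurable D -> unit_valued (survival D s).
Proof.
move=> mD; split.
  apply: (measurableT_comp (@fine_measurable R setT measurableT)).
  apply: measurableT_comp (measurable_en _) _ => //.
  apply: (measurable_work S hawkes); first exact: measurable_windows.
  by move=> z; exact: windows_ge0.
move=> w; rewrite -!lee_fin survivalE en_ge0 en_le1// work_ge0// => z.
exact: windows_ge0.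
Qed.

Lemma survival_nil D w : survival D [::] w = 1.
Proof.
apply: EFin_inj; rewrite survivalE (_ : work _ w = 0)%E ?en0//.
apply: esum1 => e _; rewrite (_ : windows D [::] = cst 0%E); last first.
  by apply/funext => z; exact: windows_nil.
by case: (birth e w) => -[x0| |] [x| |]; rewrite /ext2/= mule0.
Qed.

Lemma survival_cat D s t w : survival D (s ++ t) w = survival D s w * survival D t w.
Proof.
apply: EFin_inj; rewrite EFinM !survivalE -enD.
- have -> : windows D (s ++ t) = (fun z => windows D s z + windows D t z)%E.
    by apply/funext => z; exact: windows_cat.
  by congr en; apply: workD => z; exact: windows_ge0.
- by apply: work_ge0 => z; exact: windows_ge0.
- by apply: work_ge0 => z; exact: windows_ge0.
Qed.

Lemma load_survival D a b w : load (survival D ^~ w) (a, b) = input D a b w.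
Proof.
have : (0 <= work (windows D [:: (a, b)]) w)%E by apply: work_ge0 => z; exact: windows_ge0.
rewrite /load /survival /input; case: work => [x| |]//= _.
  by rewrite expRK opprK.
by rewrite ln0// oppr0.
Qed.

Lemma survival_shift u s :
  (\int[P]_w (survival setT (shift_windows u s) w)%:E = \int[P]_w (survival setT s w)%:E)%E.
Proof.
under eq_integral do rewrite survivalE; under [RHS]eq_integral do rewrite survivalE.
have -> : windows setT (shift_windows u s) = (fun z => windows setT s (z.1 - u, z.2 - u)).
  by apply/funext => z; exact: windows_shift.
apply: (work_translate lambda0_gt0 m0 m1 f_density hawkes jobs u).
- exact: measurable_windows.
- exact: windows_ge0.
Qed.

Lemma survival_factor D1 D2 s t : measurable D1 -> measurable D2 -> D1 `&` D2 = set0 ->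
  (\int[P]_w (survival D1 s w * survival D2 t w)%:E =
   \int[P]_w (survival D1 s w)%:E * \int[P]_w (survival D2 t w)%:E)%E.
Proof.
move=> mD1 mD2 D120.
under eq_integral do rewrite EFinM !survivalE.
under [X in (_ = X * _)%E]eq_integral do rewrite survivalE.
under [X in (_ = _ * X)%E]eq_integral do rewrite survivalE.
apply: (work_factor lambda0_gt0 m0 m1 f_density hawkes jobs).
- exact: measurable_windows.
- exact: windows_ge0.
- exact: measurable_windows.
- exact: windows_ge0.
move=> x0; have [x0D1|x0D1] := pselect (D1 x0).
  right => x; rewrite /windows indicE memNset ?mul0r//= => x0D2.
  by have : (D1 `&` D2) x0 by []; rewrite D120.
by left => x; rewrite /windows indicE memNset ?mul0r//=.
Qed.

End Survival.

(** * Almost sure regularity of arrivals and work *)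

Section AlmostSure.
Context d (T : measurableType d) (R : realType) (P : probability T R).

Lemma ae_forall_countable (I : countType) (Q : I -> T -> Prop) :
  (forall i, {ae P, forall w, Q i w}) -> {ae P, forall w, forall i, Q i w}.
Proof.
move=> aeQ.
have : {ae P, forall w, forall n, oapp (Q ^~ w) True (@pickle_inv I n)}.
  by apply: ae_foralln => n; case: pickle_inv => [i|] /=; [exact: aeQ|exact: aeW].
by apply: filterS => w Qw i; have := Qw (choice.pickle i); rewrite pickleK_inv.
Qed.

Lemma ae_finite_of_mean (Z : T -> \bar R) : measurable_fun [set: T] Z ->
  (forall w, (0 <= Z w)%E) -> (\int[P]_w Z w < +oo)%E ->
  {ae P, forall w, (Z w < +oo)%E}.
Proof.
move=> mZ Z0 EZ; have iZ : P.-integrable [set: T] Z.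
  by apply/integrableP; split => //; under eq_integral do rewrite gee0_abs//.
have := integrable_ae measurableT iZ; apply: filterS => w /(_ Logic.I).
by rewrite ge0_fin_numE.
Qed.

Lemma ae_prob1 (A : set T) : measurable A -> P A = 1%E -> {ae P, forall w, A w}.
Proof.
move=> mA PA; exists (~` A); split => //; first exact: measurableC.
by rewrite probability_setC// PA subee.
Qed.

End AlmostSure.

Lemma finite_set_of_esum (R : realType) (I : choiceType) (A : set I) :
  (\esum_(i in A) (1 : \bar R) < +oo)%E -> finite_set A.
Proof.
move=> fA; apply: contrapT => /infinite_set_fset infA.
have fin : (\esum_(i in A) (1 : \bar R))%E \is a fin_num.
  by rewrite ge0_fin_numE// esum_ge0.
have [B BA] := infA (Num.truncn (fine (\esum_(i in A) (1 : \bar R))%E)).+1.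
move=> cB; have : ((#|` B|)%:R%:E <= \esum_(i in A) (1 : \bar R))%E.
  apply: esum_ge; exists [set` B].
    by split => //; exact: finite_fset.
  rewrite fsbig_finite//= set_fsetK (eq_bigr (fun=> (1 : R)%:E))// sumEFin.
  by rewrite big_const_seq count_predT iter_addr_0.
rewrite -(fineK fin) lee_fin; apply/negP; rewrite -ltNge.
apply: lt_le_trans (truncnS_gt _) _.
by rewrite ler_nat.
Qed.

Section RegularPaths.
Context d (T : measurableType d) (R : realType) (P : probability T R).
Context (lambda0 m : R) (f : R -> R).
Context (imm : nat -> T -> \bar R) (off : label -> nat -> T -> \bar R).
Context (V : {RV P >-> R}) (S : label -> {RV P >-> R}).
Hypotheses (lambda0_gt0 : 0 < lambda0) (m0 : 0 < m) (m1 : m < 1).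
Hypothesis f_density : prob_density `[0, +oo[ f.
Hypothesis hawkes : stationary_hawkes P lambda0 m f imm off.
Hypothesis V_density : positive_with_continuous_density V.
Hypothesis V_mean : ('E_P[V] = 1)%E.
Hypothesis jobs : iid_job_sizes (arrival imm off) V S.
Local Notation birth := (birth imm off).
Local Notation work := (work imm off S).

Lemma arrival_finite_imm e w x : arrival imm off e w = x%:E ->
  exists x0, birth e w = (x0%:E, x%:E).
Proof.
move=> ex; suff [x0 x0E] : exists x0, imm e.1 w = x0%:E by exists x0; rewrite /birth x0E ex.
case: e ex => i p /=; rewrite /arrival/=; elim: p x => [|k p ih] x /=.
  by move=> ->; exists x.
by case: (birth_time imm off i p w) ih => [y| |] ih; case: off => [z| |]//= _; exact: ih.
Qed.

(** The offspring intensity charges only [[0, +oo[], so the number of points in []-oo, 0[] has the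
    Poisson law of parameter 0. *)
Lemma ae_offspring_nonneg :
  {ae P, forall w, forall (ek : label * nat) (r : R),
    off ek.1 ek.2 w = r%:E -> 0 <= r}.
Proof.
apply: ae_forall_countable => -[e k] /=.
have mN : measurable (`]-oo, 0[%classic : set R) by exact: measurable_itv.
have I0 : intensity `[0, +oo[ (fun x => m * f x) (`]-oo, 0[%classic : set R) = 0%E.
  rewrite /intensity (_ : _ `&` _ = set0) ?integral_set0//.
  by apply/seteqP; split => // x [] /=; rewrite !in_itv/= => x0 /andP[]; lra.
have := (offspring_poisson hawkes e).2 1%N (fun=> `]-oo, 0[%classic) (fun=> 0%N).
rewrite big_ord1 I0 /= /poisson_prob ltxx diracE mem_set//.
rewrite bigcap_const; last by exists ord0.
move=> /(_ (fun=> mN)) PN.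
have {}PN : P [set w | nb_points (off e) (`]-oo, 0[%classic : set R) w = 0%:R%:E] = 1%E.
  by apply: PN => [|_]; [apply/trivIsetP => i j _ _; rewrite (ord1 i) (ord1 j) eqxx|exact: ltry].
have := ae_prob1 (measurable_nb_points_eq (offspring_poisson hawkes e) 0 mN) PN.
apply: filterS => w /= N0 r rE; rewrite leNgt; apply/negP => r0.
have : nb_points (off e) (`]-oo, 0[%classic : set R) w != 0%E.
  rewrite /nb_points /counting; case: asboolP => // fA.
  rewrite eqe pnatr_eq0 cardfs_eq0; apply/eqP => A0.
  have : k \in fset_set [set n | (EFin @` (`]-oo, 0[%classic : set R)) (off e n w)].
    rewrite in_fset_set// mem_set//=; exists r; first by rewrite /= in_itv.
    by rewrite rE.
  by rewrite A0 inE.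
by rewrite N0 eqxx.
Qed.

Definition ordered_births w :=
  forall e x0 x, birth e w = (x0%:E, x%:E) -> x0 <= x.

Lemma ae_ordered_births : {ae P, forall w, ordered_births w}.
Proof.
have := ae_offspring_nonneg; apply: filterS => w off0 [i p] x0 x [].
rewrite /arrival/= => x0E; elim: p x => [|k p ih] x /=.
  by rewrite x0E => -[->].
case E : (birth_time imm off i p w) => [y| |]; case E' : off => [z| |]//= [<-].
by apply: le_trans (ih _ E) _; rewrite lerDl; exact: (off0 ((i, p), k)).
Qed.

Lemma work_mono h h' w : (forall z, (0 <= h z <= h' z)%E) -> (work h w <= work h' w)%E.
Proof.
move=> hh'; apply: le_esum => e _; apply: lee_wpmul2l; first by rewrite lee_fin job_ge0.
by case: (birth e w) => -[x0| |] [x| |]; rewrite /ext2//=; have /andP[] := hh' (x0, x).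
Qed.

Lemma eq_work h h' w :
  (forall e x0 x, birth e w = (x0%:E, x%:E) -> h (x0, x) = h' (x0, x)) ->
  work h w = work h' w.
Proof.
move=> hh'; apply: eq_esum => e _; congr (_ * _)%E.
case E : (birth e w) => [x0 x]; case: x0 E => [x0| |]//; case: x => [x| |]// E.
by rewrite /ext2/=; exact: hh' E.
Qed.

Let windowsT (n : nat) := windows setT [:: (- n%:R, n%:R : R)].

Let int_window n : (\int[lebesgue_measure]_x
  (\1_(`[(- n%:R : R), n%:R[%classic : set R) x)%:E < +oo)%E.
Proof.
by have := integrable_lty measurableT (integrable_indic_itv (- n%:R : R) n%:R true true).
Qed.

Let bound (a b : R) := (maxn (Num.truncn `|a|) (Num.truncn `|b|)).+1.

Let bound_le a b : (`[a, b[%classic : set R) `<=`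
  `[(- (bound a b)%:R : R), (bound a b)%:R[%classic.
Proof.
have ha : `|a| < (bound a b)%:R.
  apply: lt_le_trans (truncnS_gt _) _.
  by rewrite ler_nat ltnS leq_maxl.
have hb : `|b| < (bound a b)%:R.
  apply: lt_le_trans (truncnS_gt _) _.
  by rewrite ler_nat ltnS leq_maxr.
move=> x /=; rewrite !in_itv/= => /andP[ax xb].
by move: ha hb; rewrite !ltr_norml => /andP[ha _] /andP[_ hb]; apply/andP; split; lra.
Qed.

Let rate_lty n : ((lambda0 / (1 - m))%:E * \int[lebesgue_measure]_x
  (\1_(`[(- n%:R : R), n%:R[%classic : set R) x)%:E < +oo)%E.
Proof.
rewrite lte_mul_pinfty ?int_window// ?lee_fin ?divr_ge0// ?(ltW lambda0_gt0)//.
by rewrite subr_ge0 ltW.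
Qed.

Definition finite_input w := forall a b, (work (windows setT [:: (a, b)]) w < +oo)%E.

(** Every window lies in some [[-n, n[], so countably many mean bounds handle all real endpoints at
    once. *)
Lemma ae_finite_input : {ae P, forall w, finite_input w}.
Proof.
have : {ae P, forall w, forall n : nat, (work (windowsT n) w < +oo)%E}.
  apply: ae_foralln => n; apply: ae_finite_of_mean.
  - by apply: (measurable_work S hawkes); [exact: measurable_windows|exact: windows_ge0].
  - by move=> w; apply: work_ge0 => z; exact: windows_ge0.
  apply: le_lt_trans (rate_lty n).
  rewrite (_ : windowsT n = fun z => (\1_(`[(- n%:R : R), n%:R[%classic : set R) z.2)%:E).
    apply: (work_mean lambda0_gt0 m0 m1 f_density hawkes V_density V_mean jobs).
      by apply/measurable_EFinP; apply: measurable_indic; exact: measurable_itv.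
    by move=> x; rewrite lee_fin indic_ge0.
  by apply/funext => z; exact: windowsT1.
apply: filterS => w fin a b; apply: le_lt_trans (fin (bound a b)).
apply: work_mono => z; rewrite windows_ge0/= /windowsT !windowsT1 lee_fin !indicE ler_nat.
by case: (boolP (z.2 \in _)) => // /set_mem /bound_le zb; rewrite mem_set.
Qed.

(** Finite work would not exclude an accumulation of arrivals with small jobs; the births are
    therefore counted separately. *)
Lemma ae_finite_arrivals : {ae P, forall w, forall a b : R,
  finite_set [set e | (a%:E <= arrival imm off e w)%E /\ (arrival imm off e w < b%:E)%E]}.
Proof.
have : {ae P, forall w, forall n : nat, (birth_sum imm off (windowsT n) w < +oo)%E}.
  apply: ae_foralln => n; apply: ae_finite_of_mean.
  - by apply: (measurable_birth_sum hawkes); [exact: measurable_windows|exact: windows_ge0].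
  - by move=> w; apply: birth_sum_ge0 => z; exact: windows_ge0.
  apply: le_lt_trans (rate_lty n).
  rewrite (_ : windowsT n = fun z => (\1_(`[(- n%:R : R), n%:R[%classic : set R) z.2)%:E).
    apply: (birth_sum_mean lambda0_gt0 m0 m1 f_density hawkes).
      by apply/measurable_EFinP; apply: measurable_indic; exact: measurable_itv.
    by move=> x; rewrite lee_fin indic_ge0.
  by apply/funext => z; exact: windowsT1.
apply: filterS => w fin a b; apply: (@finite_set_of_esum R).
apply: le_lt_trans (fin (bound a b)); rewrite esum_mkcond; apply: le_esum => e _.
case: ifPn => [/set_mem/= [ae eb]|_]; last by apply: ext2_ge0 => z; exact: windows_ge0.
case E : (arrival imm off e w) ae eb => [x| |] //; rewrite lee_fin lte_fin => ax xb.
have [x0 ->] := arrival_finite_imm E.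
rewrite /ext2/= /windowsT windowsT1 lee_fin indicE mem_set//; apply: bound_le.
by rewrite /= in_itv/= ax.
Qed.

Lemma ae_job_gt0 : {ae P, forall w, forall e, 0 < S e w}.
Proof.
apply: ae_forall_countable => e.
have mp : measurable (`]0%R, +oo[%classic : set R) by exact: measurable_itv.
have mS (X : {RV P >-> R}) : measurable (X @^-1` `]0%R, +oo[%classic).
  by rewrite -[X in measurable X]setTI; apply: measurable_funPT.
have : P (S e @^-1` `]0%R, +oo[%classic) = 1%E.
  have [/(_ e _ mp) + _] := jobs; rewrite /distribution/= /pushforward => ->.
  case: V_density => -[N [mN PN NV]] _.
  apply/eqP; rewrite eq_le probability_le1//= -(probability_setT P).
  rewrite -(setUv (V @^-1` `]0%R, +oo[%classic)).
  apply: le_trans (measureU2 _ _ _) _; [exact: mS|exact/measurableC/mS|].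
  apply: geeDl; rewrite -[leRHS]PN; apply: le_measure; rewrite ?inE//; first exact/measurableC/mS.
  by apply: subset_trans NV => w /= V0; move: V0; rewrite in_itv/= andbT.
move/(ae_prob1 (mS _)); apply: filterS => w /=.
by rewrite in_itv/= andbT.
Qed.

End RegularPaths.

(** * A zero-one law *)

Lemma eq_prob_ae d (T : measurableType d) (R : realType) (P : probability T R)
  (A B : set T) : measurable A -> measurable B ->
  {ae P, forall w, A w <-> B w} -> P A = P B.
Proof.
move=> mA mB AB; rewrite -(setIT A) -(setIT B) -!integral_indic//.
apply: ae_eq_integral => //.
- exact/measurable_EFinP/measurable_indic.
- exact/measurable_EFinP/measurable_indic.
- apply: filterS AB => w AB _; rewrite !indicE; congr (_%:R%:E); congr nat_of_bool.
  by apply/idP/idP => /set_mem /AB ?; exact/mem_set.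
Qed.

Section ZeroOne.
Context d (T : measurableType d) (R : realType) (P : probability T R).
Context (lambda0 m : R) (f : R -> R).
Context (imm : nat -> T -> \bar R) (off : label -> nat -> T -> \bar R).
Context (V : {RV P >-> R}) (S : label -> {RV P >-> R}).
Hypotheses (lambda0_gt0 : 0 < lambda0) (m0 : 0 < m) (m1 : m < 1).
Hypothesis f_density : prob_density `[0, +oo[ f.
Hypothesis hawkes : stationary_hawkes P lambda0 m f imm off.
Hypothesis V_density : positive_with_continuous_density V.
Hypothesis V_mean : ('E_P[V] = 1)%E.
Hypothesis jobs : iid_job_sizes (arrival imm off) V S.
Local Notation birth := (birth imm off).
Local Notation work := (work imm off S).
Local Notation survival := (survival imm off S).
Local Notation input := (input imm off S).
Local Notation finite_input := (finite_input imm off S).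
Local Notation ordered_births := (ordered_births imm off).

Lemma input_ge0 D a b w : 0 <= input D a b w.
Proof. by rewrite fine_ge0// work_ge0// => z; exact: windows_ge0. Qed.

Lemma inputE a b w : finite_input w ->
  (input setT a b w)%:E = work (windows setT [:: (a, b)]) w.
Proof.
by move=> fw; rewrite fineK// ge0_fin_numE// work_ge0// => z; exact: windows_ge0.
Qed.

Lemma inputD a b c w : finite_input w -> a <= b -> b <= c ->
  input setT a c w = input setT a b w + input setT b c w.
Proof.
move=> fw ab bc; apply: EFin_inj; rewrite EFinD !inputE// -workD; last 2 first.
- exact: windows_ge0.
- exact: windows_ge0.
apply: eq_work => e x0 x _; rewrite !windowsT1/= -EFinD -natrD !indicE !mem_setE !in_itv/=.
by congr _%:R%:E; case: (leP b x) => bx; case: (leP a x) => ax;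
  case: (ltP x c) => xc; case: (ltP x b) => xb //=; exfalso; lra.
Qed.

Lemma le_input a b c w : finite_input w -> a <= b -> b <= c ->
  input setT b c w <= input setT a c w.
Proof. by move=> fw ab bc; rewrite (inputD fw ab bc) lerDr input_ge0. Qed.

(** Causality: nobody is born before the immigrant of the cluster, so work arriving before [b] stems
    from clusters started before [b]. *)
Lemma input_before a b w : ordered_births w ->
  input `]-oo, b[ a b w = input setT a b w.
Proof.
move=> ord; congr fine; apply: eq_work => e x0 x /ord x0x.
rewrite windows1 windowsT1/= !indicE !mem_setE !in_itv/= -natrM.
by congr _%:R%:E; case: (leP a x) => ax; case: (ltP x b) => xb;
  case: (ltP x0 b) => x0b //=; exfalso; lra.
Qed.

Lemma cvg_work (h : nat -> R * R -> \bar R) (g : R * R -> \bar R) w :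
  (forall n z, 0 <= h n z)%E -> (forall z, nondecreasing_seq (h ^~ z)) ->
  (forall z, h ^~ z @ \oo --> g z) -> (work (h n) w @[n --> \oo] --> work g w)%E.
Proof.
move=> h0 ndh hg.
have g0 z : (0 <= g z)%E.
  rewrite -(cvg_lim _ (hg z))//; apply: lime_ge; first exact: cvgP (hg z).
  exact: nearW.
have j0 e : (0 <= (job S e w)%:E)%E by rewrite lee_fin job_ge0.
have wE h' : (forall z, 0 <= h' z)%E -> work h' w = (\sum_(k <oo)
    oapp (fun e => if e \in [set: label] then (job S e w)%:E * ext2 h' (birth e w)
      else 0) 0 (@pickle_inv label k))%E.
  by move=> h'0; rewrite -esum_countable// => e _; apply: mule_ge0 => //; exact: ext2_ge0.
rewrite wE//; under eq_fun do (rewrite wE; last exact: h0).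
apply: cvg_nneseries_monotone => [n k|k|k].
- case: pickle_inv => [e|]//=; case: ifP => // _; apply: mule_ge0 => //.
  exact: ext2_ge0.
- move=> n n' nn'; case: pickle_inv => [e|]//=; case: ifP => // _.
  apply: lee_wpmul2l => //; case: (birth e w) => -[x0| |] [x| |]//.
  exact: ndh.
- case: pickle_inv => [e|] /=; last exact: cvg_cst.
  case: ifP => _; last exact: cvg_cst.
  apply: cvgeZl => //; case: (birth e w) => -[x0| |] [x| |]; rewrite /ext2/=;
    by [exact: hg|exact: cvg_cst].
Qed.

Lemma cvg_survival (D : nat -> set R) s w :
  (forall n, D n `<=` D n.+1) -> (\bigcup_n D n = setT) ->
  survival (D n) s w @[n --> \oo] --> survival setT s w.
Proof.
move=> ndD DT.
have subD n n' : (n <= n')%N -> D n `<=` D n'.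
  move=> /subnKC <-; elim: (n' - n)%N => [|k ih]; first by rewrite addn0.
  by rewrite addnS; exact: subset_trans ih (ndD _).
have ndw z : nondecreasing_seq (fun n => windows (D n) s z).
  by move=> n n' nn'; apply: windows_le; exact: subD.
have cw : (work (windows (D n) s) w @[n --> \oo] --> work (windows setT s) w)%E.
  apply: cvg_work => [n z|z|z]; [exact: windows_ge0|exact: ndw|].
  have [N _ DN] : (\bigcup_n D n) z.1 by rewrite DT.
  apply: cvg_near_cst; exists N => // n /= Nn.
  by rewrite /windows !indicE mem_setT mem_set//; exact: subD DN.
have ndwork : nondecreasing_seq (fun n => work (windows (D n) s) w).
  by move=> n n' nn'; apply: work_mono => z; rewrite windows_ge0/=; exact: ndw.
have := cvg_en ndwork; rewrite (cvg_lim _ cw)// => ce.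
apply: fine_cvg; rewrite fineK; first exact: ce.
by rewrite en_fin_num// work_ge0// => z; exact: windows_ge0.
Qed.

Variable c : R.

(** Unbounded excess over slope [c], tested at integer lags only. The recent past [[-K, 0[] is left
    out; it changes the excess by a finite amount. *)
Definition overload_paths (K : nat) : set (paths (seq (R * R)) R) :=
  [set p | forall M : nat, exists n : nat,
    (K <= n)%N /\ c * n%:R + M%:R <= load p (- n%:R, - K%:R)].

Lemma measurable_overload_paths K : measurable (overload_paths K).
Proof.
rewrite (_ : overload_paths K = \bigcap_M \bigcup_(n in [set n | (K <= n)%N])
    [set p | c * n%:R + M%:R <= load p (- n%:R, - K%:R)]); last first.
  apply/seteqP; split => p pK M; first by move=> _; have [n [Kn ?]] := pK M; exists n.
  by have [n Kn ?] := pK M Logic.I; exists n.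
apply: bigcap_measurable => // M _; apply: bigcup_measurable => n _.
rewrite -[X in measurable X]setTI; apply: measurable_fun_le => //.
exact: measurable_load.
Qed.

Definition overload : set T := [set w | overload_paths 0 (survival setT ^~ w)].

Lemma measurable_survival_path D : measurable D ->
  measurable_fun [set: T] (fun w => survival D ^~ w : paths (seq (R * R)) R).
Proof.
move=> mD; apply: measurable_to_paths => s.
exact: (survival_unit S hawkes s mD).1.
Qed.

Lemma measurable_overload : measurable overload.
Proof.
rewrite -[X in measurable X]setTI.
apply: (measurable_survival_path measurableT) => //.
exact: measurable_overload_paths.
Qed.

Lemma overload_past K w : ordered_births w -> finite_input w ->
  overload w <-> overload_paths K (survival `]-oo, (- K%:R)[ ^~ w).
Proof.
move=> ow fw; split => ov M.
(* The level is raised by more than the work in [[-K, 0[], which is lost by stopping at [-K].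
   Together with the third summand this also excludes [n < K]. *)
- have [n [_]] := ov (M + (Num.truncn (input setT (- K%:R) 0 w)).+1 +
    (Num.truncn (`|c| * K%:R)).+1)%N.
  rewrite !load_survival oppr0 !natrD => nI.
  have tI := truncnS_gt (input setT (- K%:R) 0 w).
  have tK := truncnS_gt (`|c| * K%:R).
  have M0 : 0 <= M%:R :> R by [].
  have Kn : (K <= n)%N.
    rewrite leqNgt; apply/negP => nK.
    have nKR : (n%:R <= K%:R :> R) by rewrite ler_nat ltnW.
    have := le_input fw (_ : - K%:R <= - n%:R) (_ : - n%:R <= 0 :> R).
    rewrite lerN2 nKR oppr_le0 ler0n => /(_ isT isT) le.
    have : - (`|c| * K%:R) <= c * n%:R.
      have : `|c| * n%:R <= `|c| * K%:R by rewrite ler_wpM2l.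
      by have := ler_norm (- c); rewrite normrN; have : 0 <= n%:R :> R by []; nra.
    by lra.
  exists n; split => //; rewrite load_survival input_before//.
  have := @inputD (- n%:R) (- K%:R) 0 w fw.
  rewrite lerN2 ler_nat oppr_le0 ler0n => /(_ Kn isT) e.
  by have := normr_ge0 c; have : 0 <= K%:R :> R by []; nra.
- have [n [Kn]] := ov M; rewrite load_survival input_before// => nI.
  exists n; split => //; rewrite load_survival oppr0; apply: le_trans nI _.
  have := @inputD (- n%:R) (- K%:R) 0 w fw.
  rewrite lerN2 ler_nat oppr_le0 ler0n => /(_ Kn isT) ->.
  by rewrite lerDl input_ge0.
Qed.

Let m_lo K : measurable (`]-oo, (- K%:R)[%classic : set R).
Proof. exact: measurable_itv. Qed.

Let m_hi K : measurable (`[(- K%:R), +oo[%classic : set R).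
Proof. exact: measurable_itv. Qed.

Let survival_integral_unit D s : measurable D ->
  0 <= fine (\int[P]_w (survival D s w)%:E)%E <= 1.
Proof.
move=> mD; have sv := survival_unit S hawkes s mD.
rewrite -!lee_fin fineK ?integrable_fin_num//; last exact: unit_valued_integrable.
apply/andP; split; first by apply: integral_ge0 => w _; rewrite lee_fin; have /andP[] := sv.2 w.
apply: (@le_trans _ _ (\int[P]_w (cst 1 w))%E).
  apply: ge0_le_integral => //.
  - by move=> w _; rewrite lee_fin; have /andP[] := sv.2 w.
  - by apply/measurable_EFinP; exact: sv.1.
  - by move=> w _; rewrite lee_fin; have /andP[] := sv.2 w.
by rewrite integral_cst//= mul1e; exact: probability_le1.
Qed.

Let unit_cst (x : R) : 0 <= x <= 1 -> @unit_valued _ T R (cst x).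
Proof. by move=> x01; split => //; exact: measurable_cst. Qed.

Let fineI D s : measurable D ->
  ((fine (\int[P]_w (survival D s w)%:E))%:E = \int[P]_w (survival D s w)%:E)%E.
Proof.
move=> mD; rewrite fineK//; apply: integrable_fin_num => //.
exact/unit_valued_integrable/(survival_unit S hawkes s mD).
Qed.

Let ae_overload K : {ae P, forall w, overload w <->
  overload_paths K (survival `]-oo, (- K%:R)[ ^~ w)}.
Proof.
have := ae_finite_input lambda0_gt0 m0 m1 f_density hawkes V_density V_mean jobs.
have := ae_ordered_births hawkes.
by apply: filterS2 => w ow fw; exact: overload_past.
Qed.

(** Up to a null set [overload] is an event of the clusters started before [-K], whereas the
    integrand involves only the later clusters. *)
Lemma overload_independent_recent K s :
  (\int[P]_(w in overload) (survival `[(- K%:R), +oo[ s w)%:E =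
   P overload * \int[P]_w (survival `[(- K%:R), +oo[ s w)%:E)%E.
Proof.
pose E := [set w | overload_paths K (survival `]-oo, (- K%:R)[ ^~ w)].
have mE : measurable E.
  rewrite -[X in measurable X]setTI.
  by apply: (measurable_survival_path (m_lo K)) => //; exact: measurable_overload_paths.
have mO := measurable_overload.
have sv := survival_unit S hawkes s (m_hi K).
have PE : P overload = P E.
  apply: eq_prob_ae => //; exact: ae_overload.
have -> : (\int[P]_(w in overload) (survival `[(- K%:R), +oo[ s w)%:E =
    \int[P]_(w in E) (survival `[(- K%:R), +oo[ s w)%:E)%E.
  rewrite integral_mkcond [RHS]integral_mkcond; apply: ae_eq_integral => //.
  - apply/(measurable_restrictT _ mO); apply: measurable_funTS.
    by apply/measurable_EFinP; exact: sv.1.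
  - apply/(measurable_restrictT _ mE); apply: measurable_funTS.
    by apply/measurable_EFinP; exact: sv.1.
  - have := ae_overload K; apply: filterS => w oE _; rewrite !patchE.
    by have -> : (w \in overload) = (w \in E) by apply/idP/idP => /set_mem /oE ?; exact/mem_set.
rewrite PE.
(* Against the past, the recent survival variable and its constant mean have the same moments by
   [survival_factor]; as weights they therefore agree on every event of the past. *)
have := @multiplicative_class _ T R P _ [::] cat (survival `]-oo, (- K%:R)[)
  (survival `]-oo, (- K%:R)[) _ _ _ _ _ _ (survival `[(- K%:R), +oo[ s)
  (cst (fine (\int[P]_w (survival `[(- K%:R), +oo[ s w)%:E)%E)) (overload_paths K).
move=> -> //; last first.
- exact: measurable_overload_paths.
- split => //; first exact/unit_cst/survival_integral_unit.
  move=> t.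
  rewrite (survival_factor lambda0_gt0 m0 m1 f_density hawkes jobs)//; last first.
    apply/seteqP; split => // x [] /=; rewrite !in_itv/= andbT => Kx xK.
    by move: (lt_le_trans xK Kx); rewrite ltxx.
  under [RHS]eq_integral do rewrite EFinM.
  rewrite ge0_integralZl_EFin//.
  - by rewrite fineI.
  - by move=> w _; rewrite lee_fin; have /andP[] := (survival_unit S hawkes t (m_lo K)).2 w.
  - by apply/measurable_EFinP; exact: (survival_unit S hawkes t (m_lo K)).1.
  - by have /andP[] := survival_integral_unit s (m_hi K).
- by move=> i j x; exact: survival_cat.
- by move=> i j x; exact: survival_cat.
- by move=> x; exact: survival_nil.
- by move=> x; exact: survival_nil.
- by move=> i; exact: (survival_unit S hawkes i (m_lo K)).
- by move=> i; exact: (survival_unit S hawkes i (m_lo K)).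
by rewrite (integral_cst P mE (fine _)%:E) fineI// muleC.
Qed.

(** The previous lemma holds for every [K], and the clusters started after [-K] exhaust all clusters
    as [K] grows. *)
Lemma overload_independent s :
  (\int[P]_(w in overload) (survival setT s w)%:E =
   P overload * \int[P]_w (survival setT s w)%:E)%E.
Proof.
have hi_mono n : (`[(- n%:R : R), +oo[%classic : set R) `<=` `[(- n.+1%:R), +oo[%classic.
  move=> x /=; rewrite !in_itv/= !andbT; apply: le_trans.
  by rewrite lerN2 ler_nat.
have hi_cover : \bigcup_n (`[(- n%:R : R), +oo[%classic : set R) = setT.
  apply/seteqP; split => // x _; exists (Num.truncn `|x|).+1 => //=.
  rewrite in_itv/= andbT; have := truncnS_gt `|x|.
  by rewrite ltr_norml => /andP[/ltW].
have mO := measurable_overload.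
have sv n := survival_unit S hawkes s (m_hi n).
have lim w := @cvg_survival (fun n => `[(- n%:R), +oo[%classic) s w hi_mono hi_cover.
have l1 := unit_valued_cvg_integral (P := P) sv lim.
have l2 : (\int[P]_w (\1_overload w * survival `[(- n%:R), +oo[ s w)%:E @[n --> \oo] -->
    \int[P]_w (\1_overload w * survival setT s w)%:E)%E.
  apply: (@unit_valued_cvg_integral _ _ _ P (fun n w => _ * _)) => [n|w].
    by apply: unit_valuedM => //; exact: unit_valued_indic.
  by apply: cvgM; [exact: cvg_cst|exact: lim].
have toind D : (\int[P]_(w in overload) (survival D s w)%:E =
    \int[P]_w (\1_overload w * survival D s w)%:E)%E.
  rewrite integral_mkcond; apply: eq_integral => w _; rewrite patchE indicE.
  by case: ifP => _; rewrite ?mul1r ?mul0r.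
rewrite toind -(cvg_lim _ l2)//; apply/cvg_lim => //.
under eq_fun do rewrite -toind overload_independent_recent.
by apply: cvgeZl => //; exact: fin_num_measure.
Qed.

Theorem overload_zero_one : P overload = 0%E \/ P overload = 1%E.
Proof.
have mO := measurable_overload.
have P01 : 0 <= fine (P overload) <= 1.
  by rewrite -!lee_fin fineK ?fin_num_measure// measure_ge0 probability_le1.
suff : (P overload = P overload * P overload)%E.
  rewrite -(fineK (fin_num_measure P _ mO)) -EFinM => -[] /eqP.
  rewrite -subr_eq0 -{1}(mulr1 (fine _)) -mulrBr mulf_eq0 subr_eq0 => /orP[/eqP->|/eqP<-];
    by [left|right].
(* The indicator of [overload] and the constant [P overload] have the same moments against the whole
   path; comparing them on [overload] itself gives [p = p * p]. *)
have := @multiplicative_class _ T R P _ [::] cat (survival setT)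
  (survival setT) _ _ _ _ _ _ (\1_overload) (cst (fine (P overload))) (overload_paths 0).
move=> /(_ _ _ _ _ _ _ _ (measurable_overload_paths 0)) e.
have {e} : (\int[P]_(w in overload) (\1_overload w)%:E =
    \int[P]_(w in overload) (cst (fine (P overload)) w)%:E)%E.
  apply: e.
  - by move=> i; exact: (survival_unit S hawkes i measurableT).
  - by move=> i; exact: (survival_unit S hawkes i measurableT).
  - by move=> x; exact: survival_nil.
  - by move=> x; exact: survival_nil.
  - by move=> i j x; exact: survival_cat.
  - by move=> i j x; exact: survival_cat.
  split; [exact: unit_valued_indic|exact: unit_cst|move=> s].
  have sv := survival_unit S hawkes s measurableT.
  under [RHS]eq_integral do rewrite EFinM.
  rewrite ge0_integralZl_EFin//; last 3 first.
  - by move=> w _; rewrite lee_fin; have /andP[] := sv.2 w.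
  - by apply/measurable_EFinP; exact: sv.1.
  - by have /andP[] := P01.
  rewrite fineK ?fin_num_measure// -overload_independent [RHS]integral_mkcond.
  apply: eq_integral => w _; rewrite patchE indicE.
  by case: ifP => _; rewrite ?mul1r ?mul0r.
have -> : (\int[P]_(w in overload) (cst (fine (P overload)) w)%:E =
    (fine (P overload))%:E * P overload)%E by exact: (integral_cst P mO (fine (P overload))%:E).
by rewrite integral_indic// setIid fineK// fin_num_measure.
Qed.

End ZeroOne.

(** * Stability *)

Section Peak.
Context (R : realType).
Implicit Types (F G : nat -> R).

Fixpoint peak F n : R := if n is n'.+1 then Num.max (peak F n') (F n) else 0.

Lemma peak_ge0 F n : 0 <= peak F n.
Proof. by elim: n => //= n ih; rewrite le_max ih. Qed.

Lemma peakS F n : peak F n <= peak F n.+1.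
Proof. by rewrite /= le_max lexx. Qed.

Lemma le_peak F k n : F 0%N = 0 -> (k <= n)%N -> F k <= peak F n.
Proof.
move=> F0; elim: n => [|n ih]; first by rewrite leqn0 => /eqP->; rewrite F0.
by rewrite leq_eqVlt => /predU1P[->|/ih kn]; rewrite /= le_max ?lexx ?orbT// kn.
Qed.

Lemma peak_le F n (B : R) : 0 <= B -> (forall k, (k <= n)%N -> F k <= B) -> peak F n <= B.
Proof.
move=> B0; elim: n => //= n ih FB; rewrite ge_max FB// andbT ih// => k kn.
by rewrite FB// ltnW.
Qed.

(** Lindley's recursion for the workload: [F] and [G] are the excesses seen from two consecutive
    integer times, and [a] is the net input between them. *)
Lemma peak_rec F G a n : G 0%N = 0 -> (forall k, F k.+1 = a + G k) ->
  peak F n.+1 = Num.max 0 (a + peak G n).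
Proof.
move=> G0 FG; elim: n => [|n ih]; first by rewrite /= FG G0.
rewrite -[LHS]/(Num.max (peak F n.+1) (F n.+2)) ih FG -maxA; congr Num.max.
by rewrite addr_maxr.
Qed.

End Peak.

(** * Translation invariance of the law and Loynes' argument *)

Section Loynes.
Context d (T : measurableType d) (R : realType) (P : probability T R).
Context (lambda0 m : R) (f : R -> R).
Context (imm : nat -> T -> \bar R) (off : label -> nat -> T -> \bar R).
Context (V : {RV P >-> R}) (S : label -> {RV P >-> R}).
Hypotheses (lambda0_gt0 : 0 < lambda0) (m0 : 0 < m) (m1 : m < 1).
Hypothesis f_density : prob_density `[0, +oo[ f.
Hypothesis hawkes : stationary_hawkes P lambda0 m f imm off.
Hypothesis V_density : positive_with_continuous_density V.
Hypothesis V_mean : ('E_P[V] = 1)%E.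
Hypothesis jobs : iid_job_sizes (arrival imm off) V S.
Local Notation work := (work imm off S).
Local Notation survival := (survival imm off S).
Local Notation input := (input imm off S).
Local Notation overload := (overload imm off S).
Local Notation paths := (paths (seq (R * R)) R).

Definition input_path (w : T) : paths := survival setT ^~ w.

Definition shifted_path (u : R) (w : T) : paths :=
  fun s => survival setT (shift_windows u s) w.

Lemma measurable_input_path : measurable_fun [set: T] input_path.
Proof. exact: (measurable_survival_path S hawkes measurableT). Qed.

Lemma measurable_shifted_path u : measurable_fun [set: T] (shifted_path u).
Proof.
apply: measurable_to_paths => s.
exact: (survival_unit S hawkes (shift_windows u s) measurableT).1.
Qed.

(** Both families are multiplicative with equal first moments by [survival_shift]; constant weights
    1 turn equality of integrals into equality of probabilities. *)
Lemma shifted_path_law u E : measurable (E : set paths) ->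
  P (shifted_path u @^-1` E) = P (input_path @^-1` E).
Proof.
move=> mE.
have sv s := survival_unit S hawkes s measurableT.
have := @multiplicative_class _ T R P _ [::] cat
  (fun s => survival setT (shift_windows u s)) (survival setT) _ _ _ _ _ _ (cst 1) (cst 1) E.
have mpre (X : T -> paths) : measurable_fun [set: T] X -> measurable (X @^-1` E).
  by move=> mX; rewrite -[X in measurable X]setTI; exact: mX.
have mu := mpre _ (measurable_shifted_path u).
have mp := mpre _ measurable_input_path.
move=> /(_ _ _ _ _ _ _ _ mE) e.
have {e} : (\int[P]_(w in shifted_path u @^-1` E) (cst 1 w)%:E =
    \int[P]_(w in input_path @^-1` E) (cst 1 w)%:E)%E.
  apply: e.
  - by move=> s; exact: sv.
  - exact: sv.
  - by move=> w; exact: survival_nil.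
  - by move=> w; exact: survival_nil.
  - by move=> s t w; rewrite /shift_windows map_cat survival_cat.
  - by move=> s t w; exact: survival_cat.
  have v1 : unit_valued (cst 1 : T -> R).
    by split => [|w]; [exact: measurable_cst|rewrite /= lexx ler01].
  split; [exact: v1|exact: v1|move=> s].
  under eq_integral do rewrite mul1r; under [RHS]eq_integral do rewrite mul1r.
  exact: (survival_shift lambda0_gt0 m0 m1 f_density hawkes jobs).
by rewrite (integral_cst P mu 1%E) (integral_cst P mp 1%E) !mul1e.
Qed.

Lemma shifted_path_integral u (g : paths -> \bar R) :
  measurable_fun [set: paths] g -> (forall p, 0 <= g p)%E ->
  (\int[P]_w g (shifted_path u w) = \int[P]_w g (input_path w))%E.
Proof.
move=> mg g0.
have := @ge0_integral_pushforward _ _ _ _ R _ (measurable_shifted_path u) P setT g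
  measurableT mg (fun p _ => g0 p).
rewrite preimage_setT => <-.
have := @ge0_integral_pushforward _ _ _ _ R _ measurable_input_path P setT g
  measurableT mg (fun p _ => g0 p).
rewrite preimage_setT => <-.
have mp := measurable_input_path; have ms := measurable_shifted_path u.
by apply: eq_measure_integral;
  first [exact: mp|exact: ms|move=> A mA _; exact: shifted_path_law].
Qed.

Lemma load_shifted_path u a b w :
  load (shifted_path u w) (a, b) = input setT (a + u) (b + u) w.
Proof. by rewrite -load_survival. Qed.

Lemma measurable_input a b : measurable_fun [set: T] (input setT a b).
Proof.
apply: (measurableT_comp (@fine_measurable R setT measurableT)).
by apply: (measurable_work S hawkes); [exact: measurable_windows|exact: windows_ge0].
Qed.

Lemma input_mean a b : a <= b ->
  (\int[P]_w (input setT a b w)%:E <= (lambda0 / (1 - m) * (b - a))%:E)%E.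
Proof.
move=> ab; pose g (x : R) : \bar R := (\1_(`[a, b[%classic : set R) x)%:E.
have mg : measurable_fun [set: R] g.
  by apply/measurable_EFinP; apply: measurable_indic; exact: measurable_itv.
have g0 x : (0 <= g x)%E by rewrite lee_fin indic_ge0.
have w0 w : (0 <= work (windows setT [:: (a, b)]) w)%E.
  by apply: work_ge0 => z; exact: windows_ge0.
have mw : measurable_fun [set: T] (work (windows setT [:: (a, b)])).
  by apply: (measurable_work S hawkes); [exact: measurable_windows|exact: windows_ge0].
apply: (@le_trans _ _ (\int[P]_w work (windows setT [:: (a, b)]) w)%E).
  apply: ge0_le_integral => //.
  - by move=> w _; rewrite lee_fin; exact: input_ge0.
  - by apply/measurable_EFinP; exact: measurable_input.
  - by move=> w _; rewrite /input; case: (work _ w) (w0 w) => [x| |] //=; rewrite leey.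
have -> : windows setT [:: (a, b)] = (fun z => g z.2).
  by apply/funext => z; exact: windowsT1.
apply: le_trans (work_mean lambda0_gt0 m0 m1 f_density hawkes V_density V_mean jobs mg g0) _.
rewrite [leRHS]EFinM; apply: lee_wpmul2l.
  by rewrite lee_fin divr_ge0// ?(ltW lambda0_gt0)// subr_ge0 ltW.
have mI : measurable (`[a, b[%classic : set R) by exact: measurable_itv.
have -> : (\int[lebesgue_measure]_x g x = lebesgue_measure (`[a, b[%classic : set R))%E.
  by rewrite (integral_indic lebesgue_measure measurableT mI) setIT.
rewrite lebesgue_measure_itv/=.
by case: ifP => // _; rewrite lee_fin subr_ge0.
Qed.

Lemma input_empty a b w : b <= a -> input setT a b w = 0.
Proof.
move=> ba; rewrite /input (_ : work _ w = 0)%E//; apply: esum1 => e _.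
suff -> : ext2 (windows setT [:: (a, b)]) (birth imm off e w) = 0%E by rewrite mule0.
case: (birth imm off e w) => -[x0| |] [x| |]; rewrite /ext2//= windowsT1/= indicE.
rewrite memNset//= in_itv/= => /andP[ax xb].
by move: (lt_le_trans (le_lt_trans ax xb) ba); rewrite ltxx.
Qed.

Lemma integrable_input a b : P.-integrable [set: T] (EFin \o input setT a b).
Proof.
apply/integrableP; split; first by apply/measurable_EFinP; exact: measurable_input.
under eq_integral do rewrite gee0_abs ?lee_fin ?input_ge0//.
have [ab|ba] := leP a b; first exact: le_lt_trans (input_mean ab) (ltry _).
by rewrite integral0_eq ?ltry// => w _; congr _%:E; exact/input_empty/ltW.
Qed.

Variable c : R.
Hypothesis stable : lambda0 / (1 - m) < c.

Let excess (p : paths) (b : R) (k : nat) : R := load p (b - k%:R, b) - c * k%:R.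

(** The workload at time [b] at slope [c], with lags restricted to the integers up to [n]; it is
    compared at the times 0 and -1. *)
Let top b n w := peak (excess (input_path w) b) n.

Let excessE b k w : excess (input_path w) b k = input setT (b - k%:R) b w - c * k%:R.
Proof. by rewrite /excess load_survival. Qed.

Let measurable_peak b n : measurable_fun [set: paths] (fun p => peak (excess p b) n).
Proof.
elim: n => [|n ih] /=; first exact: measurable_cst.
apply: measurable_maxr => //; apply: measurable_funB; last exact: measurable_cst.
exact: measurable_load.
Qed.

Let measurable_top b n : measurable_fun [set: T] (top b n).
Proof. exact: measurableT_comp (measurable_peak b n) measurable_input_path. Qed.

Let top_stationary n :
  (\int[P]_w (top (-1) n w)%:E = \int[P]_w (top 0 n w)%:E)%E.
Proof.
have := @shifted_path_integral (-1) (fun p => (peak (excess p 0) n)%:E).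
move=> /(_ _ _) <-; last 2 first.
- by apply/measurable_EFinP; exact: measurable_peak.
- by move=> p; rewrite lee_fin peak_ge0.
apply: eq_integral => w _; congr (peak _ n)%:E; apply/funext => k.
by rewrite excessE /excess load_shifted_path !add0r [- k%:R - 1]addrC.
Qed.

Let c_gt0 : 0 < c.
Proof.
by apply: le_lt_trans stable; rewrite divr_ge0// ?(ltW lambda0_gt0)// subr_ge0 ltW.
Qed.

Let top_le b n w : finite_input imm off S w -> top b n w <= input setT (b - n%:R) b w.
Proof.
move=> fw; apply: peak_le => [|k kn]; first exact: input_ge0.
rewrite excessE lerBlDr; apply: le_trans (le_input fw (_ : b - n%:R <= b - k%:R) _) _.
- by rewrite lerB// ler_nat.
- by rewrite gerBl.
- by rewrite lerDl mulr_ge0// ltW.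
Qed.

Let top_integrable b n : P.-integrable [set: T] (EFin \o top b n).
Proof.
apply/integrableP; split; first by apply/measurable_EFinP; exact: measurable_top.
have := integrable_input (b - n%:R) b => /integrableP[_]; apply: le_lt_trans.
apply: ae_ge0_le_integral => //.
- by apply: measurableT_comp => //; apply/measurable_EFinP; exact: measurable_top.
- by apply: measurableT_comp => //; apply/measurable_EFinP; exact: measurable_input.
have := ae_finite_input lambda0_gt0 m0 m1 f_density hawkes V_density V_mean jobs.
apply: filterS => w fw _ /=; rewrite lee_fin !ger0_norm ?peak_ge0 ?input_ge0//.
exact: top_le.
Qed.

Let excess0 b w : excess (input_path w) b 0 = 0.
Proof. by rewrite excessE subr0 input_empty// mulr0 subr0. Qed.

Let top_rec n w : finite_input imm off S w ->
  top 0 n.+1 w = Num.max 0 (input setT (-1) 0 w - c + top (-1) n w).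
Proof.
move=> fw; apply: peak_rec; first exact: excess0.
move=> k; rewrite !excessE add0r (@inputD _ _ _ _ _ _ _ (- k.+1%:R) (-1) 0)//.
- rewrite -natr1 opprD [- k%:R - 1]addrC mulrDr mulr1; ring.
- by rewrite lerN2 ler1n.
Qed.

(* Loynes: the expected increment of the maximum over the past is nonnegative
   by stationarity, whereas it would tend to [E(input setT (-1) 0) - c < 0]
   if the maximum diverged. *)
Lemma overload_null : P (overload c) = 0%E.
Proof.
have [//|P1] := overload_zero_one lambda0_gt0 m0 m1 f_density hawkes V_density V_mean jobs c.
exfalso; pose a w := input setT (-1) 0 w - c.
(* Both terms look back to the same time [- n.+1], so [top_rec] gives [D n = max (- top (-1) n) a],
   which is dominated by the absolute value of [a]. *)
pose D n w := top 0 n.+1 w - top (-1) n w.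
have ia : P.-integrable [set: T] (EFin \o a).
  have -> : EFin \o a = (fun w => (input setT (-1) 0 w)%:E - (cst c%:E) w)%E.
    by apply/funext => w; rewrite /= EFinB.
  apply: integrableB => //; first exact: integrable_input.
  exact: finite_measure_integrable_cst.
have Dge0 n : (0 <= \int[P]_w (D n w)%:E)%E.
  under eq_integral do rewrite EFinB.
  rewrite integralB//; [|exact: top_integrable|exact: top_integrable].
  rewrite top_stationary sube_ge0; last first.
    by rewrite orbC integrable_fin_num//; exact: top_integrable.
  apply: ge0_le_integral => //.
  - by move=> w _; rewrite lee_fin peak_ge0.
  - by apply/measurable_EFinP; exact: measurable_top.
  - by apply/measurable_EFinP; exact: measurable_top.
  - by move=> w _; rewrite lee_fin; exact: peakS.
have finite := ae_finite_input lambda0_gt0 m0 m1 f_density hawkes V_density V_mean jobs.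
have over := ae_prob1 (measurable_overload S hawkes c) P1.
have mD n : measurable_fun [set: T] (fun w => (D n w)%:E).
  by apply/measurable_EFinP; apply: measurable_funB; exact: measurable_top.
have limD : {ae P, forall w, [set: T] w -> (D n w)%:E @[n --> \oo] --> (EFin \o a) w}.
  apply: filterS2 finite over => w fw ow _.
  (* Once the excess is positive at one lag [n], the maximum in [top_rec] is attained by its second
     term, so [D k] equals [a] for all [k >= n]. *)
  apply: cvg_near_cst; have [n [_]] := ow 1%N.
  rewrite load_survival oppr0 => n1; exists n => // k /= nk; congr EFin.
  have : 0 < top 0 k.+1 w.
    have : excess (input_path w) 0 n <= top 0 k.+1 w.
      by apply: le_peak; [exact: excess0|exact: leqW].
    rewrite excessE add0r; lra.
  rewrite /D top_rec//; rewrite lt_max ltxx /= => pos.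
  by rewrite max_r ?ltW// addrK.
have boundD : {ae P, forall w, forall n, [set: T] w -> (`|(D n w)%:E| <= `|(EFin \o a) w|)%E}.
  apply: filterS finite => w fw n _; rewrite /= lee_fin /D top_rec// -/(a w).
  have := peak_ge0 (excess (input_path w) (-1)) n; rewrite -/(top (-1) n w) => t0.
  have := ler_norm (a w); have := ler_norm (- a w); rewrite normrN => n1 n2.
  by rewrite ler_norml; case: (leP 0 (a w + top (-1) n w)) => h; apply/andP; split; lra.
have [_ _ cvgD] := dominated_convergence measurableT mD (measurable_int _ ia) limD
  (integrable_abse ia) boundD.
have : (0 <= \int[P]_w (a w)%:E)%E.
  rewrite -(cvg_lim _ cvgD)//; apply: lime_ge; first exact: cvgP cvgD.
  exact: nearW.
under eq_integral do rewrite EFinB.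
rewrite integralB//; [|exact: integrable_input|exact: finite_measure_integrable_cst].
have -> : (\int[P]__ c%:E = c%:E)%E.
  transitivity (c%:E * P setT)%E; first exact: (integral_cst P measurableT c%:E).
  by rewrite probability_setT mule1.
apply/negP; rewrite -ltNge sube_lt0 ?fin_numE ?orbT//.
apply: le_lt_trans (input_mean _) _; first by rewrite oppr_le0.
by rewrite lte_fin opprK add0r mulr1.
Qed.

Lemma ae_stable : {ae P, forall w, exists M : nat, forall n : nat,
  input setT (- n%:R) 0 w < c * n%:R + M%:R}.
Proof.
exists (overload c); split.
- exact: (measurable_overload S hawkes).
- exact: overload_null.
- move=> w /= nM M; apply: contrapT => noM; apply: nM; exists M => n.
  rewrite ltNge; apply/negP => cn; apply: noM; exists n; split => //.
  by rewrite load_survival oppr0.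
Qed.

End Loynes.

(** * Maximizers of the backward path *)

Section ArgMax.
Context (R : realType).

Lemma exists_argmax (s : seq R) (g : R -> R) x0 : x0 \in s ->
  exists2 x, x \in s & forall y, y \in s -> g y <= g x.
Proof.
elim: s x0 => // a s ih x0 _; case: s ih => [_|b s ih].
  by exists a; rewrite ?mem_head// => y; rewrite mem_seq1 => /eqP->.
have [x xs xmax] := ih b (mem_head _ _).
have [ax|xa] := leP (g a) (g x).
  exists x; first by rewrite inE xs orbT.
  by move=> y; rewrite inE => /predU1P[->//|/xmax].
exists a; first exact: mem_head.
by move=> y; rewrite inE => /predU1P[->//|/xmax/le_trans]; apply; exact: ltW.
Qed.

Lemma exists_gap (s : seq R) (g : R -> R) (B : R) (Q : pred R) :
  (forall y, y \in s -> Q y -> g y < B) ->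
  exists2 delta, 0 < delta & forall y, y \in s -> Q y -> g y <= B - delta.
Proof.
elim: s => [_|a s ih gB]; first by exists 1.
have [//|delta d0 gap] := ih; first by move=> y ys; apply: gB; rewrite inE ys orbT.
have [Qa|nQa] := boolP (Q a); last first.
  exists delta => // y; rewrite inE => /predU1P[->|]; last exact: gap.
  by move=> Qa; rewrite Qa in nQa.
have ga := gB a (mem_head _ _) Qa.
exists (Num.min delta (B - g a)); first by rewrite lt_min d0 subr_gt0.
move=> y; rewrite inE => /predU1P[->|ys] Qy.
  by rewrite lerBrDl -lerBrDr ge_min lexx orbT.
apply: le_trans (gap _ ys Qy) _.
by rewrite lerB// ge_min lexx.
Qed.

Section BackwardPath.
Variables (F : R -> R -> R) (A : set R) (mu t : R).
Hypothesis mu_gt0 : 0 < mu.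
Hypothesis F_add : forall a b c, a <= b -> b <= c -> F a c = F a b + F b c.
Hypothesis A_finite : forall a b, finite_set (A `&` `[a, b[).
Hypothesis F_no_jump : forall a b, A `&` `[a, b[ = set0 -> F a b = 0.
Hypothesis F_drift : exists s0, forall s, s0 < s -> F (t - s) t < mu * s.
Hypothesis F_no_tie : forall a b, A a -> A b \/ b = t -> a < b -> F a b != mu * (b - a).

Let r s := F (t - s) t - mu * s.

Let r0 : r 0 = 0.
Proof.
rewrite /r subr0 mulr0 subr0; apply: F_no_jump; apply/seteqP; split => // x [_] /=.
by rewrite in_itv/= => /andP[tx /(le_lt_trans tx)]; rewrite ltxx.
Qed.

(* Between two consecutive arrivals the backward path decreases, so that it can
   only be maximal at [0] or at an arrival. *)
Let candidates : exists cand : seq R,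
  [/\ 0 \in cand, (forall x, x \in cand -> x = 0 \/ 0 < x /\ A (t - x)) &
      forall s, 0 <= s -> exists x, [/\ x \in cand, x <= s & s != x -> r s < r x]].
Proof.
have [s0 drift] := F_drift.
have /finite_seqP[l Al] := A_finite (t - s0) t.
have lP x : x \in l -> A x /\ t - s0 <= x < t.
  by move=> xl; have : [set` l] x by []; rewrite -Al => -[Ax]; rewrite /= in_itv.
exists (0 :: [seq t - a | a <- l]); split; first exact: mem_head.
  move=> x; rewrite inE => /predU1P[->|/mapP[a /lP[Aa /andP[_ at_]] ->]]; first by left.
  by right; rewrite subr_gt0 subKr.
move=> s s_ge0; have [s0s|ss0] := ltP s0 s.
  exists 0; split => //; first exact: mem_head.
  by move=> _; rewrite r0 subr_lt0 drift.
have /finite_seqP[k Ak] := A_finite (t - s) t.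
case: k Ak => [|a0 k] Ak.
  exists 0; split => //; first exact: mem_head.
  move=> sn0; rewrite r0 /r F_no_jump; last by rewrite Ak; apply/seteqP; split.
  by rewrite sub0r oppr_lt0 mulr_gt0// lt_def sn0.
(* [a] is the earliest arrival in [[t - s, t[]. No work arrives in [[t - s, a[], so between the lags
   [t - a] and [s] the path falls with slope [mu]. *)
have [a ak amin] := @exists_argmax (a0 :: k) (fun x => - x) a0 (mem_head _ _).
have [Aa] : (A `&` `[t - s, t[) a by rewrite Ak.
rewrite /= in_itv/= => /andP[sa at_].
have aS : t - a <= s by lra.
exists (t - a); split => //.
  rewrite inE; apply/orP; right; apply/mapP; exists a => //.
  have : (A `&` `[t - s0, t[) a by split=> //=; rewrite in_itv/= at_ andbT; lra.
  by rewrite Al.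
move=> sna; rewrite /r subKr (F_add sa (ltW at_)).
rewrite F_no_jump ?add0r; last first.
  apply/seteqP; split => // x [Ax]; rewrite /= in_itv/= => /andP[sx xa].
  have : (A `&` `[t - s, t[) x.
    by split => //=; rewrite in_itv/= sx (lt_trans xa).
  by rewrite Ak => /amin; rewrite lerN2 leNgt xa.
have : t - a < s by rewrite lt_def sna.
by move=> aS'; rewrite ltrD2l ltrN2 ltr_pM2l.
Qed.

Let no_tie x y : x = 0 \/ 0 < x /\ A (t - x) -> 0 < y /\ A (t - y) -> x < y -> r x != r y.
Proof.
move=> xP [y0 Ay] xy; apply/eqP => rxy.
have lty : t - y < t - x by lra.
have b : A (t - x) \/ t - x = t by case: xP => [->|[]]; [right; rewrite subr0|left].
have := F_no_tie Ay b lty; rewrite (_ : t - x - (t - y) = y - x); last by ring.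
have xt : t - x <= t by case: xP => [->|[]]; lra.
move: rxy; rewrite /r (F_add (ltW lty) xt) => rxy.
by move/eqP; apply; lra.
Qed.

(** Finitely many candidates compete, hence the uniform gap [delta] below the maximum at all lags
    before [X]; it allows [argmax_path] to locate [X] by rational lags. *)
Lemma exists_unique_maximizer : exists X delta, [/\ 0 <= X, 0 < delta,
  (forall s, 0 <= s -> s != X -> r s < r X) &
  (forall s, 0 <= s -> s < X -> r s <= r X - delta)].
Proof.
have [cand [c0 candP reach]] := candidates.
have [X Xc Xmax] := exists_argmax r c0.
have cand_lt y : y \in cand -> y != X -> r y < r X.
  move=> yc yX; rewrite lt_def Xmax// andbT eq_sym.
  have := candP _ yc; have := candP _ Xc => XP yP.
  have [yltX|Xlty|] := ltgtP y X; last by move/eqP; rewrite (negbTE yX).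
    apply: no_tie => //; case: XP => // X0; case: yP => [y0|[y0 _]]; exfalso; lra.
  rewrite eq_sym; apply: no_tie => //; case: yP => // y0; case: XP => [X0|[X0 _]]; exfalso; lra.
have [delta d0 gap] := exists_gap (fun y yc => cand_lt y yc).
exists X, delta; split => //.
- by case: (candP _ Xc) => [->|[/ltW]].
- move=> s s_ge0 sX; have [x [xc xs]] := reach s s_ge0.
  have [sx|sx /(_ isT) rs] := eqVneq s x; first by subst; rewrite cand_lt.
  exact: lt_le_trans rs (Xmax _ xc).
(* The candidate dominating [s] satisfies [x <= s < X], so it differs from [X] and the gap applies
   to it. *)
- move=> s s_ge0 sX; have [x [xc xs rs]] := reach s s_ge0.
  have xX : x != X by rewrite lt_eqF// (le_lt_trans xs).
  apply: le_trans (gap _ xc xX).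
  by have [->//|/rs/ltW] := eqVneq s x.
Qed.

End BackwardPath.

End ArgMax.

(** * A measurable formula for the maximizer *)

Section ArgMaxFunctional.
Context (R : realType).
Local Notation paths := (paths (seq (R * R)) R).
Variables (mu t : R).

Definition backward (p : paths) (s : R) : R := load p (t - s, t) - mu * s.

(** Over rational lags, those in [[0, c]] do as well as those beyond [c], up to an arbitrarily small
    error since suprema over rationals need not be attained. Under the hypotheses of [argmax_pathE]
    this fails for [0 <= c < X] and holds for [c > X]. *)
Definition reached_by (c : R) : set paths :=
  [set p | forall (q : rat) (k : nat), c < ratr q -> exists q' : rat,
    0 <= (ratr q' : R) <= c /\ backward p (ratr q) - k.+1%:R^-1 <= backward p (ratr q')].

Definition last_unreached (p : paths) (n : nat) : \bar R :=
  if @pickle_inv rat n is Some c then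
    (Num.max 0 (ratr c) * \1_(~` reached_by (ratr c)) p)%:E
  else 0%E.

(* The argument of the maximum of the backward path, written with countably
   many operations. *)
Definition argmax_path (p : paths) : R := fine (esups (last_unreached p) 0).

Lemma measurable_backward s : measurable_fun [set: paths] (backward ^~ s).
Proof. by apply: measurable_funB; [exact: measurable_load|exact: measurable_cst]. Qed.

Lemma measurable_reached_by c : measurable (reached_by c).
Proof.
have bigcap_rat (G : rat -> set paths) : (forall q, measurable (G q)) ->
    measurable (\bigcap_q G q).
  move=> mG; rewrite -[X in measurable X]setCK setC_bigcap.
  by apply: measurableC; apply: bigcupT_measurable_rat => q; exact: measurableC.
have -> : reached_by c = \bigcap_(q : rat) \bigcap_k \bigcup_(q' : rat)
    [set p | c < ratr q -> 0 <= (ratr q' : R) <= c /\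
      backward p (ratr q) - k.+1%:R^-1 <= backward p (ratr q')].
  apply/seteqP; split => [p rp q _ k _|p rp q k cq].
    have [cq|cq] := ltP c (ratr q); last by exists 0.
    by have [q' rq'] := rp q k cq; exists q'.
  by have [q' _ /(_ cq) rq'] := rp q Logic.I k Logic.I; exists q'.
apply: bigcap_rat => q; apply: bigcapT_measurable => k; apply: bigcupT_measurable_rat => q'.
have [cq|cq] := ltP c (ratr q); last first.
  by rewrite (_ : [set p | _] = setT)//; apply/seteqP; split.
have [q'c|q'c] := boolP (0 <= (ratr q' : R) <= c); last first.
  by rewrite (_ : [set p | _] = set0)//; apply/seteqP; split => // p /(_ isT) [].
rewrite (_ : [set p | _] = [set p |
    backward p (ratr q) - k.+1%:R^-1 <= backward p (ratr q')]); last first.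
  by apply/seteqP; split => p /=; [move=> /(_ isT) []|move=> h _].
rewrite -[X in measurable X]setTI; apply: measurable_fun_le => //.
  by apply: measurable_funB; [exact: measurable_backward|exact: measurable_cst].
exact: measurable_backward.
Qed.

Lemma measurable_argmax_path : measurable_fun [set: paths] argmax_path.
Proof.
apply: (measurableT_comp (@fine_measurable R setT measurableT)).
apply: measurable_fun_esups => n; rewrite /last_unreached.
case: pickle_inv => [c|]; last exact: measurable_cst.
apply/measurable_EFinP; apply: measurable_funM; first exact: measurable_cst.
by apply: measurable_indic; apply: measurableC; exact: measurable_reached_by.
Qed.

Lemma argmax_pathE (p : paths) (X delta : R) : 0 < mu -> 0 <= X -> 0 < delta ->
  (forall a b c, a <= b -> b <= c -> load p (b, c) <= load p (a, c)) ->
  (forall s : R, 0 <= s -> backward p s <= backward p X) ->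
  (forall s : R, 0 <= s -> s < X -> backward p s <= backward p X - delta) ->
  argmax_path p = X.
Proof.
move=> mu0 X0 d0 mono Xmax gap.
(* Enlarging the lag never decreases the load, so beyond [X] the path falls at rate at most [mu];
   rational lags slightly larger than [X] are almost optimal. *)
have right_lower (x : R) : X <= x -> backward p X - mu * (x - X) <= backward p x.
  move=> Xx; rewrite /backward.
  have tx : t - x <= t - X by lra.
  have tX : t - X <= t by lra.
  by have := mono _ _ _ tx tX; lra.
have unreached_le c : ~ reached_by c p -> c <= X.
  move=> nr; rewrite leNgt; apply/negP => Xc; apply: nr => q k cq.
  have k0 : 0 < k.+1%:R^-1 :> R by rewrite invr_gt0.
  have lt1 : X < Num.min c (X + k.+1%:R^-1 / mu) by rewrite lt_min Xc ltrDl divr_gt0.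
  have [q' /[!in_itv]/= /andP[Xq']] := rat_in_itvoo lt1.
  rewrite lt_min => /andP[q'c q'k]; exists q'; split.
    by rewrite (le_trans X0 (ltW Xq')) ltW.
  have := right_lower _ (ltW Xq'); have := Xmax (ratr q).
  have : mu * (ratr q' - X) <= k.+1%:R^-1.
    by rewrite mulrC -ler_pdivlMr// lerBlDl ltW.
  have : 0 <= ratr q :> R by lra.
  by move=> q0 h1 /(_ q0) h2 h3; apply: le_trans h3; exact: lerB h2 h1.
have below (c : R) : 0 <= c -> c < X -> ~ reached_by c p.
  move=> c0 cX rc.
  (* Two errors of size at most [e] occur, one from the tolerance in [reached_by] and one from
     replacing [X] by a rational lag [q]; their sum has to stay below [delta]. *)
  pose e := delta / 4.
  have e0 : 0 < e by rewrite divr_gt0.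
  have lt1 : X < X + e / mu by rewrite ltrDl divr_gt0.
  have [q /[!in_itv]/= /andP[Xq qe]] := rat_in_itvoo lt1.
  have [q' [/andP[q'0 q'c] h]] := rc q (Num.truncn e^-1) (lt_trans cX Xq).
  have := gap _ q'0 (le_lt_trans q'c cX); have := right_lower _ (ltW Xq).
  have : mu * (ratr q - X) <= e.
    by rewrite mulrC -ler_pdivlMr// lerBlDl ltW.
  have : (Num.truncn e^-1).+1%:R^-1 <= e.
    by rewrite invf_ple// ?posrE//; apply/ltW; exact: truncnS_gt.
  have arith (a b k z y : R) : a - k <= b -> k <= e -> z <= e -> y - z <= a ->
      b <= y - delta -> False.
    have de : delta = e * 4 by rewrite divfK.
    by lra.
  by move=> h1 h2 h3 h4; exact: arith h h1 h2 h3 h4.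
suff -> : argmax_path p = fine X%:E by [].
congr fine; apply/eqP; rewrite eq_le; apply/andP; split.
  apply: ge_ereal_sup => _ [n _ <-]; rewrite /last_unreached.
  case: pickle_inv => [c|]; last by rewrite lee_fin.
  rewrite lee_fin indicE; case: (boolP (p \in _)) => [/set_mem/= nr|_]; last by rewrite mulr0.
  by rewrite mulr1 ge_max X0 unreached_le.
have term_le n : (last_unreached p n <= esups (last_unreached p) 0%N)%E.
  by apply: ereal_sup_ubound; exists n.
have sup_ge0 : (0 <= esups (last_unreached p) 0%N)%E.
  apply: le_trans (term_le 0%N); rewrite /last_unreached.
  case: pickle_inv => [c|] //; rewrite lee_fin mulr_ge0 ?indic_ge0//.
  by rewrite le_max lexx.
rewrite leNgt; apply/negP => supX.
case: (esups _ 0%N) sup_ge0 supX term_le => [y| |]//; rewrite lee_fin lte_fin => y0 yX term_le.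
have [c /[!in_itv]/= /andP[yc cX]] := rat_in_itvoo yX.
have := term_le (choice.pickle c); rewrite /last_unreached pickleK_inv lee_fin indicE mem_set.
  by rewrite mulr1 ge_max => /andP[_]; rewrite leNgt yc.
by apply: below => //; lra.
Qed.

End ArgMaxFunctional.

(** * Absence of ties *)

Lemma measurable_bool_indicator d (T : measurableType d) (R : realType) (b : T -> bool) :
  measurable_fun [set: T] b -> measurable_fun [set: T] (fun w => (b w)%:R : R).
Proof.
move=> mb; have -> : (fun w => (b w)%:R : R) = \1_(b @^-1` [set true]).
  apply/funext => w; rewrite indicE; congr (nat_of_bool _)%:R.
  by apply/idP/idP => [bw|/set_mem//]; exact/mem_set.
apply: measurable_indic; rewrite -[X in measurable X]setTI; exact: mb.
Qed.

Section Ties.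
Context d (T : measurableType d) (R : realType) (P : probability T R).
Context (lambda0 m : R) (f : R -> R).
Context (imm : nat -> T -> \bar R) (off : label -> nat -> T -> \bar R).
Context (V : {RV P >-> R}) (S : label -> {RV P >-> R}).
Hypotheses (lambda0_gt0 : 0 < lambda0) (m0 : 0 < m) (m1 : m < 1).
Hypothesis f_density : prob_density `[0, +oo[ f.
Hypothesis hawkes : stationary_hawkes P lambda0 m f imm off.
Hypothesis V_density : positive_with_continuous_density V.
Hypothesis V_mean : ('E_P[V] = 1)%E.
Hypothesis jobs : iid_job_sizes (arrival imm off) V S.
Local Notation arr := (arrival imm off).
Local Notation input := (input imm off S).

Let source (o : option label) : set (set T) :=
  if o is Some e then sigma_of (fun _ : unit => S e : T -> R) else sigma_of arr.

Let source_sigma o : sigma_algebra [set: T] (source o).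
Proof. by case: o => [e|]; exact: sigma_of_sigma_algebra. Qed.

Let source_measurable o A : source o A -> measurable A.
Proof.
case: o => [e|]; apply: sigma_of_measurable => // e.
exact: (measurableT_comp measurable_snd (measurable_birth hawkes e)).
Qed.

Let source_independent : mutual_independence P source.
Proof. by case: jobs. Qed.

Local Notation others_type e :=
  (g_sigma_algebraType (joint source [set o | o <> Some e])).

Lemma job_atomless e v : P (S e @^-1` [set v]) = 0%E.
Proof.
have [/(_ e _ (measurable_set1 v)) + _] := jobs; rewrite /distribution/= /pushforward => ->.
case: V_density => _ [g [_ _ gV]].
have := gV _ (measurable_set1 v); rewrite /distribution/= /pushforward => ->.
by apply: (integral_Sset1 v) => x [].
Qed.

Let measurable_tie e (X : T -> R) : measurable_fun [set: T] X ->
  measurable [set w | X w = S e w].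
Proof.
move=> mX; rewrite (_ : [set w | _] = (fun w => X w == S e w) @^-1` [set true]).
  rewrite -[X in measurable X]setTI.
  by apply: (measurable_fun_eqr mX (measurable_funPT (S e))).
by apply/seteqP; split => w /= /eqP.
Qed.

(** Integrating over the size of [e] with all other sources frozen, [X] is a constant, which an
    atomless variable almost surely avoids. *)
Lemma job_avoids e (X : T -> R) : measurable_fun [set: others_type e] X ->
  P [set w | X w = S e w] = 0%E.
Proof.
move=> mX; have mXT : measurable_fun [set: T] X := measurable_fun_joint source_measurable mX.
have mdiag : measurable_fun [set: R * R] (fun z => ((z.1 == z.2)%:R : R)%:E).
  apply/measurable_EFinP; apply: measurable_bool_indicator.
  by apply: measurable_fun_eqr; [exact: measurable_fst|exact: measurable_snd].
have := independent_fubini (P := P) (F := fun z : R * R => ((z.1 == z.2)%:R : R)%:E) mXT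
  (measurable_funPT (S e)) _ mdiag _.
move=> /(_ _ _); rewrite /=.
have mA := measurable_tie e mXT.
rewrite -(setIT [set w | _]) -integral_indic//.
have -> : (\int[P]_w (\1_[set w | X w = S e w] w)%:E =
    \int[P]_w ((X w == S e w)%:R)%:E)%E.
  apply: eq_integral => w _; rewrite indicE; congr (nat_of_bool _)%:R%:E.
  by apply/idP/eqP => [/set_mem//|?]; exact/mem_set.
move=> ->.
- apply: integral0_eq => x _.
  rewrite -(job_atomless e (X x)) -(setIT (S e @^-1` _)) -integral_indic//.
  apply: eq_integral => w _; rewrite indicE; congr (nat_of_bool _)%:R%:E.
  by apply/eqP/idP => [?|/set_mem//]; exact/mem_set.
- move=> A B mAB mB; apply: (joint_independent source_sigma source_measurable
    source_independent (J := [set o | o <> Some e]) (j := Some e)).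
  + by [].
  + by rewrite -[X in <<s _ >> X]setTI; exact: mX.
  + by apply: sub_sigma_algebra; exists tt => //; exists B => //; rewrite setTI.
- by move=> z; rewrite lee_fin.
Qed.

Variables (mu t : R).

(* The end of a backward window: an arrival, or the current time. *)
Let endpoint (o : option label) w : \bar R := if o is Some e then arr e w else t%:E.

(** The work of the window opened by the arrival of [e], without the job of [e] itself; it is
    determined by the arrivals and the other job sizes. *)
Let others e o w : \bar R := (\esum_(e' in ~` [set e])
  ((job S e' w)%:E * ((arr e w <= arr e' w)%E && (arr e' w < endpoint o w)%E)%:R%:E))%E.

Let measurable_arr e e' : measurable_fun [set: others_type e] (arr e').
Proof.
by apply: (@measurable_fun_factor _ _ _ source _ _ _ None); last exact: measurable_sigma_of.
Qed.

Let measurable_endpoint e o : measurable_fun [set: others_type e] (endpoint o).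
Proof. by case: o => [e'|] /=; [exact: measurable_arr|exact: measurable_cst]. Qed.

Let measurable_others e o : measurable_fun [set: others_type e] (others e o).
Proof.
apply: measurable_esum => [e' /= e'e|e' w _]; last by rewrite mule_ge0 ?lee_fin ?job_ge0.
apply: emeasurable_funM.
  apply/measurable_EFinP; apply: measurable_maxr; last exact: measurable_cst.
  apply: (@measurable_fun_factor _ _ _ source _ _ _ (Some e')); first by move=> [].
  exact: (@measurable_sigma_of _ _ _ _ _ (fun _ : unit => S e' : T -> R) tt).
apply/measurable_EFinP.
have -> : (fun w => ((arr e w <= arr e' w)%E && (arr e' w < endpoint o w)%E)%:R : R) =
    (fun w => (arr e w <= arr e' w)%E%:R * (arr e' w < endpoint o w)%E%:R).
  by apply/funext => w; rewrite -natrM mulnb.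
apply: measurable_funM; apply: measurable_bool_indicator.
  by apply: measurable_fun_lee; exact: measurable_arr.
by apply: measurable_fun_lte; [exact: measurable_arr|exact: measurable_endpoint].
Qed.

Let input_split e o x y w : finite_input imm off S w -> 0 < S e w ->
  arr e w = x%:E -> endpoint o w = y%:E -> x < y ->
  input setT x y w = S e w + fine (others e o w).
Proof.
move=> fw S0 ex oy xy.
have term e' : ((job S e' w)%:E * ext2 (windows setT [:: (x, y)]) (birth imm off e' w) =
    (job S e' w)%:E * ((arr e w <= arr e' w)%E && (arr e' w < endpoint o w)%E)%:R%:E)%E.
  congr (_ * _)%E; rewrite ex oy; case E : (arr e' w) => [z| |].
  - have [x0 ->] := arrival_finite_imm E.
    by rewrite /ext2/= windowsT1/= indicE mem_setE in_itv/= lee_fin lte_fin.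
  - by rewrite /birth E /ext2/=; case: imm => [?| |]; rewrite ?ltNge ?leey ?andbF.
  - by rewrite /birth E /ext2/=; case: imm => [?| |].
have j0 e' : (0 <= (job S e' w)%:E *
    ((arr e w <= arr e' w)%E && (arr e' w < endpoint o w)%E)%:R%:E)%E.
  by rewrite mule_ge0 ?lee_fin ?job_ge0.
have workE : work imm off S (windows setT [:: (x, y)]) w = ((S e w)%:E + others e o w)%E.
  rewrite /work (eq_esum (fun e' _ => term e')) (esumID [set e])// !setTI.
  rewrite esum_set1// /others; congr (_ + _)%E.
  by rewrite ex oy lexx lte_fin xy mule1 /job max_l// ltW.
have o0 : (0 <= others e o w)%E by apply: esum_ge0 => e' _; exact: j0.
have := fw x y; rewrite /input workE.
by case: (others e o w) o0 => [z| |].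
Qed.

(** The job of [e] is counted in the window that its arrival opens. A tie would therefore force
    [S e] to equal the quantity [X], which the other sources determine. Countably many pairs of
    endpoints suffice. *)
Lemma ae_no_tie : {ae P, forall w, forall (eo : label * option label) (x y : R),
  arr eo.1 w = x%:E -> endpoint eo.2 w = y%:E -> x < y ->
  input setT x y w != mu * (y - x)}.
Proof.
apply: ae_forall_countable => -[e o] /=.
pose X w := mu * (fine (endpoint o w) - fine (arr e w)) - fine (others e o w).
have mX : measurable_fun [set: others_type e] X.
  have mfine (g : T -> \bar R) : measurable_fun [set: others_type e] g ->
      measurable_fun [set: others_type e] (fine \o g).
    exact: (measurableT_comp (@fine_measurable R setT measurableT)).
  have me := mfine _ (@measurable_endpoint e o).
  have ma := mfine _ (@measurable_arr e e).
  have mo := mfine _ (@measurable_others e o).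
  exact: (measurable_funB (measurable_funM (measurable_cst mu) (measurable_funB me ma)) mo).
have mXT : measurable_fun [set: T] X := measurable_fun_joint source_measurable mX.
have mA := measurable_tie e mXT.
have avoid : {ae P, forall w, X w <> S e w}.
  exists [set w | X w = S e w]; split => //; first exact: job_avoids.
  by move=> w /= /contrapT.
have fin := ae_finite_input lambda0_gt0 m0 m1 f_density hawkes V_density V_mean jobs.
have pos := ae_job_gt0 V_density jobs.
near=> w => x y ex oy xy.
apply/eqP => tie; have : X w <> S e w by near: w.
apply; rewrite /X ex oy/= -tie (@input_split e o)//.
- by rewrite addrK.
- by near: w.
- by suff: forall e, 0 < S e w by []; near: w.
Unshelve. all: by end_near. Qed.

End Ties.

(** * Stationarity *)

Lemma argmax_path_ext (R : realType) (mu t t' : R) (p p' : paths (seq (R * R)) R) :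
  (forall s, backward mu t p s = backward mu t' p' s) ->
  argmax_path mu t p = argmax_path mu t' p'.
Proof.
move=> pp'; have reach c : reached_by mu t c p <-> reached_by mu t' c p'.
  by split => h q k /(h q k)[q' [q'c le]]; exists q'; split => //; move: le; rewrite !pp'.
rewrite /argmax_path; congr (fine (esups _ _)); apply/funext => n.
rewrite /last_unreached; case: pickle_inv => // c; rewrite !indicE.
congr (_ * (nat_of_bool _)%:R)%:E; apply/idP/idP => /set_mem nr; apply/mem_set => /reach.
  exact: nr.
exact: nr.
Qed.

Lemma argmax_input_shift d (T : measurableType d) (R : realType) (P : probability T R)
    (imm : nat -> T -> \bar R) (off : label -> nat -> T -> \bar R)
    (S : label -> {RV P >-> R}) (mu t u : R) (w : T) :
  argmax_path mu (t + u) (input_path imm off S w) =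
  argmax_path mu t (shifted_path imm off S u w).
Proof.
apply: argmax_path_ext => s.
have now := load_survival imm off S setT (t + u - s) (t + u) w.
have later := load_shifted_path imm off S u (t - s) t w.
have e : t - s + u = t + u - s by rewrite addrAC.
rewrite e in later.
exact: (congr1 (fun x => x - mu * s) (etrans now (esym later))).
Qed.

(** * Maximizer and busy period of a regular sample path *)

Section RegularWindow.
Context d (T : measurableType d) (R : realType) (P : probability T R).
Context (imm : nat -> T -> \bar R) (off : label -> nat -> T -> \bar R).
Context (S : label -> {RV P >-> R}) (c mu : R) (w : T).
Local Notation arr := (arrival imm off).
Local Notation input := (input imm off S).
Hypotheses (c_gt0 : 0 < c) (c_mu : c < mu).
Hypothesis finite_w : finite_input imm off S w.
Hypothesis finite_arrivals_w : forall a b : R,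
  finite_set [set e | (a%:E <= arr e w)%E /\ (arr e w < b%:E)%E].
Hypothesis job_gt0_w : forall e, 0 < S e w.
Hypothesis stable_w : exists M : nat, forall n : nat,
  input setT (- n%:R) 0 w < c * n%:R + M%:R.

Let mu_gt0 : 0 < mu. Proof. exact: lt_trans c_mu. Qed.

Let ext2_window e x y : ext2 (windows setT [:: (x, y)]) (birth imm off e w) =
  ((x%:E <= arr e w)%E && (arr e w < y%:E)%E)%:R%:E.
Proof.
case E : (arr e w) => [z| |].
- have [x0 ->] := arrival_finite_imm E.
  by rewrite /ext2/= windowsT1/= indicE mem_setE in_itv/= lee_fin lte_fin.
- by rewrite /birth E /ext2/=; case: imm => [?| |]; rewrite ?ltNge ?leey ?andbF.
- by rewrite /birth E /ext2/=; case: imm => [?| |].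
Qed.

Let arrivals : set R := [set x | exists e, arr e w = x%:E].

Let arrivals_finite a b : finite_set (arrivals `&` `[a, b[).
Proof.
apply: (@sub_finite_set _ _ ((fun e => fine (arr e w)) @`
    [set e | (a%:E <= arr e w)%E /\ (arr e w < b%:E)%E])).
  move=> x [[e ex]]; rewrite /= in_itv/= => /andP[ax xb].
  by exists e; rewrite /= ex ?lee_fin ?lte_fin.
exact: finite_image.
Qed.

Let input_no_arrival a b : arrivals `&` `[a, b[ = set0 -> input setT a b w = 0.
Proof.
move=> none; rewrite /input (_ : work _ _ _ _ w = 0)%E//; apply: esum1 => e _.
rewrite ext2_window; case: (boolP (_ && _)) => [/andP[ae eb]|_]; last by rewrite mule0.
exfalso; case E : (arr e w) ae eb => [x| |]//; rewrite lee_fin lte_fin => ax xb.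
have : (arrivals `&` `[a, b[) x by split; [exists e|rewrite /= in_itv/= ax].
by rewrite none.
Qed.

Let drift (t : R) : exists s0, forall s, s0 < s -> input setT (t - s) t w < mu * s.
Proof.
have [M stable] := stable_w.
pose N := (Num.truncn `|t|).+1.
have tN : `|t| < N%:R by exact: truncnS_gt.
pose C := input setT 0 N%:R w.
have C0 : 0 <= C by exact: input_ge0.
(* [stable] controls only the windows [[-n, 0[]. Enclosing [[t - s, t[] in [[-n, N[] with
   [n <= s - t + 1] bounds its work by [c (s - t + 1) + M + C], which is below [mu s] beyond this
   lag; the summand with the absolute value of [t] ensures [s - t >= 0]. *)
exists (`|t| + (c * (1 + `|t|) + M%:R + C) / (mu - c)) => s s0s.
have k0 : 0 < mu - c by rewrite subr_gt0.
have q0 : 0 <= (c * (1 + `|t|) + M%:R + C) / (mu - c).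
  by rewrite divr_ge0 ?(ltW k0)// !addr_ge0// mulr_ge0// ?addr_ge0// ltW.
have st : `|t| < s by lra.
have t1 := ler_norm t; have t2 := ler_norm (- t); rewrite normrN in t2.
pose n := (Num.truncn (s - t)).+1.
have st0 : 0 <= s - t by lra.
have nge : s - t < n%:R by exact: truncnS_gt.
have nle : n%:R <= s - t + 1.
  by rewrite -natr1 lerD2r truncn_le.
have F1 : input setT (- n%:R) N%:R w = input setT (- n%:R) 0 w + C.
  by apply: inputD => //; rewrite oppr_le0.
have F2 : input setT (- n%:R) N%:R w =
    input setT (- n%:R) (t - s) w + input setT (t - s) N%:R w by apply: inputD => //; lra.
have F3 : input setT (t - s) N%:R w = input setT (t - s) t w + input setT t N%:R w.
  by apply: inputD => //; lra.
have i1 := input_ge0 imm off S setT (- n%:R) (t - s) w.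
have i2 := input_ge0 imm off S setT t N%:R w.
have := stable n.
have cn : c * n%:R <= c * (s - t + 1) by rewrite ler_wpM2l// ltW.
have big : c * (1 + `|t|) + M%:R + C < (mu - c) * s.
  by rewrite [ltRHS]mulrC -ltr_pdivrMr//; apply: le_lt_trans s0s; rewrite lerDr.
have ct : - (c * t) <= c * `|t| by rewrite -mulrN ler_wpM2l// ltW.
lra.
Qed.

Lemma backward_inputE (t s : R) : 0 <= s ->
  backward_input arr S mu t s w = (input setT (t - s) t w - mu * s)%:E.
Proof.
move=> s0; rewrite /backward_input [RHS]EFinB inputE//; congr (_ - _)%E.
rewrite esum_mkcond /work; apply: eq_esum => e _; rewrite ext2_window.
have -> : job S e w = S e w by rewrite /job max_l// ltW.
case: ifPn => [/set_mem[/= -> ->]|]; first by rewrite mule1.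
move=> /negP ne; case: (boolP (_ && _)) => [/andP[h1 h2]|_]; last by rewrite mule0.
by exfalso; apply: ne; exact/mem_set.
Qed.

Variable t : R.
Hypothesis no_tie_w : forall (eo : label * option label) (x y : R),
  arr eo.1 w = x%:E ->
  (if eo.2 is Some e then arr e w else t%:E) = y%:E -> x < y ->
  input setT x y w != mu * (y - x).

Lemma regular_argmax : exists X, [/\ maximizers arr S mu t w = [set X],
  argmax_path mu t (input_path imm off S w) = X &
  X%:E = observed_busy_period arr S mu t w].
Proof.
have no_tie a b : arrivals a -> arrivals b \/ b = t -> a < b ->
    input setT a b w != mu * (b - a).
  move=> [e ea] [[e' eb]|bt] ab; first exact: (no_tie_w (eo := (e, Some e'))).
  by apply: (no_tie_w (eo := (e, None))); rewrite //= bt.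
have [X [delta [X0 d0 Xmax gap]]] := exists_unique_maximizer mu_gt0
  (fun a b c => @inputD _ _ _ _ imm off S a b c w finite_w) arrivals_finite
  input_no_arrival (drift t) no_tie.
have Xge s : 0 <= s -> input setT (t - s) t w - mu * s <= input setT (t - X) t w - mu * X.
  by move=> s0; have [->//|sX] := eqVneq s X; exact/ltW/Xmax.
exists X; split.
- apply/seteqP; split => [s [s0 smax]|_ ->] /=.
    apply/eqP; apply: contraT => sX; have := smax X X0.
    by rewrite !backward_inputE// lee_fin leNgt Xmax.
  by split => // s s0; rewrite !backward_inputE// lee_fin Xge.
- apply: (argmax_pathE mu_gt0 X0 d0).
  + by move=> a b b' ab bb'; rewrite !load_survival; exact: le_input.
  + by move=> s s0; rewrite /backward !load_survival; exact: Xge.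
  + by move=> s s0 sX; rewrite /backward !load_survival; exact: gap.
rewrite /observed_busy_period (_ : ereal_sup _ = (t - X)%:E); last first.
  apply/eqP; rewrite eq_le; apply/andP; split.
    apply: ge_ereal_sup => _ [s [st Ws] <-]; rewrite lee_fin leNgt; apply/negP => tXs.
    have ts0 : 0 <= t - s by lra.
    have tsX : t - s != X by rewrite lt_eqF//; lra.
    have sX0 : 0 <= s - (t - X) by lra.
    (* The path from [t] at lag [X] is its value at lag [t - s] plus the path from [s] at lag
       [s - (t - X)]. Strict maximality of [X] makes the last term positive, against [Ws]. *)
    have : ((input setT (t - X) s w - mu * (s - (t - X)))%:E <= 0)%E.
      rewrite -Ws; apply: ereal_sup_ubound; exists (s - (t - X)) => //.
      by rewrite backward_inputE// subKr.
    rewrite lee_fin; have := Xmax _ ts0 tsX; rewrite subKr.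
    by rewrite (@inputD _ _ _ _ _ _ _ (t - X) s t)//; lra.
  apply: ereal_sup_ubound; exists (t - X) => //=; split; first by lra.
  apply/eqP; rewrite eq_le; apply/andP; split.
    apply: ge_ereal_sup => _ [s /= s0 <-]; rewrite backward_inputE// lee_fin.
    have sX0 : 0 <= s + X by lra.
    (* Comparing the lags [s + X] and [X] and cancelling the work in [[t - X, t[] shows that the
       path from [t - X] is nowhere positive. *)
    have := Xge _ sX0; rewrite (_ : t - (s + X) = t - X - s); last by ring.
    by rewrite (@inputD _ _ _ _ _ _ _ (t - X - s) (t - X) t)//; lra.
  apply: ereal_sup_ubound; exists 0 => /=; first exact: lexx.
  rewrite backward_inputE// subr0 mulr0 subr0 input_no_arrival//.
  apply/seteqP; split => // x [_] /=.
  by rewrite in_itv/= => /andP[h /(le_lt_trans h)]; rewrite ltxx.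
by rewrite -EFinB subKr.
Qed.

End RegularWindow.

Theorem proposition2 (R : realType) (d : measure_display)
  (T : measurableType d) (P : probability T R)
  (lambda0 m : R) (f : R -> R)
  (imm : nat -> T -> \bar R) (off : label -> nat -> T -> \bar R)
  (V : {RV P >-> R}) (S : label -> {RV P >-> R})
  (eps mu_lo mu_hi mu : R) :
  0 < lambda0 -> 0 < m -> m < 1 ->
  prob_density `[0, +oo[ f ->
  stationary_hawkes P lambda0 m f imm off ->
  positive_with_continuous_density V ->
  ('E_P[V] = 1)%E ->
  iid_job_sizes (arrival imm off) V S ->
  0 < eps -> 0 < mu_lo ->
  (lambda0%:E * 'E_P[V] * (1 - m)^-1%:E < (mu_lo - eps)%:E)%E ->
  mu_lo <= mu -> mu <= mu_hi ->
  let X := arg_maximum (arrival imm off) S mu in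
  stationary_process P X /\
  (forall t : R, 0 <= t ->
     {ae P, forall w,
        maximizers (arrival imm off) S mu t w = [set X t w] /\
        (X t w)%:E = observed_busy_period (arrival imm off) S mu t w}).
Proof.
move=> lambda0_gt0 m0 m1 f_density hawkes V_density V_mean jobs eps0 _.
rewrite V_mean mule1 -EFinM lte_fin => stable mu_lo_mu _ X.
(* The slope at which stability is proved: it lies strictly between the mean rate of arriving work
   and [mu], so that the backward path has negative drift. *)
have c_gt0 : 0 < mu_lo - eps.
  by apply: le_lt_trans stable; rewrite divr_ge0// ?(ltW lambda0_gt0)// subr_ge0 ltW.
have c_mu : mu_lo - eps < mu by lra.
have regular t : {ae P, forall w, exists x,
    [/\ maximizers (arrival imm off) S mu t w = [set x],
      argmax_path mu t (input_path imm off S w) = x &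
      x%:E = observed_busy_period (arrival imm off) S mu t w]}.
  have fin := ae_finite_input lambda0_gt0 m0 m1 f_density hawkes V_density V_mean jobs.
  have arrs := ae_finite_arrivals lambda0_gt0 m0 m1 f_density hawkes.
  have pos := ae_job_gt0 V_density jobs.
  have sta := ae_stable lambda0_gt0 m0 m1 f_density hawkes V_density V_mean jobs stable.
  have tie := ae_no_tie lambda0_gt0 m0 m1 f_density hawkes V_density V_mean jobs mu t.
  near=> w; apply: (@regular_argmax _ _ _ _ imm off S (mu_lo - eps) mu w c_gt0 c_mu).
  - by near: w.
  - by near: w.
  - by near: w.
  - by near: w.
  - by near: w.
have XE t w x : maximizers (arrival imm off) S mu t w = [set x] -> X t w = x.
  move=> maxx; rewrite /X /arg_maximum maxx.
  exact: (xgetPex 0 (ex_intro [set x] x erefl)).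
split; last first.
  move=> t _; apply: filterS (regular t) => w [x [maxx _ busy]].
  by rewrite (XE _ _ _ maxx).
have mY t : measurable_fun [set: T] (argmax_path mu t \o input_path imm off S).
  exact: (measurableT_comp (measurable_argmax_path mu t) (measurable_input_path S hawkes)).
(* [X t] depends on an arbitrary choice where the maximizer is missing or not unique; [Y t] is
   measurable everywhere and agrees with it almost surely. *)
pose Y t : {RV P >-> R} := HB.pack (argmax_path mu t \o input_path imm off S)
  (isMeasurableFun.Build _ _ _ _ _ (mY t)).
exists Y; split.
  move=> t _; apply: filterS (regular t) => w [x [maxx ax _]].
  by rewrite (XE _ _ _ maxx) -ax.
move=> n t u B _ _ mB.
(* The event at finitely many times is a single event of the input path, so invariance of the law of
   that path yields all finite-dimensional laws at once. *)
pose E := \bigcap_(i in [set: 'I_n]) (argmax_path mu (t i) @^-1` B i).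
have mE : measurable (E : set (paths (seq (R * R)) R)).
  apply: fin_bigcap_measurable => // i _; rewrite -[X in measurable X]setTI.
  by apply: (measurable_argmax_path mu (t i)).
have Y_shift i w : Y (t i + u) w = argmax_path mu (t i) (shifted_path imm off S u w).
  exact: argmax_input_shift.
have YE i w : Y (t i) w = argmax_path mu (t i) (input_path imm off S w) by [].
have shiftedE : \bigcap_(i in [set: 'I_n]) (Y (t i + u) @^-1` B i) =
    shifted_path imm off S u @^-1` E.
  apply/seteqP; split => w Bw i iT; have h := Bw i iT.
    have {}h : B i (Y (t i + u) w) := h.
    by rewrite Y_shift in h.
  suff : B i (Y (t i + u) w) by [].
  by rewrite Y_shift.
have currentE : \bigcap_(i in [set: 'I_n]) (Y (t i) @^-1` B i) = input_path imm off S @^-1` E.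
  apply/seteqP; split => w Bw i iT; have h := Bw i iT.
    have {}h : B i (Y (t i) w) := h.
    by rewrite YE in h.
  suff : B i (Y (t i) w) by [].
  by rewrite YE.
have law := shifted_path_law lambda0_gt0 m0 m1 f_density hawkes jobs u mE.
exact: (etrans (congr1 P shiftedE) (etrans law (esym (congr1 P currentE)))).
Unshelve. all: by end_near. Qed.
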